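(* Let $k$ be a field of characteristic zero, let $\mathscr{U}\subseteq\mathscr{G}$ be a widely closed full replete subcategory, and let $\mathscr{V}\subseteq\mathscr{U}$ be a multiplicative global family. Then the thick ideal $$\mathfrak{p}_{\mathscr{V}}=\{X\in\mathsf{D}(\mathscr{U})^c\mid H_*(X(G))=0\ \text{ for all } G\in\mathscr{V}\}$$ is prime in $\mathsf{D}(\mathscr{U})^c$. In particular, when $\mathscr{U}=\mathscr{V}$ is itself a multiplicative global family, the zero ideal is prime in $\mathsf{D}(\mathscr{U})^c$.
   Context: $\mathscr{G}$ is the category of finite groups with morphisms the conjugacy classes of surjective group homomorphisms. A full subcategory $\mathscr{U}\subseteq\mathscr{G}$ closed under isomorphism (replete) is widely closed if whenever $G\twoheadleftarrow H\twoheadrightarrow K$ are surjective homomorphisms with $G,H,K\in\mathscr{U}$, the image of $H\to G\times K$ lies in $\mathscr{U}$. A multiplicative global family is a full replete subcategory of $\mathscr{G}$ closed under finite products (including the empty product, so it contains the trivial group), subgroups and quotients. $\mathsf{D}(\mathscr{U})$ is the derived category of $\mathrm{Fun}(\mathscr{U}^{\mathrm{op}},\mathrm{Mod}_k)$, with the pointwise tensor product over $k$, and $\mathsf{D}(\mathscr{U})^c$ is its full subcategory of compact objects. Since $\mathscr{U}$ is widely closed and contains the trivial group, $\mathsf{D}(\mathscr{U})^c$ is a tensor-triangulated subcategory of $\mathsf{D}(\mathscr{U})$. A thick ideal is a full triangulated subcategory closed under retracts and under tensoring with any object; it is prime if it is proper and $X\otimes Y\in\mathfrak{p}$ implies $X\in\mathfrak{p}$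 or $Y\in\mathfrak{p}$. *)

(* Defs.v *)
From HB Require Import structures.
From mathcomp Require Import all_boot all_order all_algebra all_fingroup.
From mathcomp Require Import boolp.

Set Implicit Arguments.
Unset Strict Implicit.
Unset Printing Implicit Defensive.

Import GRing.Theory.
Local Open Scope ring_scope.

Record epi (H G : finGroupType) := Epi {
  epi_fun :> {multiplicative H -> G};
  epi_surj : forall y, exists x, epi_fun x = y }.

Lemma id_epi_surj (G : finGroupType) : forall y : G, exists x, idfun x = y.
Proof. by move=> y; exists y. Qed.

Definition id_epi (G : finGroupType) : epi G G :=
  @Epi G G idfun (@id_epi_surj G).

Lemma comp_epi_surj (K H G : finGroupType) (f : epi H G) (g : epi K H) :
  forall y, exists x, (f \o g) x = y.
Proof.
by move=> y; have [z <-] := epi_surj f y; have [x <-] := epi_surj g z; exists x.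
Qed.

Definition comp_epi (K H G : finGroupType) (f : epi H G) (g : epi K H) :
  epi K G := @Epi K G (f \o g) (comp_epi_surj f g).

(* The morphisms of the category are the classes of [epi H G] for this
   relation; instead of forming the quotient, every construction below is
   required to respect it. *)
Definition epi_conj (H G : finGroupType) (f g : epi H G) : Prop :=
  exists a : G, forall x, g x = (f x ^ a)%g.

Definition group_family := finGroupType -> Prop.

Definition replete (U : group_family) : Prop := forall G H : finGroupType,
  U G -> [set: G] \isog [set: H] -> U H.

Lemma epi1 (H G : finGroupType) (f : epi H G) : f 1%g = 1%g.
Proof. by apply: (mulgI (f 1%g)); rewrite -gmulfM !mulg1. Qed.

Lemma epi_pair_group_set (H G K : finGroupType) (f : epi H G) (g : epi H K) :
  group_set [set (f x, g x) | x : H].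
Proof.
apply/group_setP; split.
  by apply/imsetP; exists 1%g; rewrite ?inE // !epi1.
move=> _ _ /imsetP[x _ ->] /imsetP[y _ ->].
by apply/imsetP; exists (x * y)%g; rewrite ?inE // !gmulfM.
Qed.

Definition epi_pair_image (H G K : finGroupType) (f : epi H G) (g : epi H K) :
  {group (G * K)%type} := group (epi_pair_group_set f g).

Definition widely_closed (U : group_family) : Prop :=
  forall (G H K : finGroupType) (f : epi H G) (g : epi H K),
    U G -> U H -> U K -> U (subg_of (epi_pair_image f g)).

Definition multiplicative_global_family (V : group_family) : Prop :=
  [/\ replete V,
      forall G : finGroupType, #|G| = 1%N -> V G,
      forall G H : finGroupType, V G -> V H -> V (G * H)%type,
      forall (G : finGroupType) (H : {group G}), V G -> V (subg_of H)
    & forall (G : finGroupType) (N : {group G}),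
        V G -> (N <| [set: G])%g -> V (coset_of N)].

Record member (U : group_family) := Member {
  member_group :> finGroupType;
  memberP : U member_group }.

Section MkLinear.
Variables (k : fieldType) (A B : lmodType k) (f : A -> B) (fP : linear f).
HB.instance Definition _ := GRing.isLinear.Build k A B _ f fP.
Definition mk_linear : {linear A -> B} := f.
End MkLinear.

Section Functors.
Variables (k : fieldType) (U : group_family).

Record gfunctor := GFunctor {
  ob :> member U -> lmodType k;
  res : forall H G : member U, epi H G -> {linear ob G -> ob H};
  res_conj : forall (H G : member U) (f g : epi H G),
    epi_conj f g -> res f =1 res g;
  res_id : forall (G : member U) (x : ob G), res (id_epi G) x = x;
  res_comp : forall (K H G : member U) (f : epi H G) (g : epi K H) (x : ob G),
    res (comp_epi f g) x = res g (res f x) }.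

Record nat_trans (X Y : gfunctor) := NatTrans {
  nt :> forall G : member U, {linear X G -> Y G};
  nt_natural : forall (H G : member U) (f : epi H G) (x : X G),
    nt H (res X f x) = res Y f (nt G x) }.

Section NatTransOps.
Variables X Y Z : gfunctor.

Fact nt_id_natural (H G : member U) (f : epi H G) (x : X G) :
  idfun (res X f x) = res X f (idfun x).
Proof. by []. Qed.
Definition nt_id : nat_trans X X :=
  @NatTrans X X (fun G => idfun) nt_id_natural.

Fact nt_comp_natural (g : nat_trans Y Z) (f : nat_trans X Y)
    (H G : member U) (e : epi H G) (x : X G) :
  (g H \o f H) (res X e x) = res Z e ((g G \o f G) x).
Proof. by rewrite /= !nt_natural. Qed.
Definition nt_comp (g : nat_trans Y Z) (f : nat_trans X Y) : nat_trans X Z :=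
  @NatTrans X Z (fun G => g G \o f G) (nt_comp_natural g f).

Fact nt_add_natural (f g : nat_trans X Y) (H G : member U) (e : epi H G)
    (x : X G) :
  (f H \+ g H) (res X e x) = res Y e ((f G \+ g G) x).
Proof. by rewrite /= !nt_natural linearD. Qed.
Definition nt_add (f g : nat_trans X Y) : nat_trans X Y :=
  @NatTrans X Y (fun G => f G \+ g G) (nt_add_natural f g).

Fact nt_opp_natural (f : nat_trans X Y) (H G : member U) (e : epi H G)
    (x : X G) :
  (\- f H) (res X e x) = res Y e ((\- f G) x).
Proof. by rewrite /= nt_natural linearN. Qed.
Definition nt_opp (f : nat_trans X Y) : nat_trans X Y :=
  @NatTrans X Y (fun G => \- f G) (nt_opp_natural f).

End NatTransOps.

Section DirectSum.
Variables X Y : gfunctor.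

Definition sum_ob (G : member U) : lmodType k := (X G * Y G)%type.

Definition sum_res_fun (H G : member U) (e : epi H G) (u : sum_ob G) :
  sum_ob H := (res X e u.1, res Y e u.2).

Fact sum_res_linear (H G : member U) (e : epi H G) :
  linear (@sum_res_fun H G e).
Proof. by move=> a u v; rewrite /sum_res_fun /= !linearP. Qed.

Definition sum_res (H G : member U) (e : epi H G) :
  {linear sum_ob G -> sum_ob H} := mk_linear (sum_res_linear e).

Fact sum_res_conj (H G : member U) (f g : epi H G) :
  epi_conj f g -> sum_res f =1 sum_res g.
Proof.
by move=> fg u; congr pair; rewrite (res_conj fg).
Qed.

Fact sum_res_id (G : member U) (u : sum_ob G) : sum_res (id_epi G) u = u.
Proof. by case: u => x y; congr pair; rewrite res_id. Qed.

Fact sum_res_comp (K H G : member U) (f : epi H G) (g : epi K H)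
    (u : sum_ob G) :
  sum_res (comp_epi f g) u = sum_res g (sum_res f u).
Proof. by congr pair; rewrite res_comp. Qed.

Definition gsum : gfunctor := GFunctor sum_res_conj sum_res_id sum_res_comp.

End DirectSum.

(* Homological, unbounded; the differential [diff n] goes from degree [n] to
   degree [n - 1]. *)
Record complex := Complex {
  cx_ob :> int -> gfunctor;
  diff : forall n : int, nat_trans (cx_ob n) (cx_ob (n - 1));
  dd : forall (n : int) (G : member U) (x : cx_ob n G),
    diff (n - 1) G (diff n G x) = 0 }.

Record chain_map (X Y : complex) := ChainMap {
  cm :> forall n : int, nat_trans (X n) (Y n);
  cm_d : forall (n : int) (G : member U) (x : X n G),
    cm (n - 1) G (diff X n G x) = diff Y n G (cm n G x) }.

Section ChainMapOps.
Variables X Y Z : complex.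

Fact chain_id_d (n : int) (G : member U) (x : X n G) :
  nt_id (X (n - 1)) G (diff X n G x) = diff X n G (nt_id (X n) G x).
Proof. by []. Qed.
Definition chain_id : chain_map X X :=
  @ChainMap X X (fun n => nt_id (X n)) chain_id_d.

Fact chain_comp_d (g : chain_map Y Z) (f : chain_map X Y)
    (n : int) (G : member U) (x : X n G) :
  nt_comp (g (n - 1)) (f (n - 1)) G (diff X n G x)
  = diff Z n G (nt_comp (g n) (f n) G x).
Proof. by rewrite /= !cm_d. Qed.
Definition chain_comp (g : chain_map Y Z) (f : chain_map X Y) :
  chain_map X Z :=
  @ChainMap X Z (fun n => nt_comp (g n) (f n)) (chain_comp_d g f).

Fact chain_add_d (f g : chain_map X Y) (n : int) (G : member U) (x : X n G) :
  nt_add (f (n - 1)) (g (n - 1)) G (diff X n G x)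
  = diff Y n G (nt_add (f n) (g n) G x).
Proof. by rewrite /= !cm_d linearD. Qed.
Definition chain_add (f g : chain_map X Y) : chain_map X Y :=
  @ChainMap X Y (fun n => nt_add (f n) (g n)) (chain_add_d f g).

End ChainMapOps.

(* Homology is computed groupwise.  Degrees are written [n - 1] so that cycles
   [x : X (n - 1) G] and boundaries [diff X n G y] have the same type; [n]
   ranges over all integers, hence so does [n - 1]. *)

Definition is_cycle (X : complex) (G : member U) (n : int) (x : X (n - 1) G) :
  Prop := diff X (n - 1) G x = 0.

Definition homologous (X : complex) (G : member U) (n : int)
    (x y : X (n - 1) G) : Prop :=
  exists z : X n G, diff X n G z = x - y.

Definition homology_zero (X : complex) (G : member U) : Prop :=
  forall (n : int) (x : X (n - 1) G), is_cycle x -> homologous x 0.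

Definition quasi_iso (X Y : complex) (s : chain_map X Y) : Prop :=
  forall (G : member U) (n : int),
    (forall x x' : X (n - 1) G, is_cycle x -> is_cycle x' ->
       homologous (s (n - 1) G x) (s (n - 1) G x') -> homologous x x')
    /\ (forall y : Y (n - 1) G, is_cycle y ->
       exists2 x : X (n - 1) G, is_cycle x & homologous (s (n - 1) G x) y).

(* Suspension: [(shift X)_n = X_(n-1)] with differential [- diff]. *)

Section Shift.
Variable X : complex.

Fact shift_dd (n : int) (G : member U) (x : X (n - 1) G) :
  nt_opp (diff X (n - 1 - 1)) G (nt_opp (diff X (n - 1)) G x) = 0.
Proof. by rewrite /= linearN dd !oppr0. Qed.

Definition shift : complex :=
  @Complex (fun n => X (n - 1)) (fun n => nt_opp (diff X (n - 1))) shift_dd.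

End Shift.

Fact chain_shift_d (X Y : complex) (f : chain_map X Y) (n : int) (G : member U)
    (x : shift X n G) :
  f (n - 1 - 1) G (diff (shift X) n G x) = diff (shift Y) n G (f (n - 1) G x).
Proof. by rewrite /= linearN cm_d. Qed.

Definition chain_shift (X Y : complex) (f : chain_map X Y) :
  chain_map (shift X) (shift Y) :=
  @ChainMap (shift X) (shift Y) (fun n => f (n - 1)) (@chain_shift_d X Y f).

Lemma shift_cycle (X : complex) (G : member U) (n : int)
    (x : shift X (n - 1) G) :
  is_cycle x <-> @is_cycle X G (n - 1) x.
Proof.
rewrite /is_cycle /=; split=> [/eqP|->]; last exact: oppr0.
by rewrite oppr_eq0 => /eqP.
Qed.

Lemma shift_homologous (X : complex) (G : member U) n
    (x y : shift X (n - 1) G) :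
  homologous x y <-> @homologous X G (n - 1) x y.
Proof.
by split=> -[z zE]; exists (- z); rewrite -zE /= linearN ?opprK.
Qed.

Lemma quasi_iso_shift (X Y : complex) (s : chain_map X Y) :
  quasi_iso s -> quasi_iso (chain_shift s).
Proof.
move=> sP G n; have [inj sur] := sP G (n - 1); split.
  move=> x x' /shift_cycle cx /shift_cycle cx' /shift_homologous h.
  by apply/shift_homologous/inj.
move=> y /shift_cycle /sur[x cx h].
by exists x; [apply/shift_cycle|apply/shift_homologous].
Qed.

(* Mapping cone: [(cone f)_n = X_(n-1) + Y_n] with
   [diff (x, y) = (- diff x, f x + diff y)]. *)

Section Cone.
Variables (X Y : complex) (f : chain_map X Y).

Definition cone_ob (n : int) : gfunctor := gsum (X (n - 1)) (Y n).

Definition cone_d_fun (n : int) (G : member U) (u : cone_ob n G) :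
  cone_ob (n - 1) G :=
  (- diff X (n - 1) G u.1, f (n - 1) G u.1 + diff Y n G u.2).

Fact cone_d_linear (n : int) (G : member U) : linear (@cone_d_fun n G).
Proof.
move=> a u v; congr pair; rewrite /= !linearP //.
by rewrite scalerDr addrACA.
Qed.

Fact cone_d_natural (n : int) (H G : member U) (e : epi H G) (u : cone_ob n G) :
  mk_linear (@cone_d_linear n H) (res (cone_ob n) e u)
  = res (cone_ob (n - 1)) e (mk_linear (@cone_d_linear n G) u).
Proof.
by congr pair; rewrite /= !nt_natural ?linearN // linearD.
Qed.

Definition cone_d (n : int) : nat_trans (cone_ob n) (cone_ob (n - 1)) :=
  NatTrans (@cone_d_natural n).

Fact cone_dd (n : int) (G : member U) (u : cone_ob n G) :
  cone_d (n - 1) G (cone_d n G u) = 0.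
Proof.
congr pair; rewrite /=; first by rewrite linearN dd !oppr0.
by rewrite linearN linearD dd addr0 cm_d addNr.
Qed.

Definition cone : complex := Complex cone_dd.

Definition cone_in_fun (n : int) (G : member U) (y : Y n G) : cone n G :=
  (0, y).
Fact cone_in_linear (n : int) (G : member U) : linear (@cone_in_fun n G).
Proof. by move=> a u v; congr pair; rewrite /= scaler0 addr0. Qed.
Fact cone_in_natural (n : int) (H G : member U) (e : epi H G) (y : Y n G) :
  mk_linear (@cone_in_linear n H) (res (Y n) e y)
  = res (cone n) e (mk_linear (@cone_in_linear n G) y).
Proof. by congr pair; rewrite /= linear0. Qed.
Fact cone_in_d (n : int) (G : member U) (y : Y n G) :
  NatTrans (@cone_in_natural (n - 1)) G (diff Y n G y)
  = diff cone n G (NatTrans (@cone_in_natural n) G y).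
Proof. by congr pair; rewrite /= !linear0 ?oppr0 // add0r. Qed.
Definition cone_in : chain_map Y cone :=
  @ChainMap Y cone (fun n => NatTrans (@cone_in_natural n)) cone_in_d.

Definition cone_out_fun (n : int) (G : member U) (u : cone n G) :
  shift X n G := u.1.
Fact cone_out_linear (n : int) (G : member U) : linear (@cone_out_fun n G).
Proof. by []. Qed.
Fact cone_out_natural (n : int) (H G : member U) (e : epi H G) (u : cone n G) :
  mk_linear (@cone_out_linear n H) (res (cone n) e u)
  = res (shift X n) e (mk_linear (@cone_out_linear n G) u).
Proof. by []. Qed.
Fact cone_out_d (n : int) (G : member U) (u : cone n G) :
  NatTrans (@cone_out_natural (n - 1)) G (diff cone n G u)
  = diff (shift X) n G (NatTrans (@cone_out_natural n) G u).
Proof. by []. Qed.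
Definition cone_out : chain_map cone (shift X) :=
  @ChainMap cone (shift X) (fun n => NatTrans (@cone_out_natural n)) cone_out_d.

End Cone.

(* D(U) is the localization of the category of complexes at the
   quasi-isomorphisms, presented by generators and relations: its objects are
   the complexes, its morphisms the classes for [deq] of the formal expressions
   [dhom].  The relations [deq] say exactly that D(U) is a preadditive category,
   that [dmap] is an additive functor and that [dinv s] is inverse to [dmap s],
   so D(U) is universal among preadditive categories receiving an additive
   functor inverting the quasi-isomorphisms.  It is the usual localization,
   since the latter is additive with an additive localization functor. *)
Inductive dhom : complex -> complex -> Type :=
| dmap X Y : chain_map X Y -> dhom X Y
| dinv X Y (s : chain_map X Y) : quasi_iso s -> dhom Y X
| dcomp X Y Z : dhom Y Z -> dhom X Y -> dhom X Z
| dzero X Y : dhom X Y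
| dadd X Y : dhom X Y -> dhom X Y -> dhom X Y
| dopp X Y : dhom X Y -> dhom X Y.

Arguments dzero {X Y}.

Definition did (X : complex) : dhom X X := dmap (chain_id X).

Inductive deq : forall X Y : complex, dhom X Y -> dhom X Y -> Prop :=
| deq_refl X Y (f : dhom X Y) : deq f f
| deq_sym X Y (f g : dhom X Y) : deq f g -> deq g f
| deq_trans X Y (f g h : dhom X Y) : deq f g -> deq g h -> deq f h
| deq_dcomp X Y Z (f f' : dhom Y Z) (g g' : dhom X Y) :
    deq f f' -> deq g g' -> deq (dcomp f g) (dcomp f' g')
| deq_dadd X Y (f f' g g' : dhom X Y) :
    deq f f' -> deq g g' -> deq (dadd f g) (dadd f' g')
| deq_dopp X Y (f f' : dhom X Y) : deq f f' -> deq (dopp f) (dopp f')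
| dcompA W X Y Z (f : dhom Y Z) (g : dhom X Y) (h : dhom W X) :
    deq (dcomp f (dcomp g h)) (dcomp (dcomp f g) h)
| dcomp1f X Y (f : dhom X Y) : deq (dcomp (did Y) f) f
| dcompf1 X Y (f : dhom X Y) : deq (dcomp f (did X)) f
| daddA X Y (f g h : dhom X Y) : deq (dadd f (dadd g h)) (dadd (dadd f g) h)
| daddC X Y (f g : dhom X Y) : deq (dadd f g) (dadd g f)
| dadd0f X Y (f : dhom X Y) : deq (dadd dzero f) f
| daddNf X Y (f : dhom X Y) : deq (dadd (dopp f) f) dzero
| dcompDl X Y Z (f f' : dhom Y Z) (g : dhom X Y) :
    deq (dcomp (dadd f f') g) (dadd (dcomp f g) (dcomp f' g))
| dcompDr X Y Z (f : dhom Y Z) (g g' : dhom X Y) :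
    deq (dcomp f (dadd g g')) (dadd (dcomp f g) (dcomp f g'))
| dmap_ext X Y (f g : chain_map X Y) :
    (forall n G x, f n G x = g n G x) -> deq (dmap f) (dmap g)
| dmap_comp X Y Z (f : chain_map Y Z) (g : chain_map X Y) :
    deq (dmap (chain_comp f g)) (dcomp (dmap f) (dmap g))
| dmap_add X Y (f g : chain_map X Y) :
    deq (dmap (chain_add f g)) (dadd (dmap f) (dmap g))
| dinvL X Y (s : chain_map X Y) (sP : quasi_iso s) :
    deq (dcomp (dinv sP) (dmap s)) (did X)
| dinvR X Y (s : chain_map X Y) (sP : quasi_iso s) :
    deq (dcomp (dmap s) (dinv sP)) (did Y).

Definition inverse (X Y : complex) (f : dhom X Y) (g : dhom Y X) : Prop :=
  deq (dcomp g f) (did X) /\ deq (dcomp f g) (did Y).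

Definition is_iso (X Y : complex) (f : dhom X Y) : Prop :=
  exists g, inverse f g.

Definition retract (X Y : complex) : Prop :=
  exists (i : dhom X Y) (r : dhom Y X), deq (dcomp r i) (did X).

Definition zero_object (X : complex) : Prop :=
  forall Y, (forall f : dhom X Y, deq f dzero)
         /\ (forall f : dhom Y X, deq f dzero).

Fixpoint dshift (X Y : complex) (f : dhom X Y) : dhom (shift X) (shift Y) :=
  match f with
  | dmap _ _ u => dmap (chain_shift u)
  | dinv _ _ _ sP => dinv (quasi_iso_shift sP)
  | dcomp _ _ _ g h => dcomp (dshift g) (dshift h)
  | dzero _ _ => dzero
  | dadd _ _ g h => dadd (dshift g) (dshift h)
  | dopp _ _ g => dopp (dshift g)
  end.

(* Triangles isomorphic to a standard triangle
   [A -> B -> cone f -> shift A]. *)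
Definition distinguished (X Y Z : complex) (u : dhom X Y) (v : dhom Y Z)
    (w : dhom Z (shift X)) : Prop :=
  exists (A B : complex) (f : chain_map A B)
         (a : dhom A X) (b : dhom B Y) (c : dhom (cone f) Z),
    [/\ is_iso a, is_iso b & is_iso c] /\
    [/\ deq (dcomp u a) (dcomp b (dmap f)),
        deq (dcomp v b) (dcomp c (dmap (cone_in f)))
      & deq (dcomp w c) (dcomp (dshift a) (dmap (cone_out f)))].

Definition is_coproduct (I : Type) (Y : I -> complex) (S : complex)
    (inj : forall i, dhom (Y i) S) : Prop :=
  forall (Z : complex) (g : forall i, dhom (Y i) Z),
    (exists h : dhom S Z, forall i, deq (dcomp h (inj i)) (g i))
    /\ (forall h h' : dhom S Z,
          (forall i, deq (dcomp h (inj i)) (dcomp h' (inj i))) -> deq h h').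

Definition dsum (X Y : complex) (s : seq (dhom X Y)) : dhom X Y :=
  foldr (@dadd X Y) dzero s.

(* [X] is compact when, for every coproduct [S] of a family [Y], the canonical
   map from the direct sum of the [Hom(X, Y i)] to [Hom(X, S)] is bijective; an
   element of the direct sum is a family [f] vanishing outside a finite [s]. *)
Definition compact (X : complex) : Prop :=
  forall (I : choiceType) (Y : I -> complex) (S : complex)
         (inj : forall i, dhom (Y i) S), is_coproduct inj ->
    let fin_family (s : seq I) (f : forall i, dhom X (Y i)) :=
      uniq s /\ forall i, i \notin s -> deq (f i) dzero in
    let canonical (s : seq I) (f : forall i, dhom X (Y i)) :=
      dsum [seq dcomp (inj i) (f i) | i <- s] in
    (forall s f, fin_family s f ->
       deq (canonical s f) dzero -> forall i, deq (f i) dzero)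
    /\ (forall h : dhom X S,
       exists s, exists2 f, fin_family s f & deq (canonical s f) h).

End Functors.

Section Presented.
Variables (k : fieldType) (S : Type).

Inductive term : Type :=
| Gen of S
| Zero
| Add of term & term
| Opp of term
| Scale of k & term.

Variable R : term -> term -> Prop.

Inductive teq : term -> term -> Prop :=
| teq_rel t u : R t u -> teq t u
| teq_refl t : teq t t
| teq_sym t u : teq t u -> teq u t
| teq_trans t u v : teq t u -> teq u v -> teq t v
| teq_Add t t' u u' : teq t t' -> teq u u' -> teq (Add t u) (Add t' u')
| teq_Opp t t' : teq t t' -> teq (Opp t) (Opp t')
| teq_Scale a t t' : teq t t' -> teq (Scale a t) (Scale a t')
| teq_addA t u v : teq (Add t (Add u v)) (Add (Add t u) v)
| teq_addC t u : teq (Add t u) (Add u t)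
| teq_add0 t : teq (Add Zero t) t
| teq_addN t : teq (Add (Opp t) t) Zero
| teq_scaleA a b t : teq (Scale a (Scale b t)) (Scale (a * b) t)
| teq_scale1 t : teq (Scale 1 t) t
| teq_scaleDr a t u : teq (Scale a (Add t u)) (Add (Scale a t) (Scale a u))
| teq_scaleDl a b t : teq (Scale (a + b) t) (Add (Scale a t) (Scale b t)).

Definition pres := {A : term -> Prop | exists t, A = teq t}.

HB.instance Definition _ := gen_eqMixin pres.
HB.instance Definition _ := gen_choiceMixin pres.

Definition cls (t : term) : pres := exist _ (teq t) (ex_intro _ t erefl).

Lemma cls_eqP t u : cls t = cls u <-> teq t u.
Proof.
split=> [/(congr1 sval)/= e|tu].
  by rewrite e; exact: teq_refl.
apply: eq_exist; apply/funext => v; apply/propext; split=> h.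
  exact: teq_trans (teq_sym tu) h.
exact: teq_trans tu h.
Qed.

Definition rep (x : pres) : term := sval (cid (svalP x)).

Lemma repK : cancel rep cls.
Proof.
move=> [A At]; apply: eq_exist.
by rewrite /rep; case: cid => t /= ->.
Qed.

Lemma rep_cls t : teq (rep (cls t)) t.
Proof. by apply/cls_eqP; rewrite repK. Qed.

Definition pres_add x y := cls (Add (rep x) (rep y)).
Definition pres_opp x := cls (Opp (rep x)).
Definition pres_scale a x := cls (Scale a (rep x)).

Lemma clsD t u : pres_add (cls t) (cls u) = cls (Add t u).
Proof. by apply/cls_eqP/teq_Add; apply: rep_cls. Qed.
Lemma clsN t : pres_opp (cls t) = cls (Opp t).
Proof. by apply/cls_eqP/teq_Opp/rep_cls. Qed.
Lemma clsZ a t : pres_scale a (cls t) = cls (Scale a t).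
Proof. by apply/cls_eqP/teq_Scale/rep_cls. Qed.

Fact pres_addA : associative pres_add.
Proof.
move=> x y z; rewrite -[x]repK -[y]repK -[z]repK !clsD.
exact/cls_eqP/teq_addA.
Qed.
Fact pres_addC : commutative pres_add.
Proof. by move=> x y; apply/cls_eqP/teq_addC. Qed.
Fact pres_add0 : left_id (cls Zero) pres_add.
Proof. by move=> x; rewrite -[x]repK clsD; apply/cls_eqP/teq_add0. Qed.
Fact pres_addN : left_inverse (cls Zero) pres_opp pres_add.
Proof. by move=> x; rewrite -[x]repK clsN clsD; apply/cls_eqP/teq_addN. Qed.
HB.instance Definition _ :=
  GRing.isZmodule.Build pres pres_addA pres_addC pres_add0 pres_addN.

Fact pres_scaleA a b x : pres_scale a (pres_scale b x) = pres_scale (a * b) x.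
Proof. by rewrite -[x]repK !clsZ; apply/cls_eqP/teq_scaleA. Qed.
Fact pres_scale1 : left_id 1 pres_scale.
Proof. by move=> x; rewrite -[x]repK clsZ; apply/cls_eqP/teq_scale1. Qed.
Fact pres_scaleDr : right_distributive pres_scale +%R.
Proof.
move=> a x y; rewrite -[x]repK -[y]repK [_ + _]clsD !clsZ [_ + _]clsD.
exact/cls_eqP/teq_scaleDr.
Qed.
Fact pres_scaleDl x : {morph pres_scale^~ x : a b / a + b}.
Proof.
by move=> a b; rewrite -[x]repK !clsZ [RHS]clsD; apply/cls_eqP/teq_scaleDl.
Qed.
HB.instance Definition _ := GRing.Zmodule_isLmodule.Build k pres
  pres_scaleA pres_scale1 pres_scaleDr pres_scaleDl.

Definition pres_gen (x : S) : pres := cls (Gen x).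

Section Lift.
Variables (M : lmodType k) (phi : S -> M).

Fixpoint term_eval (t : term) : M :=
  match t with
  | Gen x => phi x
  | Zero => 0
  | Add t u => term_eval t + term_eval u
  | Opp t => - term_eval t
  | Scale a t => a *: term_eval t
  end.

Hypothesis phiR : forall t u, R t u -> term_eval t = term_eval u.

Lemma eval_teq t u : teq t u -> term_eval t = term_eval u.
Proof.
elim=> {t u} //=; first [by move=> *; congruence | move=> *].
- exact: addrA.
- exact: addrC.
- exact: add0r.
- exact: addNr.
- exact: scalerA.
- exact: scale1r.
- exact: scalerDr.
- exact: scalerDl.
Qed.

Definition lift_fun (x : pres) : M := term_eval (rep x).

Lemma lift_cls t : lift_fun (cls t) = term_eval t.
Proof. exact/eval_teq/rep_cls. Qed.

Fact lift_linear : linear lift_fun.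
Proof.
move=> a x y; rewrite -[x in LHS]repK -[y in LHS]repK.
by rewrite [_ *: _]clsZ [_ + _]clsD lift_cls.
Qed.

Definition pres_lift : {linear pres -> M} := mk_linear lift_linear.

Lemma pres_liftE x : pres_lift (pres_gen x) = phi x.
Proof. exact: lift_cls. Qed.

End Lift.

Lemma clsE :
  [/\ cls Zero = 0, forall t u, cls (Add t u) = cls t + cls u,
      forall t, cls (Opp t) = - cls t
    & forall a t, cls (Scale a t) = a *: cls t].
Proof.
by split=> [|t u|t|a t] //; rewrite ?[RHS]clsD ?[RHS]clsN ?[RHS]clsZ.
Qed.

Lemma pres_ext (M : lmodType k) (f g : {linear pres -> M}) :
  (forall x, f (pres_gen x) = g (pres_gen x)) -> f =1 g.
Proof.
move=> fg x; have [c0 cD cN cZ] := clsE; rewrite -[x]repK.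
elim: (rep x) => [y||t ft u fu|t ft|a t ft].
- exact: fg.
- by rewrite c0 !linear0.
- by rewrite cD !linearD ft fu.
- by rewrite cN !linearN ft.
- by rewrite cZ !linearZ_LR ft.
Qed.

End Presented.

Arguments pres_lift : simpl never.

Section Tensor.
Variables (k : fieldType) (U : group_family) (X Y : complex k U).

Section Degree.
Variable G : member U.

(* Generators of [(X (x) Y)_n (G)], the direct sum over [p + q = n] of the
   tensor products over [k] of [X_p (G)] and [Y_q (G)]. *)
Record tgen (n : int) := Tgen {
  tg_p : int; tg_q : int;
  tg_deg : tg_p + tg_q = n;
  tg_x : X tg_p G;
  tg_y : Y tg_q G }.

Inductive bilinearity (n : int) : term k (tgen n) -> term k (tgen n) -> Prop :=
| bilinear_l (p q : int) (e : p + q = n) a (x x' : X p G) (y : Y q G) :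
    bilinearity (Gen k (Tgen e (a *: x + x') y))
      (Add (Scale a (Gen k (Tgen e x y))) (Gen k (Tgen e x' y)))
| bilinear_r (p q : int) (e : p + q = n) a (x : X p G) (y y' : Y q G) :
    bilinearity (Gen k (Tgen e x (a *: y + y')))
      (Add (Scale a (Gen k (Tgen e x y))) (Gen k (Tgen e x y'))).

Definition tens_ob (n : int) : lmodType k := pres (@bilinearity n).

Definition tens (n p q : int) (e : p + q = n) (x : X p G) (y : Y q G) :
  tens_ob n := pres_gen (@bilinearity n) (Tgen e x y).

Lemma tens_linear_l (n p q : int) (e : p + q = n) y :
  linear (fun x => tens e x y).
Proof.
move=> a x x'; have [_ cD _ cZ] := clsE (@bilinearity n).
by rewrite /tens /gen -cZ -cD; apply/cls_eqP/teq_rel/bilinear_l.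
Qed.

Lemma tens_linear_r (n p q : int) (e : p + q = n) x : linear (tens e x).
Proof.
move=> a y y'; have [_ cD _ cZ] := clsE (@bilinearity n).
by rewrite /tens /gen -cZ -cD; apply/cls_eqP/teq_rel/bilinear_r.
Qed.

Section Universal.
Variables (n : int) (M : lmodType k).
Variable phi : forall p q : int, p + q = n -> X p G -> Y q G -> M.
Hypothesis phi_l : forall (p q : int) (e : p + q = n) y,
  linear (fun x => phi e x y).
Hypothesis phi_r : forall (p q : int) (e : p + q = n) x, linear (phi e x).

Definition phi_gen (g : tgen n) : M := phi (tg_deg g) (tg_x g) (tg_y g).

Fact phi_bilinearity t u :
  bilinearity t u -> term_eval phi_gen t = term_eval phi_gen u.
Proof.
case=> [p q e a x x' y|p q e a x y y']; rewrite /= /phi_gen /=.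
  exact: phi_l.
exact: phi_r.
Qed.

Definition tens_lift : {linear tens_ob n -> M} := pres_lift phi_bilinearity.

Lemma tens_liftE (p q : int) (e : p + q = n) x y :
  tens_lift (tens e x y) = phi e x y.
Proof. exact: pres_liftE. Qed.

End Universal.

Arguments tens_lift : simpl never.

Lemma tens_ext (n : int) (M : lmodType k) (f g : {linear tens_ob n -> M}) :
  (forall (p q : int) (e : p + q = n) x y, f (tens e x y) = g (tens e x y)) ->
  f =1 g.
Proof. by move=> fg; apply: pres_ext => -[p q e x y]; apply: fg. Qed.

End Degree.

Section Restriction.
Variables (n : int) (H G : member U) (f : epi H G).

Definition tens_res_phi (p q : int) (e : p + q = n) (x : X p G) (y : Y q G) :
  tens_ob H n := tens e (res (X p) f x) (res (Y q) f y).

Fact tens_res_l (p q : int) (e : p + q = n) y :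
  linear (fun x => tens_res_phi e x y).
Proof. by move=> a x x'; rewrite /tens_res_phi linearP tens_linear_l. Qed.
Fact tens_res_r (p q : int) (e : p + q = n) x : linear (tens_res_phi e x).
Proof. by move=> a y y'; rewrite /tens_res_phi linearP tens_linear_r. Qed.

Definition tens_res : {linear tens_ob G n -> tens_ob H n} :=
  tens_lift tens_res_l tens_res_r.

Lemma tens_resE (p q : int) (e : p + q = n) x y :
  tens_res (tens e x y) = tens e (res (X p) f x) (res (Y q) f y).
Proof. exact: tens_liftE. Qed.

End Restriction.

Arguments tens_res : simpl never.

Fact tens_res_conj (n : int) (H G : member U) (f g : epi H G) :
  epi_conj f g -> tens_res n f =1 tens_res n g.
Proof.
move=> fg; apply: tens_ext => p q e x y.
by rewrite !tens_resE !(res_conj fg).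
Qed.

Fact tens_res_id (n : int) (G : member U) (x : tens_ob G n) :
  tens_res n (id_epi G) x = x.
Proof.
rewrite -[RHS]/(idfun x); apply: tens_ext => p q e {}x y.
by rewrite tens_resE !res_id.
Qed.

Fact tens_res_comp (n : int) (K H G : member U) (f : epi H G) (g : epi K H)
    (x : tens_ob G n) :
  tens_res n (comp_epi f g) x = tens_res n g (tens_res n f x).
Proof.
rewrite -[RHS]/((tens_res n g \o tens_res n f) x).
apply: tens_ext => p q e {}x y.
rewrite -[RHS]/(tens_res n g (tens_res n f (tens e x y))).
by rewrite !tens_resE !res_comp.
Qed.

Definition tens_functor (n : int) : gfunctor k U :=
  GFunctor (@tens_res_conj n) (@tens_res_id n) (@tens_res_comp n).

Fact deg_l (n p q : int) : p + q = n -> p - 1 + q = n - 1.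
Proof. by move=> <-; rewrite addrAC. Qed.
Fact deg_r (n p q : int) : p + q = n -> p + (q - 1) = n - 1.
Proof. by move=> <-; rewrite addrA. Qed.

Section Differential.
Variables (n : int) (G : member U).

Definition tens_d_phi (p q : int) (e : p + q = n) (x : X p G) (y : Y q G) :
  tens_ob G (n - 1) :=
  tens (deg_l e) (diff X p G x) y + (-1) ^ p *: tens (deg_r e) x (diff Y q G y).

Fact tens_d_l (p q : int) (e : p + q = n) y :
  linear (fun x => tens_d_phi e x y).
Proof.
move=> a x x'; rewrite /tens_d_phi linearP !tens_linear_l.
by rewrite !scalerDr addrACA !scalerA [_ * a]mulrC.
Qed.
Fact tens_d_r (p q : int) (e : p + q = n) x : linear (tens_d_phi e x).
Proof.
move=> a y y'; rewrite /tens_d_phi linearP !tens_linear_r.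
by rewrite !scalerDr addrACA !scalerA [_ * a]mulrC.
Qed.

Definition tens_d_fun : {linear tens_ob G n -> tens_ob G (n - 1)} :=
  tens_lift tens_d_l tens_d_r.

Lemma tens_dE (p q : int) (e : p + q = n) x y :
  tens_d_fun (tens e x y)
  = tens (deg_l e) (diff X p G x) y
    + (-1) ^ p *: tens (deg_r e) x (diff Y q G y).
Proof. exact: tens_liftE. Qed.

End Differential.

Arguments tens_d_fun : simpl never.

Fact tens_d_natural (n : int) (H G : member U) (f : epi H G)
    (x : tens_functor n G) :
  tens_d_fun n H (res (tens_functor n) f x)
  = res (tens_functor (n - 1)) f (tens_d_fun n G x).
Proof.
rewrite -[LHS]/((tens_d_fun n H \o tens_res n f) x).
rewrite -[RHS]/((tens_res (n - 1) f \o tens_d_fun n G) x).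
apply: tens_ext => p q e {}x y.
rewrite -[LHS]/(tens_d_fun n H (tens_res n f (tens e x y))).
rewrite -[RHS]/(tens_res (n - 1) f (tens_d_fun n G (tens e x y))).
by rewrite tens_resE !tens_dE linearD linearZ_LR !tens_resE !nt_natural.
Qed.

Definition tens_d (n : int) :
  nat_trans (tens_functor n) (tens_functor (n - 1)) :=
  @NatTrans k U (tens_functor n) (tens_functor (n - 1))
    (fun G => tens_d_fun n G) (@tens_d_natural n).

Fact tens_dd (n : int) (G : member U) (x : tens_functor n G) :
  tens_d (n - 1) G (tens_d n G x) = 0.
Proof.
rewrite -[LHS]/((tens_d_fun (n - 1) G \o tens_d_fun n G) x).
rewrite -[RHS]/((\0 : {linear tens_ob G n -> tens_ob G (n - 1 - 1)}) x).
apply: tens_ext => p q e {}x y.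
have z_l e' : tens e' (diff X (p - 1) G (diff X p G x)) y = 0
    :> tens_ob G (n - 1 - 1).
  by rewrite dd; exact: (linear0 (mk_linear (tens_linear_l e' y))).
have z_r e' : tens e' x (diff Y (q - 1) G (diff Y q G y)) = 0
    :> tens_ob G (n - 1 - 1).
  by rewrite dd; exact: (linear0 (mk_linear (tens_linear_r e' x))).
rewrite -[LHS]/(tens_d_fun (n - 1) G (tens_d_fun n G (tens e x y))).
rewrite tens_dE linearD linearZ_LR !tens_dE z_l z_r.
rewrite scaler0 add0r addr0.
rewrite (Prop_irrelevance (deg_r (deg_l e)) (deg_l (deg_r e))).
by rewrite -scalerDl exprzDr ?unitrN1 // exprN1 invrN1 mulrN1 addNr scale0r.
Qed.

Definition tensor : complex k U := Complex tens_dd.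

End Tensor.

Section ThickIdeals.
Variables (k : fieldType) (U : group_family).

(* Full subcategories of D(U)^c are given by their objects. *)
Definition triangulated_subcategory (P : complex k U -> Prop) : Prop :=
  [/\ forall X, P X -> compact X,
      forall X, zero_object X -> P X,
      forall X Y (f : dhom X Y), is_iso f -> P X -> P Y,
      forall X, P X <-> P (shift X)
    & forall X Y Z (u : dhom X Y) (v : dhom Y Z) (w : dhom Z (shift X)),
        distinguished u v w -> P X -> P Y -> P Z].

Definition thick_ideal (P : complex k U -> Prop) : Prop :=
  [/\ triangulated_subcategory P,
      forall X Y, retract X Y -> P Y -> P X
    & forall X Y, compact X -> P Y -> P (tensor X Y)].

Definition proper_ideal (P : complex k U -> Prop) : Prop :=
  exists2 X, compact X & ~ P X.

Definition prime_ideal (P : complex k U -> Prop) : Prop :=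
  [/\ thick_ideal P, proper_ideal P
    & forall X Y, compact X -> compact Y -> P (tensor X Y) -> P X \/ P Y].

Definition p_ideal (V : group_family) (X : complex k U) : Prop :=
  compact X /\ forall G : member U, V G -> homology_zero X G.

Definition zero_ideal (X : complex k U) : Prop := compact X /\ zero_object X.

End ThickIdeals.

(* Main.v *)
(* D(U) is compactly generated by the complexes [sph k n G], free on the
   conjugacy classes of epimorphisms onto G, and every property that holds for
   them and is stable under cones and retracts holds for all compact objects
   (Neeman's telescope argument).  Morphisms in D(U) are computed with K-injective
   resolutions, the totalizations of a cobar construction for coinduction.

   In characteristic zero the product of two generators is a retract of a finite
   sum of generators, indexed by the wide subgroups of G * H, so compact objects
   are stable under tensor products.

   For G and N in V, the Cech complex X(G) -> X(N * G) -> X(N * N * G) -> ... is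
   acyclic when X is a generator, because the epimorphisms N^i * G -> H that kill
   the outer factor N split off; hence it is acyclic for all compact X.  Therefore
   the top homology of X on V is detected along N * G -> G.  If X and Y are
   compact and not in the ideal, both have a nonzero homology class at a common
   product G * G', and so has their tensor product by the Kunneth formula. *)
From HB Require Import structures.
Require Import Defs.
From mathcomp Require Import all_boot all_algebra all_fingroup.
From mathcomp Require Import all_order boolp zify.
From mathcomp Require classical_sets.

Set Implicit Arguments.
Unset Strict Implicit.
Unset Printing Implicit Defensive.
Import GRing.Theory.
Local Open Scope ring_scope.

(** * Generalized inverses of linear maps *)

(** The presentation of D(U) says when two expressions are equal, never when they differ. Such
    information comes from letting every expression act on K-injective resolutions up to homotopy;
    it identifies the morphisms from a sphere to X with the homology of X. Resolutions are available
    because exact complexes of vector spaces contract, and because a map into a coinduced functor is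
    an arbitrary family of linear maps, so that the contractions need not be natural.

    For primality, the classes of X and Y live at unrelated groups G and H, and nothing prevents
    restriction along H * G -> G from killing a class in general. In the top degree it cannot: the
    obstructions to extending a killed class to a Cech cycle lie in degrees where X is exact. Hence
    the bound on the homology must be uniform in the group. X is first restricted to V because V,
    unlike U, is known to be closed under N * G. Splitting off the factor N is natural in the group
    but not in the generator, so acyclicity is proved for generators and carried to compact objects
    by cones and retracts. *)

Section GeneralizedInverse.
Variables (k : fieldType) (A B : lmodType k) (d : {linear A -> B}).

(* Graphs of linear maps defined on a subspace of [B] that are sections of [d]
   over the part of the image of [d] they are defined on. *)
Record partial_section := PartialSection {
  graph :> B -> A -> Prop;
  graph_lin : forall c y a y' a',
    graph y a -> graph y' a' -> graph (c *: y + y') (c *: a + a');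
  graph_0 : graph 0 0;
  graph_fun : forall a, graph 0 a -> a = 0;
  graph_sec : forall x a, graph (d x) a -> d a = d x }.

Lemma partial_section_eq (R S : partial_section) :
  (forall y a, R y a <-> S y a) -> R = S.
Proof.
case: R S => [R R1 R2 R3 R4] [S S1 S2 S3 S4] /= RS.
have e : R = S by apply/funext => y; apply/funext => a; apply/propext.
by subst S; congr PartialSection; exact: Prop_irrelevance.
Qed.

(** Zorn's lemma for inclusion of graphs: a nonempty chain is bounded by its union, the empty chain
    by the zero graph. *)
Lemma maximal_partial_section : exists R : partial_section,
  forall S : partial_section, (forall y a, R y a -> S y a) -> S = R.
Proof.
pose le (R S : partial_section) := `[< forall y a, R y a -> S y a >].
have [||R S /asboolP RS /asboolP SR|C Ctot|R Rmax] := @classical_sets.Zorn _ le; last 1 first.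
- by exists R => S /asboolP/Rmax.
- by move=> R; apply/asboolP.
- by move=> R S T /asboolP SR /asboolP RT; apply/asboolP => y a /SR /RT.
- by apply: partial_section_eq => y a; split=> [/RS|/SR].
have [[R0 CR0]|C0] := pselect (exists R, C R); last first.
  have z1 c (y : B) (a : A) y' a' : (y = 0 /\ a = 0) -> (y' = 0 /\ a' = 0) ->
    (c *: y + y' = 0 /\ c *: a + a' = 0).
    by move=> [-> ->] [-> ->]; rewrite !scaler0 !addr0.
  have z4 x (a : A) : d x = 0 /\ a = 0 -> d a = d x.
    by move=> [-> ->]; rewrite linear0.
  exists (@PartialSection (fun y a => y = 0 /\ a = 0) z1 (conj erefl erefl)
    (fun a h => proj2 h) z4).
  by move=> S CS; case: C0; exists S.
pose W y a := exists2 R, C R & graph R y a.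
have w1 c y a y' a' : W y a -> W y' a' -> W (c *: y + y') (c *: a + a').
  move=> [R CR Ra] [S CS Sa]; have [/asboolP h|/asboolP h] := Ctot _ _ CR CS.
    by exists S => //; apply: graph_lin => //; apply: h.
  by exists R => //; apply: graph_lin => //; apply: h.
have w2 : W 0 0 by exists R0 => //; apply: graph_0.
have w3 a : W 0 a -> a = 0 by move=> [R _]; apply: graph_fun.
have w4 x a : W (d x) a -> d a = d x by move=> [R _]; apply: graph_sec.
by exists (PartialSection w1 w2 w3 w4) => R CR; apply/asboolP => y a Ra; exists R.
Qed.

Lemma graph_inj (R : partial_section) y a a' : R y a -> R y a' -> a = a'.
Proof.
move=> Ra Ra'; have := graph_lin (-1) Ra' Ra.
by rewrite !scaleN1r addNr => /graph_fun /eqP; rewrite addrC subr_eq0 => /eqP.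
Qed.

(** If [y] were outside the domain, the graph could be extended to the span of the domain and [y],
    since [graph_sec] constrains the value at [y] only modulo the kernel of [d]. *)
Lemma maximal_total (R : partial_section) :
  (forall S : partial_section, (forall y a, R y a -> S y a) -> S = R) ->
  forall y, exists a, R y a.
Proof.
move=> Rmax y; apply: contrapT => Ry.
(* [a0] is the value given to [y]. If a translate [r0 + y] by the domain equals [d x0], take
   [x0 - b0]; any other such translate differs from it by a point of the domain in the image of [d],
   where [graph_sec] applies. Without such a translate every value works. *)
have [a0 a0P] : exists a0, forall r a x, R r a -> r + y = d x -> d (a + a0) = d x.
  have [[r0 [b0 [x0 [Rr0 e0]]]]|no] :=
    pselect (exists r a x, R r a /\ r + y = d x).
    exists (x0 - b0) => r a x Rr e.
    have e' : r - r0 = d (x - x0).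
      by rewrite linearB -e -e0 opprD addrACA subrr addr0.
    have := graph_lin (-1) Rr0 Rr; rewrite !scaleN1r addrC e'.
    move=> /graph_sec; rewrite [- b0 + a]addrC => h.
    by rewrite [x0 - b0]addrC addrA linearD h linearB subrK.
  by exists 0 => r a x Rr e; case: no; exists r, a, x.
pose W z b := exists r a c, [/\ R r a, z = r + c *: y & b = a + c *: a0].
have w1 c z b z' b' : W z b -> W z' b' -> W (c *: z + z') (c *: b + b').
  move=> [r [a [e [Rr -> ->]]]] [r' [a' [e' [Rr' -> ->]]]].
  exists (c *: r + r'), (c *: a + a'), (c * e + e'); split.
  - exact: graph_lin.
  - by rewrite !scalerDr scalerA scalerDl !addrA; congr (_ + _); rewrite addrAC.
  - by rewrite !scalerDr scalerA scalerDl !addrA; congr (_ + _); rewrite addrAC.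
have w2 : W 0 0.
  by exists 0, 0, 0; split; [exact: graph_0 | rewrite scale0r addr0..].
have solve c r a : R r a -> c != 0 -> R (c^-1 *: r) (c^-1 *: a).
  by move=> Rr _; have := graph_lin c^-1 Rr (graph_0 R); rewrite !addr0.
have w3 b : W 0 b -> b = 0.
  move=> [r [a [c [Rr e ->]]]]; have [c0|c0] := eqVneq c 0.
    move: e Rr; rewrite c0 !scale0r !addr0 => <-; exact: graph_fun.
  (* A relation [0 = r + c *: y] with [c] nonzero would put [y] in the domain. *)
  case: Ry; exists (- c^-1 *: a); rewrite !scaleNr.
  have -> : y = - (c^-1 *: r).
    apply: (scalerI c0); rewrite scalerN scalerA divff // scale1r.
    by apply/eqP; rewrite -addr_eq0 addrC -e.
  have := graph_lin (-1) (solve _ _ _ Rr c0) (graph_0 R).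
  by rewrite !scaleN1r !addr0.
have w4 x b : W (d x) b -> d b = d x.
  move=> [r [a [c [Rr e ->]]]]; have [c0|c0] := eqVneq c 0.
    by move: e Rr; rewrite c0 !scale0r !addr0 => <-; apply: graph_sec.
  have e' : c^-1 *: r + y = d (c^-1 *: x).
    by rewrite linearZ_LR /= e scalerDr scalerA mulVf // scale1r.
  have h := a0P _ _ _ (solve _ _ _ Rr c0) e'.
  have -> : a + c *: a0 = c *: (c^-1 *: a + a0).
    by rewrite scalerDr scalerA divff // scale1r.
  by rewrite linearZ_LR /= h linearZ_LR /= scalerA divff // scale1r.
have := Rmax (PartialSection w1 w2 w3 w4).
have sub z b : R z b -> W z b.
  by move=> Rz; exists z, b, 0; split; rewrite ?scale0r ?addr0.
move=> /(_ sub) RW; apply: Ry; exists a0; rewrite -RW /=.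
by exists 0, 0, 1; split; [exact: graph_0 | rewrite scale1r add0r..].
Qed.

(** A maximal partial section is total and single-valued, hence a linear map. The identity
    [d s d = d] later yields contractions of exact complexes and functionals on homology, in any
    dimension. *)
Lemma lin_pinv : exists s : {linear B -> A}, forall x, d (s (d x)) = d x.
Proof.
have [R /maximal_total/choice[s sP]] := maximal_partial_section.
have s_lin : linear s.
  by move=> c y y'; apply: graph_inj (sP _) _; apply: graph_lin.
by exists (mk_linear s_lin) => x; apply: graph_sec (sP (d x)).
Qed.

End GeneralizedInverse.

(** * Complexes and homotopies *)

(** Not an induction: it rewrites a degree as a predecessor, the form in which a boundary
    [diff X n G z] has the right type. *)
Lemma int_pred_ind (P : int -> Prop) : (forall n, P (n - 1)) -> forall n, P n.
Proof. by move=> h n; rewrite -(addrK 1 n). Qed.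

Section Chains.
Variables (k : fieldType) (U : group_family).
Implicit Types (X Y Z W A B C : complex k U) (G H : member U).

Definition nt_zero (X Y : gfunctor k U) : nat_trans X Y.
Proof.
apply: (@NatTrans k U X Y (fun G => \0 : {linear X G -> Y G})) => H G f x.
by rewrite /= linear0.
Defined.

Definition chain_zero X Y : chain_map X Y.
Proof.
apply: (@ChainMap k U X Y (fun n => nt_zero (X n) (Y n))) => n G x.
by rewrite /= linear0.
Defined.

Definition chain_opp X Y (f : chain_map X Y) : chain_map X Y.
Proof.
apply: (@ChainMap k U X Y (fun n => nt_opp (f n))) => n G x.
by rewrite /= cm_d linearN.
Defined.

Definition cx_zero : complex k U.
Proof.
pose O := @GFunctor k U (fun _ => 'M[k]_(0, 0) : lmodType k) (fun _ _ _ => idfun)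
   (fun _ _ _ _ _ _ => erefl) (fun _ _ => erefl) (fun _ _ _ _ _ _ => erefl).
by apply: (@Complex k U (fun _ => O) (fun _ => nt_zero O O)).
Defined.

Section Elements.
Variables (X : complex k U) (G : member U).

(** Being indexed by the degree, the predicate applies to [x : X n G] for every [n], and not only
    for degrees of the syntactic form [n - 1]. *)
Inductive bd : forall n, X n G -> Prop := Bd n (z : X n G) : bd (diff X n G z).

Definition cyc n (x : X n G) := diff X n G x = 0.

Lemma bdP n (x : X (n - 1) G) : bd x <-> exists z : X n G, diff X n G z = x.
Proof.
split=> [|[z <-]]; last exact: Bd.
(* Inversion of the indexed family: the degree is generalized with an equation, and the resulting
   cast disappears because equality on [int] is decidable. *)
suff h m (e : m = n - 1) (y : X m G) : bd y ->
    exists z : X n G, diff X n G z = ecast i (X i G) e y.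
  by move=> /(h _ erefl).
move=> b; case: m y / b e => n' z e.
have e' : n' = n by apply: (addIr (-1)).
by subst n'; exists z; rewrite eq_axiomK.
Qed.

Lemma bdD n (x y : X n G) : bd x -> bd y -> bd (x + y).
Proof.
elim/int_pred_ind: n => n in x y *.
by move=> /bdP[a <-] /bdP[b <-]; rewrite -linearD; apply: Bd.
Qed.

Lemma bdN n (x : X n G) : bd x -> bd (- x).
Proof.
elim/int_pred_ind: n => n in x *.
by move=> /bdP[a <-]; rewrite -linearN; apply: Bd.
Qed.

Lemma bdNE n (x : X n G) : bd (- x) <-> bd x.
Proof. by split=> /bdN; rewrite ?opprK. Qed.

Lemma bdB n (x y : X n G) : bd x -> bd y -> bd (x - y).
Proof. by move=> hx /bdN; apply: bdD. Qed.

Lemma bd0 n : bd (0 : X n G).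
Proof.
by elim/int_pred_ind: n => n; rewrite -(linear0 (diff X n G)); apply: Bd.
Qed.

Lemma bd_subr n (x y : X n G) : bd (x - y) -> bd y -> bd x.
Proof. by move=> a /(bdD a); rewrite subrK. Qed.

Lemma bd_subl n (x y : X n G) : bd (x - y) -> bd x -> bd y.
Proof. by move=> /bdN; rewrite opprB; apply: bd_subr. Qed.

Lemma homology_zeroP :
  homology_zero X G <-> forall n (x : X n G), cyc x -> bd x.
Proof.
split=> h n.
  elim/int_pred_ind: n => n x /(h n)[z e]; rewrite subr0 in e.
  by apply/bdP; exists z.
by move=> x /(h _) /bdP[z <-]; exists z; rewrite subr0.
Qed.

Lemma cycB n (x y : X n G) : cyc x -> cyc y -> cyc (x - y).
Proof. by rewrite /cyc linearB => -> ->; rewrite subr0. Qed.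

End Elements.

Lemma cm_bd X Y (f : chain_map X Y) G n (x : X n G) : bd x -> bd (f n G x).
Proof. by case=> m z; rewrite cm_d; apply: Bd. Qed.

Lemma cm_cyc X Y (f : chain_map X Y) G n (x : X n G) : cyc x -> cyc (f n G x).
Proof. by rewrite /cyc -cm_d => ->; rewrite linear0. Qed.

Lemma quasi_isoP X Y (f : chain_map X Y) : quasi_iso f <->
  forall G n, (forall x : X n G, cyc x -> bd (f n G x) -> bd x) /\
   (forall y : Y n G, cyc y -> exists2 x : X n G, cyc x & bd (f n G x - y)).
Proof.
split=> h G.
  elim/int_pred_ind => n; have [i s] := h G n; split.
    move=> x cx /bdP[z e].
    have c0 : is_cycle (0 : X (n - 1) G) by rewrite /is_cycle linear0.
    have [|w] := i _ _ cx c0; first by exists z; rewrite linear0 subr0.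
    by rewrite subr0 => <-; apply: Bd.
  by move=> y /s[x cx [z e]]; exists x => //; rewrite -e; apply: Bd.
move=> n; have [i s] := h G (n - 1); split.
  move=> x x' cx cx' [z e]; apply/bdP/i; first exact: cycB.
  by rewrite linearB -e; apply: Bd.
by move=> y /s[x cx /bdP[z e]]; exists x => //; exists z.
Qed.

Definition acyclic X := forall G, homology_zero X G.

Lemma acyclicP X : acyclic X <-> forall G n (x : X n G), cyc x -> bd x.
Proof. by split=> h G; have /homology_zeroP := h G. Qed.

Lemma cone_cyc X Y (f : chain_map X Y) G n (u : cone f n G) :
  cyc u <-> cyc u.1 /\ f (n - 1) G u.1 + diff Y n G u.2 = 0.
Proof.
rewrite /cyc; split=> [[/= /eqP]|[/= e1 e2]].
  by rewrite oppr_eq0 => /eqP -> ->.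
by congr pair => //=; rewrite e1 oppr0.
Qed.

Lemma cone_bd X Y (f : chain_map X Y) G n (u : cone f (n - 1) G) :
  bd u <-> exists (x : X (n - 1) G) (y : Y n G),
    u.1 = - diff X (n - 1) G x /\ u.2 = f (n - 1) G x + diff Y n G y.
Proof.
split=> [/bdP[[x y] <-]|[x [y [e1 e2]]]]; first by exists x, y.
apply/bdP; exists (x, y); rewrite [RHS]surjective_pairing e1 e2 //.
Qed.

(** The long exact sequence of the cone, on elements and at one group, so that it serves both for
    quasi-isomorphisms and for the ideal, whose members are exact at the groups of [V] only. *)
Lemma cone_exact_at X Y (f : chain_map X Y) G :
  homology_zero (cone f) G <->
  forall n, (forall x : X n G, cyc x -> bd (f n G x) -> bd x) /\
   (forall y : Y n G, cyc y -> exists2 x : X n G, cyc x & bd (f n G x - y)).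
Proof.
split=> [/homology_zeroP h|h].
  elim/int_pred_ind => n; split.
    elim/int_pred_ind: n => n x cx /bdP[z e].
    have /h : cyc ((x, - z) : cone f (n - 1) G).
      by apply/cone_cyc; split=> //=; rewrite linearN e subrr.
    by move=> /cone_bd[a [b [/= -> _]]]; apply/bdNE/Bd.
  move=> y cy; have /h : cyc ((0, y) : cone f (n - 1) G).
    by apply/cone_cyc; rewrite /cyc /= !linear0 add0r; split.
  move=> /cone_bd[a [b [/= e1 ->]]]; exists a.
    by apply/eqP; rewrite -oppr_eq0 -e1.
  by rewrite opprD addNKr; apply/bdNE/Bd.
apply/homology_zeroP; elim/int_pred_ind => n [x y] /cone_cyc[/= cx e].
have bx : bd x.
  apply: (proj1 (h _)) => //.
  by move/eqP: e; rewrite addr_eq0 => /eqP ->; apply/bdNE/Bd.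
move/bdP: bx => [z ez]; subst x.
(* Subtracting the boundary of [(- z, 0)] turns the cycle [(x, y)] into [(0, f z + y)]. *)
have [|v cv /bdP[w ew]] := proj2 (h _) (f _ _ z + y).
  by rewrite /cyc linearD -cm_d.
apply/cone_bd; exists (v - z), (- w); split=> /=.
  by rewrite linearB cv sub0r opprK.
rewrite linearN ew linearB; set a := f _ _ v; set b := f _ _ z.
apply: (addrI (a - (b + y))).
by rewrite [RHS]addrC subrK opprD addrA subrK.
Qed.

Lemma quasi_iso_cone X Y (f : chain_map X Y) : quasi_iso f <-> acyclic (cone f).
Proof.
split=> [/quasi_isoP h G|h]; first exact/cone_exact_at.
by apply/quasi_isoP => G; apply/cone_exact_at.
Qed.

Lemma quasi_iso_id X : quasi_iso (chain_id X).
Proof.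
apply/quasi_isoP => G n; split=> // y cy; exists y => //.
by rewrite /= subrr; apply: bd0.
Qed.

Lemma quasi_iso_comp X Y Z (g : chain_map Y Z) (f : chain_map X Y) :
  quasi_iso g -> quasi_iso f -> quasi_iso (chain_comp g f).
Proof.
move=> /quasi_isoP gP /quasi_isoP fP; apply/quasi_isoP => G n.
have [gi gs] := gP G n; have [fi fs] := fP G n; split.
  by move=> x cx /gi h; apply: fi => //; apply: h; apply: cm_cyc.
move=> z /gs[y cy byz]; have [x cx bxy] := fs y cy; exists x => //=.
by have := bdD (cm_bd g bxy) byz; rewrite linearB addrA subrK.
Qed.

Lemma quasi_iso_acyclic X Y (f : chain_map X Y) :
  acyclic X -> acyclic Y -> quasi_iso f.
Proof.
move=> /acyclicP hX /acyclicP hY; apply/quasi_isoP => G n; split.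
  by move=> x /hX.
move=> y cy; exists 0; first by rewrite /cyc linear0.
by rewrite linear0 sub0r; apply/bdNE/hY.
Qed.

Lemma acyclic_zero : acyclic cx_zero.
Proof.
apply/acyclicP => G n x _; have -> : x = 0 by apply/matrixP => -[].
exact: bd0.
Qed.

(* Homotopies are indexed like the differentials of the target, so that no
   transport along [n - 1 + 1 = n] is needed. *)
Definition htpy X Y (f g : chain_map X Y) : Prop :=
  exists h : forall n, nat_trans (X (n - 1)) (Y n), forall n G (x : X (n - 1) G),
    f (n - 1) G x - g (n - 1) G x
    = diff Y n G (h n G x) + h (n - 1) G (diff X (n - 1) G x).

Lemma htpy_ext X Y (f g : chain_map X Y) :
  (forall n G x, f n G x = g n G x) -> htpy f g.
Proof.
move=> fg; exists (fun n => nt_zero _ _) => n G x.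
by rewrite fg subrr /= linear0 addr0.
Qed.

Lemma htpy_refl X Y (f : chain_map X Y) : htpy f f.
Proof. exact: htpy_ext. Qed.

Lemma htpy_sym X Y (f g : chain_map X Y) : htpy f g -> htpy g f.
Proof.
move=> [h hP]; exists (fun n => nt_opp (h n)) => n G x.
by rewrite -[LHS]opprB hP opprD /= linearN.
Qed.

Lemma htpy_add X Y (f g f' g' : chain_map X Y) :
  htpy f g -> htpy f' g' -> htpy (chain_add f f') (chain_add g g').
Proof.
move=> [h hP] [h' hP']; exists (fun n => nt_add (h n) (h' n)) => n G x.
by rewrite /= opprD addrACA hP hP' linearD addrACA.
Qed.

Lemma htpy_trans X Y (g f h : chain_map X Y) :
  htpy f g -> htpy g h -> htpy f h.
Proof.
move=> [a aP] [b bP]; exists (fun n => nt_add (a n) (b n)) => n G x.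
by rewrite /= linearD addrACA -aP -bP addrA subrK.
Qed.

Lemma htpy_opp X Y (f g : chain_map X Y) :
  htpy f g -> htpy (chain_opp f) (chain_opp g).
Proof.
move=> [h hP]; exists (fun n => nt_opp (h n)) => n G x.
by rewrite /= -opprD hP linearN -opprD.
Qed.

Lemma htpy_comp X Y Z (g g' : chain_map Y Z) (f f' : chain_map X Y) :
  htpy g g' -> htpy f f' -> htpy (chain_comp g f) (chain_comp g' f').
Proof.
move=> [h hP] [l lP]; apply: (@htpy_trans _ _ (chain_comp g f')).
  exists (fun n => nt_comp (g n) (l n)) => n G x.
  by rewrite /= -linearB lP linearD cm_d.
exists (fun n => nt_comp (h n) (f' (n - 1))) => n G x.
by rewrite /= hP cm_d.
Qed.

Lemma htpy_subr0 X Y (f g : chain_map X Y) :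
  htpy (chain_add f (chain_opp g)) (chain_zero X Y) -> htpy f g.
Proof. by move=> [h hP]; exists h => n G x; rewrite -hP /= subr0. Qed.

Lemma htpy_sub0 X Y (f g : chain_map X Y) :
  htpy f g -> htpy (chain_add f (chain_opp g)) (chain_zero X Y).
Proof. by move=> [h hP]; exists h => n G x; rewrite -hP /= subr0. Qed.

Lemma quasi_iso_htpy X Y (f g : chain_map X Y) :
  htpy f g -> quasi_iso f -> quasi_iso g.
Proof.
move=> [h hP] /quasi_isoP fP; apply/quasi_isoP => G n.
have fg (x : X n G) : cyc x -> bd (f n G x - g n G x).
  elim/int_pred_ind: n => n in x *.
  by move=> cx; rewrite hP cx linear0 addr0; apply: Bd.
have [i s] := fP G n; split.
  by move=> x cx bx; apply: i => //; apply: bd_subr (fg _ cx) _.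
move=> y /s[x cx b]; exists x => //.
by have := bdB b (fg x cx); rewrite opprB addrC addrA subrK.
Qed.

Lemma quasi_iso_cancel_r X Y Z (g : chain_map Y Z) (f : chain_map X Y) :
  quasi_iso f -> quasi_iso (chain_comp g f) -> quasi_iso g.
Proof.
move=> /quasi_isoP fP /quasi_isoP hP; apply/quasi_isoP => G n.
have [fi fs] := fP G n; have [hi hs] := hP G n; split.
  move=> y cy bgy; have [x cx bxy] := fs y cy.
  apply: (bd_subl bxy); apply: cm_bd; apply: hi => //=.
  by apply: bd_subr bgy; rewrite -linearB; apply: cm_bd.
by move=> z /hs[x cx b]; exists (f n G x) => //; apply: cm_cyc.
Qed.

End Chains.

Arguments chain_zero {k U X Y}.
Arguments bd {k U X G n} x.
Arguments cyc {k U X G n} x.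
Arguments cx_zero {k U}.

(** * Morphisms of the derived category *)

Section Mor.
Variables (k : fieldType) (U : group_family).
Implicit Types (X Y Z W A B C : complex k U) (G H : member U).

(** Classes are represented by predicates on expressions, so that [deq] becomes an equality with
    which one can rewrite. *)
Definition mor X Y := {A : dhom X Y -> Prop | exists d, A = deq d}.

Definition cl X Y (d : dhom X Y) : mor X Y :=
  exist _ (deq d) (ex_intro _ d erefl).

Lemma mor_eq X Y (f g : mor X Y) : sval f = sval g -> f = g.
Proof.
case: f g => [f fP] [g gP] /= e; subst g.
by congr exist; apply: Prop_irrelevance.
Qed.

Lemma cl_eq X Y (d e : dhom X Y) : cl d = cl e <-> deq d e.
Proof.
split=> [/(congr1 sval)/= ->|de]; first exact: deq_refl.
apply: mor_eq; apply/funext => c; apply/propext; split.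
  by apply: deq_trans; apply: deq_sym.
exact: deq_trans.
Qed.

Definition mrep X Y (m : mor X Y) : dhom X Y := sval (cid (svalP m)).

Lemma mrepK X Y (m : mor X Y) : cl (mrep m) = m.
Proof.
by apply: mor_eq; rewrite /mrep; case: m => /= A e; case: cid => d /= ->.
Qed.

Lemma mrep_cl X Y (d : dhom X Y) : deq (mrep (cl d)) d.
Proof. by apply/cl_eq; rewrite mrepK. Qed.

Definition mcomp X Y Z (g : mor Y Z) (f : mor X Y) : mor X Z :=
  cl (dcomp (mrep g) (mrep f)).
Definition madd X Y (f g : mor X Y) : mor X Y := cl (dadd (mrep f) (mrep g)).
Definition mopp X Y (f : mor X Y) : mor X Y := cl (dopp (mrep f)).
Definition m0 X Y : mor X Y := cl (@dzero _ _ _ _).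
Definition mm X Y (f : chain_map X Y) : mor X Y := cl (dmap f).
Definition minv X Y (s : chain_map X Y) (sP : quasi_iso s) : mor Y X :=
  cl (dinv sP).

End Mor.

Arguments m0 {k U X Y}.
Notation "g '*d' f" := (mcomp g f) (at level 40, left associativity).
Notation "f '+d' g" := (madd f g) (at level 50, left associativity).
Notation "'-d' f" := (mopp f) (at level 35, right associativity).
Notation "f '-d' g" := (madd f (mopp g)) (at level 50, left associativity).
Notation m1 X := (mm (chain_id X)).

Section MorTheory.
Variables (k : fieldType) (U : group_family).
Implicit Types (X Y Z W A B C : complex k U) (G H : member U).

Lemma clM X Y Z (g : dhom Y Z) (f : dhom X Y) : cl (dcomp g f) = cl g *d cl f.
Proof. by apply/cl_eq/deq_dcomp; apply/deq_sym/mrep_cl. Qed.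
Lemma clD X Y (f g : dhom X Y) : cl (dadd f g) = cl f +d cl g.
Proof. by apply/cl_eq/deq_dadd; apply/deq_sym/mrep_cl. Qed.
Lemma clN X Y (f : dhom X Y) : cl (dopp f) = -d cl f.
Proof. by apply/cl_eq/deq_dopp; apply/deq_sym/mrep_cl. Qed.

Lemma mcompA W X Y Z (h : mor Y Z) (g : mor X Y) (f : mor W X) :
  h *d (g *d f) = h *d g *d f.
Proof.
by rewrite -[h]mrepK -[g]mrepK -[f]mrepK -!clM; apply/cl_eq/dcompA.
Qed.
Lemma mcomp1l X Y (f : mor X Y) : m1 Y *d f = f.
Proof. by rewrite -[f]mrepK -clM; apply/cl_eq/dcomp1f. Qed.
Lemma mcomp1r X Y (f : mor X Y) : f *d m1 X = f.
Proof. by rewrite -[f]mrepK -clM; apply/cl_eq/dcompf1. Qed.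
Lemma maddA X Y : associative (@madd k U X Y).
Proof.
move=> f g h; rewrite -[h]mrepK -[g]mrepK -[f]mrepK -!clD.
exact/cl_eq/daddA.
Qed.
Lemma maddC X Y : commutative (@madd k U X Y).
Proof.
by move=> f g; rewrite -[g]mrepK -[f]mrepK -!clD; apply/cl_eq/daddC.
Qed.
Lemma madd0l X Y : left_id m0 (@madd k U X Y).
Proof. by move=> f; rewrite -[f]mrepK -clD; apply/cl_eq/dadd0f. Qed.
Lemma maddNl X Y : left_inverse m0 (@mopp k U X Y) (@madd k U X Y).
Proof. by move=> f; rewrite -[f]mrepK -clN -clD; apply/cl_eq/daddNf. Qed.
HB.instance Definition _ X Y :=
  Monoid.isComLaw.Build (mor X Y) m0 (@madd k U X Y)
    (@maddA X Y) (@maddC X Y) (@madd0l X Y).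
Lemma madd0r X Y : right_id m0 (@madd k U X Y).
Proof. by move=> f; rewrite maddC madd0l. Qed.
Lemma maddNr X Y (f : mor X Y) : f -d f = m0.
Proof. by rewrite maddC maddNl. Qed.
Lemma mcompDl X Y Z (f g : mor Y Z) (h : mor X Y) :
  (f +d g) *d h = f *d h +d g *d h.
Proof.
rewrite -[h]mrepK -[g]mrepK -[f]mrepK -clD -!clM -clD.
exact/cl_eq/dcompDl.
Qed.
Lemma mcompDr X Y Z (h : mor Y Z) (f g : mor X Y) :
  h *d (f +d g) = h *d f +d h *d g.
Proof.
rewrite -[h]mrepK -[g]mrepK -[f]mrepK -clD -!clM -clD.
exact/cl_eq/dcompDr.
Qed.

Lemma madd_inj X Y (f : mor X Y) : injective (madd f).
Proof.
move=> g h e; rewrite -[g]madd0l -[h]madd0l -(maddNl f).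
by rewrite -!maddA e.
Qed.
Lemma madd_id0 X Y (f : mor X Y) : f +d f = f -> f = m0.
Proof. by move=> e; apply: (@madd_inj _ _ f); rewrite madd0r. Qed.
Lemma msub_eq0 X Y (f g : mor X Y) : f -d g = m0 -> f = g.
Proof. by move=> e; rewrite -[f]madd0r -(maddNl g) maddA e madd0l. Qed.
Lemma msubK X Y (f g : mor X Y) : f -d g +d g = f.
Proof. by rewrite -maddA maddNl madd0r. Qed.
Lemma mopp_uniq X Y (f g : mor X Y) : f +d g = m0 -> g = -d f.
Proof. by move=> e; apply: (@madd_inj _ _ f); rewrite maddNr. Qed.
Lemma mcomp0l X Y Z (f : mor X Y) : @m0 k U Y Z *d f = m0.
Proof. by apply: madd_id0; rewrite -mcompDl madd0l. Qed.
Lemma mcomp0r X Y Z (f : mor Y Z) : f *d @m0 k U X Y = m0.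
Proof. by apply: madd_id0; rewrite -mcompDr madd0l. Qed.
Lemma mcompNl X Y Z (f : mor Y Z) (g : mor X Y) : -d f *d g = -d (f *d g).
Proof. by apply: mopp_uniq; rewrite -mcompDl maddNr mcomp0l. Qed.
Lemma mcompNr X Y Z (f : mor Y Z) (g : mor X Y) : f *d (-d g) = -d (f *d g).
Proof. by apply: mopp_uniq; rewrite -mcompDr maddNr mcomp0r. Qed.
Lemma mm_ext X Y (f g : chain_map X Y) :
  (forall n G x, f n G x = g n G x) -> mm f = mm g.
Proof. by move=> fg; apply/cl_eq/dmap_ext. Qed.
Lemma mmM X Y Z (g : chain_map Y Z) (f : chain_map X Y) :
  mm (chain_comp g f) = mm g *d mm f.
Proof. by rewrite -clM; apply/cl_eq/dmap_comp. Qed.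
Lemma mmD X Y (f g : chain_map X Y) : mm (chain_add f g) = mm f +d mm g.
Proof. by rewrite -clD; apply/cl_eq/dmap_add. Qed.
Lemma mm0 X Y : mm (@chain_zero k U X Y) = m0.
Proof.
by apply: madd_id0; rewrite -mmD; apply: mm_ext => n G x; rewrite /= addr0.
Qed.
Lemma mmN X Y (f : chain_map X Y) : mm (chain_opp f) = -d mm f.
Proof.
by apply: mopp_uniq; rewrite -mmD -mm0; apply: mm_ext => n G x;
   rewrite /= subrr.
Qed.
Lemma mm_minv X Y (s : chain_map X Y) (sP : quasi_iso s) :
  mm s *d minv sP = m1 Y.
Proof. by rewrite -clM; apply/cl_eq/dinvR. Qed.
Lemma minv_mm X Y (s : chain_map X Y) (sP : quasi_iso s) :
  minv sP *d mm s = m1 X.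
Proof. by rewrite -clM; apply/cl_eq/dinvL. Qed.

Lemma mm_qi_injl X Y Z (s : chain_map Y Z) (f g : mor X Y) :
  quasi_iso s -> mm s *d f = mm s *d g -> f = g.
Proof.
move=> sP e; rewrite -[f]mcomp1l -[g]mcomp1l -(minv_mm sP).
by rewrite -!mcompA e.
Qed.
Lemma mm_qi_injr X Y Z (s : chain_map X Y) (f g : mor Y Z) :
  quasi_iso s -> f *d mm s = g *d mm s -> f = g.
Proof.
move=> sP e; rewrite -[f]mcomp1r -[g]mcomp1r -(mm_minv sP).
by rewrite !mcompA e.
Qed.

(** The zero map from [X] to [cx_zero] is a quasi-isomorphism, so the identity of [X] factors
    through a zero morphism. *)
Lemma acyclic_m1 X : acyclic X -> m1 X = m0.
Proof.
move=> hX; have sP : quasi_iso (@chain_zero k U X cx_zero).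
  by apply: quasi_iso_acyclic => //; apply: acyclic_zero.
by rewrite -(minv_mm sP) mm0 mcomp0r.
Qed.

Lemma m1_mor0 X Y (f : mor X Y) : m1 X = m0 -> f = m0.
Proof. by move=> e; rewrite -[f]mcomp1r e mcomp0r. Qed.
Lemma m1_mor0r X Y (f : mor Y X) : m1 X = m0 -> f = m0.
Proof. by move=> e; rewrite -[f]mcomp1l e mcomp0l. Qed.

Lemma zero_objectP X : zero_object X <-> m1 X = m0.
Proof.
split=> [/(_ X)[h _]|e Y]; first by apply/cl_eq/h.
split=> f; apply/cl_eq; first by rewrite (m1_mor0 (cl f) e).
by rewrite (m1_mor0r (cl f) e).
Qed.

Definition cone_lift_fun A B Z (f : chain_map A B) (g : chain_map B Z)
    (h : forall n, nat_trans (A (n - 1)) (Z n)) n G (u : cone f n G) : Z n G :=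
  h n G u.1 + g n G u.2.

(** Universal property of the cone: a null-homotopy of [g f] is what is needed to extend [g] from
    [B] to [cone f]. *)
Lemma cone_factor A B Z (f : chain_map A B) (g : chain_map B Z)
    (h : forall n, nat_trans (A (n - 1)) (Z n)) :
  (forall n G (x : A (n - 1) G), g (n - 1) G (f (n - 1) G x)
     = diff Z n G (h n G x) + h (n - 1) G (diff A (n - 1) G x)) ->
  exists F : chain_map (cone f) Z,
    forall n G (u : cone f n G), F n G u = h n G u.1 + g n G u.2.
Proof.
move=> hP; have lin n G : linear (@cone_lift_fun A B Z f g h n G).
  by move=> a u v; rewrite /cone_lift_fun !linearP scalerDr addrACA.
have nat n H G (e : epi H G) (u : cone f n G) :
    mk_linear (@lin n H) (res (cone f n) e u) = res (Z n) e (mk_linear (@lin n G) u).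
  by rewrite /= /cone_lift_fun /= !nt_natural linearD.
have ch n G (u : cone f n G) :
    NatTrans (@nat (n - 1)) G (diff (cone f) n G u)
    = diff Z n G (NatTrans (@nat n) G u).
  rewrite /= /cone_lift_fun /= linearN linearD hP linearD cm_d.
  set q := h (n - 1) G _; set p := diff Z n G (h n G _).
  by rewrite [p + q]addrC -addrA addKr.
by exists (ChainMap ch).
Qed.

(** A null-homotopic map extends over the cone of the identity, which is acyclic and so has only
    zero morphisms. *)
Lemma htpy_mm X Y (f g : chain_map X Y) : htpy f g -> mm f = mm g.
Proof.
move=> /htpy_sub0[h hP]; apply: msub_eq0; rewrite -mmN -mmD.
set d := chain_add _ _ in hP *.
have [|F FP] := @cone_factor X X Y (chain_id X) d h.
  by move=> n G x; rewrite -hP /= subr0.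
have <- : mm F *d mm (cone_in (chain_id X)) = mm d.
  by rewrite -mmM; apply: mm_ext => n G x; rewrite /= FP /= linear0 add0r.
rewrite [mm F]m1_mor0 ?mcomp0l //; apply: acyclic_m1.
exact/quasi_iso_cone/quasi_iso_id.
Qed.

Lemma cone_in_comp A B (f : chain_map A B) : mm (cone_in f) *d mm f = m0.
Proof.
rewrite -mmM -mm0; apply: htpy_mm.
have lin n G : linear (fun x : A (n - 1) G => (x, 0) : cone f n G).
  by move=> a x y; congr pair; rewrite /= scaler0 addr0.
have nat n H G (e : epi H G) (x : A (n - 1) G) :
    mk_linear (@lin n H) (res (A (n - 1)) e x)
    = res (cone f n) e (mk_linear (@lin n G) x).
  by congr pair; rewrite /= linear0.
exists (fun n => NatTrans (@nat n)) => n G x; rewrite /= subr0.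
congr pair; rewrite /= ?linear0 ?addr0 ?addNr //.
Qed.

Lemma cone_out_in A B (f : chain_map A B) : mm (cone_out f) *d mm (cone_in f) = m0.
Proof. by rewrite -mmM -mm0; apply: mm_ext. Qed.

End MorTheory.

(** * Functors between derived categories induced by functors of complexes *)

Section ComplexFunctor.
Variables (k : fieldType) (U U' : group_family).
Implicit Types (X Y Z : complex k U).

(** The laws are pointwise: [dmap_ext] turns them into equalities of morphisms, and no equality
    between chain maps as records is ever asked for. *)
Record cfun := Cfun {
  fo :> complex k U -> complex k U';
  fm : forall X Y, chain_map X Y -> chain_map (fo X) (fo Y);
  fm_ext : forall X Y (f g : chain_map X Y), (forall n G x, f n G x = g n G x) ->
    forall n G x, fm f n G x = fm g n G x;
  fm_id : forall X n G x, fm (chain_id X) n G x = x;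
  fm_comp : forall X Y Z (g : chain_map Y Z) (f : chain_map X Y) n G x,
    fm (chain_comp g f) n G x = fm g n G (fm f n G x);
  fm_add : forall X Y (f g : chain_map X Y) n G x,
    fm (chain_add f g) n G x = fm f n G x + fm g n G x;
  fm_qi : forall X Y (f : chain_map X Y), quasi_iso f -> quasi_iso (fm f) }.

Variable F : cfun.

Fixpoint fdhom X Y (d : dhom X Y) : dhom (F X) (F Y) :=
  match d with
  | dmap _ _ u => dmap (fm F u)
  | dinv _ _ _ sP => dinv (fm_qi F sP)
  | dcomp _ _ _ g h => dcomp (fdhom g) (fdhom h)
  | dzero _ _ => @dzero _ _ _ _
  | dadd _ _ g h => dadd (fdhom g) (fdhom h)
  | dopp _ _ g => dopp (fdhom g)
  end.

Lemma fdhom_id X : deq (fdhom (did X)) (did (F X)).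
Proof. by apply: dmap_ext => n G x; rewrite fm_id. Qed.

Lemma fdhom_deq X Y (d e : dhom X Y) : deq d e -> deq (fdhom d) (fdhom e).
Proof.
elim=> {X Y d e} /=.
- by move=> *; apply: deq_refl.
- by move=> *; apply: deq_sym.
- by move=> X Y f g h _ h1 _ h2; apply: deq_trans h1 h2.
- by move=> *; apply: deq_dcomp.
- by move=> *; apply: deq_dadd.
- by move=> *; apply: deq_dopp.
- by move=> *; apply: dcompA.
- move=> X Y f; apply: deq_trans (dcomp1f _); apply: deq_dcomp (deq_refl _).
  exact: fdhom_id.
- move=> X Y f; apply: deq_trans (dcompf1 _); apply: deq_dcomp (deq_refl _) _.
  exact: fdhom_id.
- by move=> *; apply: daddA.
- by move=> *; apply: daddC.
- by move=> *; apply: dadd0f.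
- by move=> *; apply: daddNf.
- by move=> *; apply: dcompDl.
- by move=> *; apply: dcompDr.
- by move=> X Y f g fg; apply/dmap_ext/fm_ext.
- move=> X Y Z f g; apply: deq_trans (dmap_comp _ _).
  by apply: dmap_ext => n G x; rewrite fm_comp.
- move=> X Y f g; apply: deq_trans (dmap_add _ _).
  by apply: dmap_ext => n G x; rewrite fm_add.
- by move=> X Y s sP; apply: deq_trans (dinvL _) (deq_sym (fdhom_id _)).
- by move=> X Y s sP; apply: deq_trans (dinvR _) (deq_sym (fdhom_id _)).
Qed.

Definition fd X Y (m : mor X Y) : mor (F X) (F Y) := cl (fdhom (mrep m)).

Lemma fd_cl X Y (d : dhom X Y) : fd (cl d) = cl (fdhom d).
Proof. by apply/cl_eq/fdhom_deq/mrep_cl. Qed.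
Lemma fd_mm X Y (f : chain_map X Y) : fd (mm f) = mm (fm F f).
Proof. exact: fd_cl. Qed.
Lemma fd1 X : fd (m1 X) = m1 (F X).
Proof. by rewrite fd_mm; apply: mm_ext => n G x; rewrite fm_id. Qed.
Lemma fdM X Y Z (g : mor Y Z) (f : mor X Y) : fd (g *d f) = fd g *d fd f.
Proof. by rewrite -[g]mrepK -[f]mrepK -clM !fd_cl -clM. Qed.
Lemma fdD X Y (f g : mor X Y) : fd (f +d g) = fd f +d fd g.
Proof. by rewrite -[g]mrepK -[f]mrepK -clD !fd_cl -clD. Qed.
Lemma fd0 X Y : fd (@m0 k U X Y) = m0.
Proof. exact: fd_cl. Qed.
Lemma fdN X Y (f : mor X Y) : fd (-d f) = -d fd f.
Proof. by rewrite -[f]mrepK -clN !fd_cl -clN. Qed.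

End ComplexFunctor.

(** * Product total complexes *)

Section DependentProduct.
Variables (k : fieldType) (I : Type) (V : I -> lmodType k).

Definition pifun := forall i, V i.
HB.instance Definition _ := gen_eqMixin pifun.
HB.instance Definition _ := gen_choiceMixin pifun.

Lemma pifunP (x y : pifun) : (forall i, x i = y i) -> x = y.
Proof. by move=> e; apply: functional_extensionality_dep. Qed.

Let add (x y : pifun) : pifun := fun i => x i + y i.
Let opp (x : pifun) : pifun := fun i => - x i.
Let zero : pifun := fun i => 0.
Let scale (a : k) (x : pifun) : pifun := fun i => a *: x i.

Let addA : associative add.
Proof. by move=> x y z; apply: pifunP => i; exact: (addrA (x i) (y i) (z i)). Qed.
Let addC : commutative add.
Proof. by move=> x y; apply: pifunP => i; exact: (addrC (x i) (y i)). Qed.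
Let add0 : left_id zero add.
Proof. by move=> x; apply: pifunP => i; exact: (add0r (x i)). Qed.
Let addN : left_inverse zero opp add.
Proof. by move=> x; apply: pifunP => i; exact: (addNr (x i)). Qed.
HB.instance Definition _ := GRing.isZmodule.Build pifun addA addC add0 addN.

Let scaleA a b x : scale a (scale b x) = scale (a * b) x.
Proof. by apply: pifunP => i; exact: (scalerA a b (x i)). Qed.
Let scale1 : left_id 1 scale.
Proof. by move=> x; apply: pifunP => i; exact: (scale1r (x i)). Qed.
Let scaleDr : right_distributive scale +%R.
Proof. by move=> a x y; apply: pifunP => i; exact: (scalerDr a (x i) (y i)). Qed.
Let scaleDl x : {morph scale^~ x : a b / a + b}.
Proof. by move=> a b; apply: pifunP => i; exact: (scalerDl (x i) a b). Qed.
HB.instance Definition _ := GRing.Zmodule_isLmodule.Build k pifun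
  scaleA scale1 scaleDr scaleDl.

Lemma pifunD (x y : pifun) i : (x + y) i = x i + y i. Proof. by []. Qed.
Lemma pifunN (x : pifun) i : (- x) i = - x i. Proof. by []. Qed.
Lemma pifun0 i : (0 : pifun) i = 0. Proof. by []. Qed.
Lemma pifunZ a (x : pifun) i : (a *: x) i = a *: x i. Proof. by []. Qed.

End DependentProduct.

Section Transport.
Variables (k : fieldType) (U : group_family).
Implicit Types (X Y Z W A B C : complex k U) (G H : member U).

(** Degrees such as [m + n - 1] and [m - 1 + n] are equal but not convertible. [ct] transports along
    such an equality, and [dg] is the differential with any target degree equal to [p - 1]. *)
Definition ct X p q (e : p = q) : nat_trans (X p) (X q) :=
  match e with erefl => nt_id (X p) end.
Definition dg X p q (e : p - 1 = q) : nat_trans (X p) (X (q)) :=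
  match e with erefl => diff X p end.

Lemma ctK X p q (e : p = q) (e' : q = p) G (x : X p G) :
  ct X e' G (ct X e G x) = x.
Proof. by subst q; rewrite (eq_irrelevance e' erefl). Qed.
Lemma ct_id X p (e : p = p) G (x : X p G) : ct X e G x = x.
Proof. by rewrite (eq_irrelevance e erefl). Qed.
Lemma ct_ct X p q r (e : p = q) (e' : q = r) (e'' : p = r) G (x : X p G) :
  ct X e' G (ct X e G x) = ct X e'' G x.
Proof. by subst q r; rewrite !ct_id. Qed.
Lemma dg_ct X p q r (e : p = q) (e' : q - 1 = r) (e'' : p - 1 = r) G (x : X p G) :
  dg X e' G (ct X e G x) = dg X e'' G x.
Proof. by subst q; rewrite (eq_irrelevance e' e''). Qed.
Lemma ct_dg X p q r (e : p - 1 = q) (e' : q = r) (e'' : p - 1 = r) G (x : X p G) :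
  ct X e' G (dg X e G x) = dg X e'' G x.
Proof. by subst r; rewrite (eq_irrelevance e e''). Qed.
Lemma dg_dg X p q r (e : p - 1 = q) (e' : q - 1 = r) G (x : X p G) :
  dg X e' G (dg X e G x) = 0.
Proof. by subst q r; apply: dd. Qed.
Lemma dgE X p (e : p - 1 = p - 1) G (x : X p G) : dg X e G x = diff X p G x.
Proof. by rewrite (eq_irrelevance e erefl). Qed.
Lemma cm_dg X Y (f : chain_map X Y) p q (e : p - 1 = q) G (x : X p G) :
  f q G (dg X e G x) = dg Y e G (f p G x).
Proof. by subst q; apply: cm_d. Qed.
Lemma cm_ct X Y (f : chain_map X Y) p q (e : p = q) G (x : X p G) :
  f q G (ct X e G x) = ct Y e G (f p G x).
Proof. by subst q. Qed.
Lemma cyc_dg X p q (e : p - 1 = q) G (x : X p G) : cyc x <-> dg X e G x = 0.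
Proof. by subst q. Qed.
Lemma bd_dg X p q (e : p - 1 = q) G (x : X p G) : bd (dg X e G x).
Proof. by subst q; apply: Bd. Qed.
Lemma bd_dgP X p q (e : p - 1 = q) G (x : X q G) :
  bd x <-> exists z : X p G, dg X e G z = x.
Proof. by subst q; apply: bdP. Qed.

End Transport.

Lemma signz_pred (k : fieldType) (n : int) : (-1) ^ (n - 1) = - (-1) ^ n :> k.
Proof. by rewrite exprzDr ?unitrN1 // exprN1 invrN1 mulrN1. Qed.
Lemma signz_mul (k : fieldType) (n : int) : (-1) ^ n * (-1) ^ n = 1 :> k.
Proof.
rewrite -expfzMl mulrNN mulr1; exact: exp1rz.
Qed.

Section Tot.
Variables (k : fieldType) (U : group_family).
Implicit Types (X Y Z W A B C : complex k U) (G H : member U).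
Variables (E : nat -> complex k U).
Variable delta : forall n, chain_map (E n) (E n.+1).
Hypothesis delta2 : forall n q G (x : E n q G),
  delta n.+1 q G (delta n q G x) = 0.

Let tot_V (m : int) G (n : nat) : lmodType k := E n (m + n%:Z) G.
Definition tot_res_fun m (H G : member U) (e : epi H G) (z : pifun (tot_V m G)) :
  pifun (tot_V m H) := fun n => res (E n (m + n%:Z)) e (z n).
Lemma tot_res_linear m (H G : member U) (e : epi H G) :
  linear (@tot_res_fun m H G e).
Proof. by move=> a x y; apply: pifunP => n; rewrite /tot_res_fun linearP. Qed.

(** A product over the columns, not a sum: elements and homotopies built one column at a time, in
    infinitely many steps, have to exist in it. *)
Definition tot_ob (m : int) : gfunctor k U.
Proof.
apply: (@GFunctor k U (fun G => pifun (tot_V m G))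
  (fun H G e => mk_linear (@tot_res_linear m H G e))).
- by move=> H G f g fg z; apply: pifunP => n; apply: res_conj fg _.
- by move=> G z; apply: pifunP => n; apply: res_id.
- by move=> K H G f g z; apply: pifunP => n; apply: res_comp.
Defined.

Lemma tot_deg (m : int) (n : nat) : m + n%:Z - 1 = m - 1 + n%:Z.
Proof. by rewrite addrAC. Qed.
Lemma tot_degS (m : int) (n : nat) : m + n%:Z = m - 1 + n.+1%:Z.
Proof. by rewrite intS addrA subrK. Qed.

(** The horizontal differential into column [n]. Its sign makes it anticommute with the vertical
    one, and nothing enters column 0. *)
Definition tot_prev m G (z : tot_ob m G) n : E n (m - 1 + n%:Z) G :=
  match n with
  | 0%N => 0
  | n'.+1 => (-1) ^ (m + n'%:Z) *:
      ct (E n'.+1) (tot_degS m n') G (delta n' _ G (z n'))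
  end.

Definition tot_d_fun m G (z : tot_ob m G) : tot_ob (m - 1) G :=
  fun n => dg (E n) (tot_deg m n) G (z n) + tot_prev z n.

Lemma tot_d_linear m G : linear (@tot_d_fun m G).
Proof.
move=> a x y; apply: pifunP => n.
rewrite [RHS]pifunD pifunZ /tot_d_fun pifunD pifunZ linearP /=.
rewrite scalerDr addrACA; congr (_ + _).
case: n => [|n] /=; first by rewrite scaler0 [RHS]addr0.
by rewrite pifunD pifunZ !linearP.
Qed.

Lemma tot_d_natural m H G (e : epi H G) (z : tot_ob m G) :
  mk_linear (@tot_d_linear m H) (res (tot_ob m) e z)
  = res (tot_ob (m - 1)) e (mk_linear (@tot_d_linear m G) z).
Proof.
apply: pifunP => n; rewrite /= /tot_res_fun /tot_d_fun linearD nt_natural.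
congr (_ + _); case: n => [|n] /=; first by rewrite linear0.
by rewrite linearZ_LR /tot_res_fun !nt_natural.
Qed.

Definition tot_d m : nat_trans (tot_ob m) (tot_ob (m - 1)) :=
  NatTrans (@tot_d_natural m).

Lemma tot_dE m G (z : tot_ob m G) n : tot_d m G z n
  = dg (E n) (tot_deg m n) G (z n) + tot_prev z n.
Proof. by []. Qed.

Lemma delta_tot_prev m G (z : tot_ob m G) n : delta n _ G (tot_prev z n) = 0.
Proof.
case: n => [|n] /=; first exact: linear0.
by rewrite linearZ_LR cm_ct delta2 linear0 /= scaler0.
Qed.

Lemma tot_sign (m : int) (n : nat) :
  (-1) ^ (m - 1 + n%:Z) = - (-1) ^ (m + n%:Z) :> k.
Proof. by rewrite addrAC signz_pred. Qed.

Lemma tot_dd m G (z : tot_ob m G) : tot_d (m - 1) G (tot_d m G z) = 0.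
Proof.
apply: pifunP => n; rewrite !tot_dE linearD dg_dg add0r pifun0.
case: n => [|n]; first by rewrite /tot_prev linear0 addr0.
rewrite {2}/tot_prev tot_dE.
have -> (x y : E n (m - 1 + n%:Z) G) : delta n _ G (x + y) = delta n _ G x + delta n _ G y.
  exact: linearD.
rewrite delta_tot_prev addr0 /tot_prev linearZ_LR cm_dg /=.
have e : m + n%:Z - 1 = m - 1 - 1 + n.+1%:Z by rewrite tot_deg -tot_degS.
rewrite (dg_ct _ _ e) (ct_dg _ _ e) tot_sign scaleNr; exact: subrr.
Qed.

Definition tot : complex k U := Complex tot_dd.

Lemma tot_cyc m G (z : tot m G) :
  cyc z <-> forall n, dg (E n) (tot_deg m n) G (z n) = - tot_prev z n.
Proof.
split=> [e n|e].
  by apply/eqP; rewrite -addr_eq0 -tot_dE; apply/eqP; rewrite [LHS](congr1 (@^~ n) e).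
by apply: pifunP => n; rewrite tot_dE e addNr.
Qed.

(** A bounding element is found column by column: once column [n] is solved, the error that it
    creates in column [n + 1] is a cycle again. *)
Lemma tot_acyclic G : (forall n, homology_zero (E n) G) -> homology_zero tot G.
Proof.
move=> hE; apply/homology_zeroP; elim/int_pred_ind => m z /tot_cyc cz.
(* The preimage exists for every [x] and is arbitrary off the cycles, so that the recursion [w] can
   be written before the cycle conditions are known. *)
have {}hE n (x : E n (m - 1 + n%:Z) G) : exists w : E n (m + n%:Z) G,
    cyc x -> dg (E n) (tot_deg m n) G w = x.
  have [cx|] := pselect (cyc x); last by exists 0.
  have /homology_zeroP/(_ _ _ cx) := hE n.
  by move=> /(bd_dgP (tot_deg m n))[w we]; exists w.
pose p n x := sval (cid (hE n x)).
have pP n x : cyc x -> dg (E n) (tot_deg m n) G (p n x) = x.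
  by rewrite /p; case: cid.
pose w := fix w n : E n (m + n%:Z) G := match n with
  | 0%N => p 0%N (z 0%N)
  | n'.+1 => p n'.+1 (z n'.+1 - (-1) ^ (m + n'%:Z) *:
      ct (E n'.+1) (tot_degS m n') G (delta n' _ G (w n')))
  end.
have wE n : w n = p n (z n - tot_prev (w : tot_ob m G) n).
  by case: n => [|n] //=; rewrite (subr0 (z 0%N)).
have dw n : dg (E n) (tot_deg m n) G (w n) = z n - tot_prev (w : tot_ob m G) n.
  rewrite wE; apply: (pP n); apply/(cyc_dg (tot_deg (m - 1) n)).
  elim: n => [|n IH]; first by rewrite /= (subr0 (z 0%N)) cz /= oppr0.
  move/(cyc_dg (tot_deg (m - 1) n)): IH => /(pP n); rewrite -wE => IH.
  rewrite linearB cz /= -opprD; apply/eqP; rewrite oppr_eq0; apply/eqP.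
  have e : m + n%:Z - 1 = m - 1 - 1 + n.+1%:Z by rewrite tot_deg -tot_degS.
  rewrite linearZ_LR /= (dg_ct _ _ e).
  have <- : ct (E n.+1) (tot_degS (m - 1) n) G
      (delta n _ G (dg (E n) (tot_deg m n) G (w n)))
    = dg (E n.+1) e G (delta n (m + n%:Z) G (w n)) by rewrite cm_dg (ct_dg _ _ e).
  have -> : delta n _ G (dg (E n) (tot_deg m n) G (w n)) = delta n _ G (z n).
    rewrite IH.
    by rewrite -[LHS]/(delta n _ G (z n - _)) (linearB (delta n _ G)) delta_tot_prev subr0.
  rewrite tot_sign scaleNr; exact: addNr.
apply/bdP; exists w; apply: pifunP => n.
by rewrite -[LHS]/(tot_d m G w n) tot_dE dw subrK.
Qed.

Variable G0 : member U.
Variable s : forall n q, {linear E n.+1 q G0 -> E n q G0}.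
Hypothesis s_dg : forall n p q (e : p - 1 = q) x,
  s n q (dg (E n.+1) e G0 x) = dg (E n) e G0 (s n p x).

Lemma s_ct n p q (e : p = q) x : s n q (ct (E n.+1) e G0 x) = ct (E n) e G0 (s n p x).
Proof. by subst q. Qed.

(** The maps [s] play the role of extra degeneracies; they live at the single group [G0], without
    naturality. The boundary of [w] is [s delta + delta s] applied to [y], except in column 0 where
    only [s delta] occurs. What this equals there differs between the two uses: the resolution has
    an augmentation, the Cech complex of a generator has none. *)
Lemma tot_contract m (y : tot_ob (m - 1) G0) : @cyc k U tot G0 (m - 1) y ->
  exists w : tot_ob m G0,
    tot_d_fun w 0%N = s 0 _ (delta 0 _ G0 (y 0%N)) /\
    forall n, tot_d_fun w n.+1 =
      s n.+1 _ (delta n.+1 _ G0 (y n.+1)) + delta n _ G0 (s n _ (y n.+1))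
      :> E n.+1 (m - 1 + n.+1%:Z) G0.
Proof.
move=> /tot_cyc cy.
pose w : tot_ob m G0 := fun n => (-1) ^ (m + n%:Z) *:
  s n _ (ct (E n.+1) (esym (tot_degS m n)) G0 (y n.+1)).
have dw n : dg (E n) (tot_deg m n) G0 (w n) = s n _ (delta n _ G0 (y n)).
  rewrite /w linearZ_LR /= -s_dg.
  have e : m - 1 + n.+1%:Z - 1 = m - 1 + n%:Z by rewrite -tot_degS tot_deg.
  rewrite (dg_ct _ _ e) -(ct_dg (tot_deg (m - 1) n.+1) (esym (tot_degS (m - 1) n))).
  have -> : dg (E n.+1) (tot_deg (m - 1) n.+1) G0 (y n.+1) = (-1) ^ (m + n%:Z) *:
      ct (E n.+1) (tot_degS (m - 1) n) G0 (delta n _ G0 (y n)).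
    by rewrite cy /tot_prev tot_sign scaleNr opprK.
  rewrite [ct _ _ _ _]linearZ_LR /= ctK [s _ _ _]linearZ_LR /=.
  by rewrite scalerA signz_mul scale1r.
exists w; split=> [|n]; first by rewrite /tot_d_fun dw addr0.
rewrite /tot_d_fun dw; congr (_ + _).
by rewrite /= /w linearZ_LR /= linearZ_LR scalerA signz_mul scale1r -!cm_ct -s_ct ctK.
Qed.

End Tot.

(** * Epimorphism classes and coinduction *)

Section MkEpi.
Variables (H G : finGroupType) (f : H -> G).
Hypothesis fM : {morph f : x y / (x * y)%g}.
Hypothesis fS : forall y, exists x, f x = y.
HB.instance Definition _ := isMultiplicative.Build H G f fM.
Definition mk_epi : epi H G := @Epi H G f fS.
End MkEpi.

Lemma epiM (H G : finGroupType) (f : epi H G) : {morph f : x y / (x * y)%g}.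
Proof. exact: gmulfM. Qed.

Lemma epiV (H G : finGroupType) (f : epi H G) x : f x^-1%g = (f x)^-1%g.
Proof. by apply: (mulgI (f x)); rewrite -epiM !mulgV epi1. Qed.

Lemma epiJ (H G : finGroupType) (f : epi H G) x y : f (x ^ y)%g = (f x ^ f y)%g.
Proof. by rewrite /conjg !epiM epiV. Qed.

Lemma epi_conj_ext (H G : finGroupType) (f g : epi H G) : f =1 g -> epi_conj f g.
Proof. by move=> fg; exists 1%g => x; rewrite conjg1. Qed.
Lemma epi_conj_refl (H G : finGroupType) (f : epi H G) : epi_conj f f.
Proof. exact: epi_conj_ext. Qed.
Lemma epi_conj_sym (H G : finGroupType) (f g : epi H G) :
  epi_conj f g -> epi_conj g f.
Proof. by move=> [a fg]; exists a^-1%g => x; rewrite fg conjgK. Qed.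
Lemma epi_conj_trans (H G : finGroupType) (f g h : epi H G) :
  epi_conj f g -> epi_conj g h -> epi_conj f h.
Proof. by move=> [a fg] [b gh]; exists (a * b)%g => x; rewrite gh fg conjgM. Qed.
Lemma epi_conj_comp (K H G : finGroupType) (f f' : epi H G) (g g' : epi K H) :
  epi_conj f f' -> epi_conj g g' -> epi_conj (comp_epi f g) (comp_epi f' g').
Proof.
move=> [a fa] [b gb]; exists (f b * a)%g => x /=.
by rewrite gb fa epiJ conjgM.
Qed.

Lemma epi_isog (H G : finGroupType) (f : epi H G) : injective f ->
  [set: H] \isog [set: G].
Proof.
move=> fI; have fM : {in [set: H] &, {morph f : x y / (x * y)%g}}.
  by move=> x y _ _; apply: epiM.
pose fm := Morphism fM.
apply: (isom_isog fm (subxx [set: H])); apply/isomP; split; first by apply/injmP => x y _ _ /fI.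
apply/eqP; rewrite eqEsubset subsetT; apply/subsetP => y _.
have [x <-] := epi_surj f y.
by rewrite morphimEdom; apply/imsetP; exists x.
Qed.

Lemma epi_inv (H G : finGroupType) (f : epi H G) : injective f ->
  exists g : epi G H, cancel f g /\ cancel g f.
Proof.
move=> fI; have [g gP] := choice (epi_surj f).
have fg : cancel f g by move=> x; apply: fI; rewrite gP.
have gM : {morph g : x y / (x * y)%g}.
  by move=> x y; apply: fI; rewrite epiM !gP.
have gS y : exists x, g x = y by exists (f y).
by exists (mk_epi gM gS).
Qed.

(* Cayley: every finite group is a subgroup of some ['S_n], so the isomorphism
   classes of groups of [U] are indexed by a small type. *)
Section Cayley.
Variable G : finGroupType.

Definition cayley_fun (x : G) (i : 'I_#|G|) : 'I_#|G| :=
  enum_rank (enum_val i * x)%g.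
Lemma cayley_inj x : injective (cayley_fun x).
Proof. by move=> i j /enum_rank_inj/mulIg/enum_val_inj. Qed.
Definition cayley (x : G) : {perm 'I_#|G|} := perm (@cayley_inj x).
Lemma cayleyM : {morph cayley : x y / (x * y)%g}.
Proof.
move=> x y; apply/permP => i; rewrite permM !permE /cayley_fun.
by rewrite enum_rankK mulgA.
Qed.
Lemma cayley_injective : injective cayley.
Proof.
move=> x y /permP/(_ (enum_rank 1%g)); rewrite !permE /cayley_fun.
by move/enum_rank_inj; rewrite enum_rankK !mul1g.
Qed.
Lemma cayley_group_set : group_set [set cayley x | x : G].
Proof.
apply/group_setP; split.
  apply/imsetP; exists 1%g => //; apply/esym/(mulgI (cayley 1%g)).
  by rewrite -cayleyM !mulg1.
move=> _ _ /imsetP[x _ ->] /imsetP[y _ ->].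
by apply/imsetP; exists (x * y)%g; rewrite ?cayleyM.
Qed.
Definition cayley_group := group cayley_group_set.

Lemma cayley_epi : exists f : epi G (subg_of cayley_group), injective f.
Proof.
have cP x : cayley x \in cayley_group by apply/imsetP; exists x.
pose f x : subg_of cayley_group := Subg (cP x).
have fM : {morph f : x y / (x * y)%g} by move=> x y; apply/val_inj/cayleyM.
have fS y : exists x, f x = y.
  case: y => y yP; have /imsetP[x _ e] := yP.
  by exists x; apply: val_inj; rewrite /= e.
by exists (mk_epi fM fS) => x y /(congr1 val)/cayley_injective.
Qed.

End Cayley.

Section Skeleton.
Variable U : group_family.
Hypothesis U_replete : replete U.

(** The products of [coind] and the sums of [cells] run over this type, since [member U] lives in a
    larger universe than the modules to be formed. *)
Record skel := Skel {
  sk_n : nat;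
  sk_group : {group {perm 'I_sk_n}};
  sk_member : U (subg_of sk_group) }.

Definition sk (c : skel) : member U := Member (sk_member c).

Lemma sk_exists (G : member U) : exists (c : skel) (a : epi (sk c) G) (b : epi G (sk c)),
  cancel a b /\ cancel b a.
Proof.
have [b bI] := @cayley_epi G; have [a [ba ab]] := epi_inv bI.
have h := U_replete (memberP G) (epi_isog bI).
by exists (Skel h), a, b.
Qed.

Definition skof (G : member U) : skel := sval (cid (sk_exists G)).
Definition sk_to (G : member U) : epi (sk (skof G)) G := sval (cid (svalP (cid (sk_exists G)))).
Definition sk_from (G : member U) : epi G (sk (skof G)) :=
  sval (cid (svalP (cid (svalP (cid (sk_exists G)))))).
Lemma sk_fromK (G : member U) : cancel (sk_from G) (sk_to G).
Proof. exact: (proj2 (svalP (cid (svalP (cid (svalP (cid (sk_exists G)))))))). Qed.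

End Skeleton.

Section EpiClass.
Variables (H G : finGroupType).

Definition ecls := {A : epi H G -> Prop | exists f, A = epi_conj f}.
Definition ecl (f : epi H G) : ecls := exist _ (epi_conj f) (ex_intro _ f erefl).
Definition erep (c : ecls) : epi H G := sval (cid (svalP c)).

Lemma ecl_eq f g : epi_conj f g -> ecl f = ecl g.
Proof.
move=> fg; apply: eq_exist; apply/funext => h; apply/propext; split.
  exact/epi_conj_trans/epi_conj_sym.
exact: epi_conj_trans.
Qed.

Lemma ecl_conj f g : ecl f = ecl g -> epi_conj f g.
Proof. by move/(congr1 sval) => /= ->; apply: epi_conj_refl. Qed.

Lemma erepK : cancel erep ecl.
Proof.
move=> [A At]; apply: eq_exist; rewrite /erep; case: cid => t /= e.
by rewrite e.
Qed.

Lemma erep_ecl f : epi_conj f (erep (ecl f)).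
Proof. by apply: ecl_conj; rewrite erepK. Qed.

End EpiClass.

Section Coinduced.
Variables (k : fieldType) (U : group_family).
Hypothesis U_replete : replete U.

Section Functor.
Variable M : gfunctor k U.

(** [coind M] is the cofree functor on the family of vector spaces [M c]: a map from [A] to it
    amounts to arbitrary linear maps from [A c] to [M c], one for each [c] in the skeleton. *)
Definition coind_idx (G : member U) := {c : skel U & ecls (sk c) G}.
Definition coind_V (G : member U) (i : coind_idx G) : lmodType k := M (sk (tag i)).

Definition coind_res_fun (H G : member U) (e : epi H G) (w : pifun (@coind_V G)) :
  pifun (@coind_V H) :=
  fun i => w (Tagged (fun c : skel U => ecls (sk c) G) (ecl (comp_epi e (erep (tagged i))))).
Lemma coind_res_linear (H G : member U) (e : epi H G) : linear (@coind_res_fun H G e).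
Proof. by move=> a x y; apply: pifunP. Qed.

Definition coind : gfunctor k U.
Proof.
apply: (@GFunctor k U (fun G => pifun (@coind_V G))
  (fun H G e => mk_linear (@coind_res_linear H G e))).
- move=> H G f g fg w; apply: pifunP => -[c h] /=; rewrite /coind_res_fun /=.
  have -> // : ecl (comp_epi f (erep h)) = ecl (comp_epi g (erep h)).
  exact/ecl_eq/epi_conj_comp/epi_conj_refl.
- move=> G w; apply: pifunP => -[c h] /=; rewrite /coind_res_fun /=.
  have -> // : ecl (comp_epi (id_epi G) (erep h)) = h.
  by rewrite -[RHS]erepK; apply/ecl_eq/epi_conj_ext.
- move=> K H G f g w; apply: pifunP => -[c h] /=; rewrite /coind_res_fun /=.
  have -> // : ecl (comp_epi (comp_epi f g) (erep h))
    = ecl (comp_epi f (erep (ecl (comp_epi g (erep h))))).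
  apply/ecl_eq/epi_conj_trans/epi_conj_comp/erep_ecl/epi_conj_refl.
  exact: epi_conj_ext.
Defined.

Definition coind_at (G : member U) (w : coind G) (c : skel U) (h : ecls (sk c) G) : M (sk c) :=
  (w : pifun (@coind_V G)) (Tagged (fun c : skel U => ecls (sk c) G) h).

Lemma coindP (G : member U) (w w' : coind G) :
  (forall c h, @coind_at G w c h = coind_at w' h) -> w = w'.
Proof. by move=> e; apply: pifunP => -[c h]; apply: e. Qed.

Lemma coind_res (H G : member U) (e : epi H G) (w : coind G) c (h : ecls (sk c) H) :
  coind_at (res coind e w) h = coind_at w (ecl (comp_epi e (erep h))).
Proof. by []. Qed.

Definition eta_fun (G : member U) (x : M G) : coind G := fun i => res M (erep (tagged i)) x.
Lemma eta_linear (G : member U) : linear (@eta_fun G).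
Proof. by move=> a x y; apply: pifunP => i; rewrite /eta_fun linearP. Qed.
Lemma eta_natural (H G : member U) (e : epi H G) (x : M G) :
  mk_linear (@eta_linear H) (res M e x) = res coind e (mk_linear (@eta_linear G) x).
Proof.
apply: pifunP => -[c h] /=; rewrite /coind_res_fun /eta_fun /= -res_comp.
exact/res_conj/erep_ecl.
Qed.
Definition eta : nat_trans M coind := NatTrans eta_natural.

(** Evaluation at a chosen isomorphism from the skeleton. It splits [eta] at each group and is
    natural in [M]; naturality in [G] is not claimed, which is why [tot_contract] works at one
    group. *)
Definition ceval_fun (G : member U) (w : coind G) : M G :=
  res M (sk_from U_replete G) (coind_at w (ecl (sk_to U_replete G))).
Lemma ceval_linear (G : member U) : linear (@ceval_fun G).
Proof. by move=> a x y; rewrite /ceval_fun -linearP. Qed.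
Definition ceval (G : member U) : {linear coind G -> M G} := mk_linear (@ceval_linear G).

Lemma ceval_eta (G : member U) (x : M G) : ceval G (eta G x) = x.
Proof.
rewrite /= /ceval_fun /coind_at /= /eta_fun /= -res_comp -[RHS]res_id.
apply: res_conj; apply: epi_conj_trans (epi_conj_comp (epi_conj_sym (erep_ecl _)) (epi_conj_refl _)) _.
by apply: epi_conj_ext => y /=; rewrite sk_fromK.
Qed.

End Functor.

Section Map.
Variables (M N : gfunctor k U) (f : nat_trans M N).
Definition coind_map_fun (G : member U) (w : coind M G) : coind N G :=
  fun i => f (sk (tag i)) ((w : pifun (@coind_V M G)) i).
Lemma coind_map_linear (G : member U) : linear (@coind_map_fun G).
Proof. by move=> a x y; apply: pifunP => i; rewrite /coind_map_fun linearP. Qed.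
Lemma coind_map_natural (H G : member U) (e : epi H G) (x : coind M G) :
  mk_linear (@coind_map_linear H) (res (coind M) e x)
  = res (coind N) e (mk_linear (@coind_map_linear G) x).
Proof. by []. Qed.
Definition coind_map : nat_trans (coind M) (coind N) := NatTrans coind_map_natural.

Lemma coind_mapE (G : member U) (w : coind M G) c h :
  @coind_at N G (coind_map G w) c h = f (sk c) (coind_at w h).
Proof. by []. Qed.

Lemma eta_map (G : member U) (x : M G) : coind_map G (eta M G x) = eta N G (f G x).
Proof. by apply: pifunP => i; rewrite /= /coind_map_fun /eta_fun nt_natural. Qed.

Lemma ceval_map (G : member U) (w : coind M G) : ceval N G (coind_map G w) = f G (ceval M G w).
Proof. by rewrite /= /ceval_fun coind_mapE nt_natural. Qed.

End Map.
End Coinduced.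

(** * K-injective resolutions *)

Section KInjective.
Variables (k : fieldType) (U : group_family).
Implicit Types (X Y Z W A B C I : complex k U) (G H : member U).

(** With a generalized inverse [s] of each differential, [s (1 - s d)] is a contraction: [x - s d x]
    is a cycle, hence a boundary, and [d s] fixes boundaries. *)
Lemma acyclic_contraction A G : homology_zero A G ->
  exists kap : forall m, {linear A (m - 1) G -> A m G}, forall m x,
    diff A m G (kap m x) + kap (m - 1) (diff A (m - 1) G x) = x.
Proof.
move=> /homology_zeroP hA.
pose s m := sval (cid (lin_pinv (diff A m G))).
have sP m x : diff A m G (s m (diff A m G x)) = diff A m G x.
  by rewrite /s; case: cid.
have lin m : linear (fun x => s m (x - s (m - 1) (diff A (m - 1) G x))).
  move=> a x y; rewrite -[RHS]linearP; congr (s m _).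
  by rewrite 2!linearP /= [- (_ + _)]opprD addrACA scalerBr.
exists (fun m => mk_linear (lin m)) => m x /=.
rewrite dd linear0 subr0.
have /hA/bdP[z e] : cyc (x - s (m - 1) (diff A (m - 1) G x)).
  by rewrite /cyc linearB sP subrr.
by rewrite -e sP e subrK.
Qed.

(* [I] is K-injective; [t] is a shift of degrees, and the statement is about
   null-homotopy of chain maps of arbitrary degree. *)
Definition kinj I : Prop := forall A, acyclic A ->
  forall (t : int -> int) (te : forall m, t m - 1 = t (m - 1))
    (phi : forall m, nat_trans (A m) (I (t m))),
  (forall m G (x : A m G),
    phi (m - 1) G (diff A m G x) = dg I (te m) G (phi m G x)) ->
  exists h : forall m, nat_trans (A (m - 1)) (I (t m)),
    forall m G (x : A (m - 1) G), phi (m - 1) G x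
      = dg I (te m) G (h m G x) + h (m - 1) G (diff A (m - 1) G x).

(** Passes from the indexing of homotopies, by [m - 1], to the ordinary indexing by all degrees. *)
Lemma deg_reindex A (V : int -> gfunctor k U)
    (phi : forall m, nat_trans (A (m - 1)) (V (m - 1))) :
  exists psi : forall m, nat_trans (A m) (V m),
    forall m G x, psi (m - 1) G x = phi m G x.
Proof.
have e (m : int) : m = m + 1 - 1 by rewrite addrK.
have e' (m : int) : m + 1 - 1 = m by rewrite addrK.
pose c m : nat_trans (V (m + 1 - 1)) (V m) :=
  ecast i (nat_trans (V (m + 1 - 1)) (V i)) (e' m) (nt_id _).
exists (fun m => nt_comp (c m) (nt_comp (phi (m + 1)) (ct A (e m)))) => m G x /=.
rewrite /c; move: (e (m - 1)) (e' (m - 1)).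
have -> : m - 1 + 1 = m by rewrite subrK.
by move=> a b; rewrite ct_id eq_axiomK.
Qed.

Variables (U_replete : replete U).

Definition ccx X : complex k U.
Proof.
apply: (@Complex k U (fun n => coind (X n)) (fun n => coind_map (diff X n))).
by move=> n G x; apply: pifunP => i; rewrite /= /coind_map_fun dd.
Defined.

Definition ccx_map X Y (f : chain_map X Y) : chain_map (ccx X) (ccx Y).
Proof.
apply: (@ChainMap k U (ccx X) (ccx Y) (fun n => coind_map (f n))).
by move=> n G x; apply: pifunP => i; rewrite /= /coind_map_fun cm_d.
Defined.

Definition ccx_eta X : chain_map X (ccx X).
Proof.
apply: (@ChainMap k U X (ccx X) (fun n => eta (X n))) => n G x.
exact/esym/eta_map.
Defined.

Lemma ccx_at_dg X p q (e : p - 1 = q) G (w : ccx X p G) c h :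
  coind_at (dg (ccx X) e G w) h = dg X e (sk c) (coind_at w h).
Proof. by subst q. Qed.

(** A map into [ccx B] is determined by its components [psi] at the identity classes, and these obey
    no compatibility. Hence the contractions of the complexes [A c], which are not natural in the
    group, still define a natural homotopy. *)
Lemma ccx_kinj B : kinj (ccx B).
Proof.
move=> A hA t te phi closed.
have K c := acyclic_contraction (hA (sk c)).
pose kap c := sval (cid (K c)).
have kapP (c : skel U) m (x : A (m - 1) (sk c)) : diff A m _ (kap c m x) +
    kap c (m - 1) (diff A (m - 1) _ x) = x by rewrite /kap; case: cid.
pose psi (c : skel U) m (y : A m (sk c)) : B (t m) (sk c) :=
  coind_at (phi m (sk c) y) (ecl (id_epi (sk c))).
have psiP c a m (x y : A m (sk c)) : psi c m (a *: x + y) = a *: psi c m x + psi c m y.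
  by rewrite /psi linearP.
have phi_psi m G (x : A m G) (c : skel U) (f : ecls (sk c) G) :
    coind_at (phi m G x) f = psi c m (res (A m) (erep f) x).
  rewrite /psi nt_natural coind_res; congr (coind_at _ _).
  rewrite -[LHS]erepK; apply/ecl_eq.
  apply: epi_conj_trans (epi_conj_comp (epi_conj_refl _) (erep_ecl _)).
  exact: epi_conj_ext.
pose h m G (x : A (m - 1) G) : ccx B (t m) G :=
  fun i => psi (tag i) m (kap (tag i) m (res (A (m - 1)) (erep (tagged i)) x)).
have h_lin m G : linear (h m G).
  by move=> a x y; apply: pifunP => i; rewrite /h !linearP psiP.
have h_nat m H G (e : epi H G) (x : A (m - 1) G) :
  mk_linear (h_lin m H) (res (A (m - 1)) e x)
  = res (ccx B (t m)) e (mk_linear (h_lin m G) x).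
  apply: pifunP => -[c f] /=; rewrite /h /coind_res_fun /=; congr (psi _ _ (kap _ _ _)).
  by rewrite -res_comp; apply/res_conj/erep_ecl.
exists (fun m => NatTrans (h_nat m)) => m G x; apply: coindP => c f.
rewrite phi_psi -[in LHS](kapP c m (res _ _ x)).
(* Additivity of [psi], obtained from [psiP] with the scalar 1. *)
rewrite -[diff A m _ _]scale1r psiP scale1r.
rewrite {1}/psi closed ccx_at_dg nt_natural.
have -> (u v : ccx B (t (m - 1)) G) : coind_at (u + v) f = coind_at u f + coind_at v f by [].
by rewrite ccx_at_dg.
Qed.

Section TotKInj.
Variables (E : nat -> complex k U).
Variable delta : forall n, chain_map (E n) (E n.+1).
Hypothesis delta2 : forall n q G (x : E n q G),
  delta n.+1 q G (delta n q G x) = 0.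

Lemma tot_dgE p q (e : p - 1 = q) G (z : tot_ob E p G) (n : nat)
    (e1 : p + n%:Z - 1 = q + n%:Z) :
  (dg (tot delta2) e G z : tot_ob E q G) n = dg (E n) e1 G (z n) +
   match n return p + n%:Z - 1 = q + n%:Z -> E n (q + n%:Z) G with
   | 0%N => fun=> 0
   | n'.+1 => fun e1 => (-1) ^ (p + n'%:Z) *: ct (E n'.+1)
       (etrans (tot_degS p n') (congr1 (fun i => i + n'.+1%:Z) e)) G (delta n' _ G (z n'))
   end e1.
Proof.
subst q; rewrite /= -/(tot_d_fun delta z) /tot_d_fun (eq_irrelevance e1 (tot_deg p n)).
by congr (_ + _); case: n e1.
Qed.

(** The homotopy is built by columns. The part of [phi] in column [n + 1], minus what column [n]
    already contributes, is a closed map into [E n.+1], which is K-injective. *)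
Lemma tot_kinj : (forall n, kinj (E n)) -> kinj (tot delta2).
Proof.
move=> hE A hA t te phi closed.
pose T n m := t m + n%:Z.
have Te n m : T n m - 1 = T n (m - 1) by rewrite /T addrAC te.
have TS n m : t m + n%:Z = t (m - 1) + n.+1%:Z by rewrite -te -tot_degS.
pose f n m G (x : A m G) : E n (T n m) G := (phi m G x : tot_ob E (t m) G) n.
have f_lin n m G : linear (f n m G).
  by move=> a x y; rewrite /f linearP.
have f_nat n m H G (e : epi H G) (x : A m G) :
  mk_linear (f_lin n m H) (res (A m) e x)
  = res (E n (T n m)) e (mk_linear (f_lin n m G) x).
  by rewrite /= /f nt_natural.
pose F n m := NatTrans (f_nat n m).
pose Hn n := forall m, nat_trans (A (m - 1)) (E n (T n m)).
(* The invariant is the homotopy identity after applying [delta]. It suffices for the next column,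
   and it is inherited because [delta] kills the contribution [prev] of the column before. *)
pose good n (h : Hn n) := forall m G (x : A (m - 1) G),
  delta n _ G (F n (m - 1) G x) = delta n _ G (dg (E n) (Te n m) G (h m G x))
    + delta n _ G (h (m - 1) G (diff A (m - 1) G x)).
pose prev n (h : Hn n) m G (x : A (m - 1) G) : E n.+1 (T n.+1 (m - 1)) G :=
  (-1) ^ (T n m) *: ct (E n.+1) (TS n m) G (delta n _ G (h m G x)).
have F0 m G (x : A m G) : F 0%N (m - 1) G (diff A m G x) = dg (E 0%N) (Te 0%N m) G (F 0%N m G x).
  rewrite /= /f closed (tot_dgE _ _ (Te 0%N m)) /=; exact: (addr0 (dg (E 0%N) (Te 0%N m) G _)).
have FS n m G (x : A m G) : F n.+1 (m - 1) G (diff A m G x) =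
    dg (E n.+1) (Te n.+1 m) G (F n.+1 m G x) +
     (-1) ^ (T n m) *: ct (E n.+1) (TS n m) G (delta n _ G (F n m G x)).
  rewrite /= /f closed (tot_dgE _ _ (Te n.+1 m)) /=.
  by congr (_ + _ *: ct _ _ _ _); apply: eq_irrelevance.
have [h0 h0P] := hE 0%N A hA (T 0%N) (Te 0%N) (F 0%N) F0.
have g0 : good 0%N h0.
  by move=> j G x; rewrite h0P linearD.
have step n (h : Hn n) : good n h -> exists h' : Hn n.+1, forall m G (x : A (m - 1) G),
    F n.+1 (m - 1) G x = dg (E n.+1) (Te n.+1 m) G (h' m G x) + prev n h m G x
      + h' (m - 1) G (diff A (m - 1) G x).
  move=> hg.
  have P_lin m G : linear (prev n h m G).
    by move=> a x y; rewrite /prev !linearP.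
  have P_nat m H G (e : epi H G) (x : A (m - 1) G) :
    mk_linear (P_lin m H) (res (A (m - 1)) e x)
    = res (E n.+1 (T n.+1 (m - 1))) e (mk_linear (P_lin m G) x).
    by rewrite /= /prev linearZ_LR !nt_natural.
  have [psi psiE] := @deg_reindex A (fun m => E n.+1 (T n.+1 m))
    (fun m => nt_add (F n.+1 (m - 1)) (nt_opp (NatTrans (P_nat m)))).
  have psi_closed m G (x : A m G) :
    psi (m - 1) G (diff A m G x) = dg (E n.+1) (Te n.+1 m) G (psi m G x).
    elim/int_pred_ind: m => m in x *.
    rewrite !psiE; set Fx := F n.+1 (m - 1) G x.
    rewrite -[LHS]/(F n.+1 (m - 1 - 1) G (diff A (m - 1) G x)
      - prev n h (m - 1) G (diff A (m - 1) G x)).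
    rewrite -[in RHS]/(Fx - prev n h m G x) linearB FS.
    apply: etrans (esym (addrA _ _ _)) _; congr (_ + _).
    rewrite hg /prev !linearD addrK linearZ_LR /= cm_dg.
    have e : T n m - 1 = t (m - 1 - 1) + n.+1%:Z by rewrite Te /T (TS n (m - 1)).
    rewrite (ct_dg _ _ e) (dg_ct _ _ e) -scaleNr; congr (_ *: _).
    by rewrite -Te signz_pred.
  have [h' h'P] := hE n.+1 A hA (T n.+1) (Te n.+1) psi psi_closed.
  exists h' => m G x; have := h'P m G x; rewrite psiE /= => /eqP.
  by rewrite subr_eq => /eqP ->; rewrite addrAC.
have step_good n (h : Hn n) (h' : Hn n.+1) : (forall m G (x : A (m - 1) G),
    F n.+1 (m - 1) G x = dg (E n.+1) (Te n.+1 m) G (h' m G x) + prev n h m G x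
      + h' (m - 1) G (diff A (m - 1) G x)) -> good n.+1 h'.
  move=> hP m G x; rewrite hP !linearD; congr (_ + _).
  by rewrite /prev linearZ_LR /= cm_ct delta2 linear0 scaler0 addr0.
pose S := fix S n : {h : Hn n | good n h} := match n with
  | 0%N => exist _ h0 g0
  | n'.+1 => let c := cid (step n' (sval (S n')) (svalP (S n'))) in
     exist _ (sval c) (step_good _ _ _ (svalP c))
  end.
have SP n m G (x : A (m - 1) G) : F n.+1 (m - 1) G x =
    dg (E n.+1) (Te n.+1 m) G (sval (S n.+1) m G x)
    + prev n (sval (S n)) m G x
    + sval (S n.+1) (m - 1) G (diff A (m - 1) G x).
  by rewrite [sval (S n.+1)]/=; case: cid => h' hP /=.
pose h m G (x : A (m - 1) G) : tot_ob E (t m) G := fun n => sval (S n) m G x.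
have h_lin m G : linear (h m G).
  by move=> a x y; apply: pifunP => n; rewrite /h linearP.
have h_nat m H G (e : epi H G) (x : A (m - 1) G) :
  mk_linear (h_lin m H) (res (A (m - 1)) e x)
  = res (tot delta2 (t m)) e (mk_linear (h_lin m G) x).
  by apply: pifunP => n; rewrite /= /h nt_natural.
exists (fun m => NatTrans (h_nat m)) => m G x.
apply: pifunP => n; rewrite [RHS]pifunD (tot_dgE _ _ (Te n m)).
case: n => [|n] /=.
  rewrite (addr0 (dg (E 0%N) _ _ _)).
  exact: (h0P m G x).
rewrite [X in ct _ X](eq_irrelevance _ (TS n m)).
exact: (SP n m G x).
Qed.

End TotKInj.
End KInjective.

Section Resolution.
Variables (k : fieldType) (U : group_family).
Implicit Types (X Y Z W A B C I : complex k U) (G H : member U).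
Hypothesis U_replete : replete U.

Section Cobar.
Variable Z : complex k U.

Fixpoint cobar n : complex k U := if n is n'.+1 then ccx (cobar n') else Z.

(** The alternating sum of the cofaces: one is the unit [eta] of the outermost coinduction, the
    others are those of the previous stage under coinduction. *)
Fixpoint cobar_delta n : chain_map (cobar n) (cobar n.+1) :=
  match n with
  | 0%N => ccx_eta Z
  | n'.+1 => chain_add (ccx_eta (cobar n'.+1)) (chain_opp (ccx_map (cobar_delta n')))
  end.

Lemma cobar_deltaS n q G (x : cobar n.+1 q G) : cobar_delta n.+1 q G x
  = ccx_eta (cobar n.+1) q G x - ccx_map (cobar_delta n) q G x.
Proof. by []. Qed.

Lemma cobar_delta2 n q G (x : cobar n q G) :
  cobar_delta n.+1 q G (cobar_delta n q G x) = 0.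
Proof.
elim: n => [|n IH] in q G x *.
  rewrite cobar_deltaS; apply/eqP; rewrite subr_eq0; apply/eqP.
  exact/esym/eta_map.
rewrite cobar_deltaS; apply/eqP; rewrite subr_eq0; apply/eqP.
have <- : coind_map (cobar_delta n.+1 q) G (ccx_eta (cobar n.+1) q G x)
   = ccx_eta (cobar n.+2) q G (cobar_delta n.+1 q G x) by apply: eta_map.
rewrite [cobar_delta n.+1 q G x]cobar_deltaS linearB.
have -> : ccx_map (cobar_delta n.+1) q G (ccx_map (cobar_delta n) q G x) = 0.
  by apply: pifunP => i; apply: IH.
by rewrite subr0.
Qed.

Definition cobar_s G n q : {linear cobar n.+1 q G -> cobar n q G} :=
  ceval U_replete (cobar n q) G.

Lemma cobar_s_dg G n p q (e : p - 1 = q) x :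
  cobar_s G n q (dg (cobar n.+1) e G x) = dg (cobar n) e G (cobar_s G n p x).
Proof. by subst q; apply: ceval_map. Qed.

Lemma cobar_s0 G q (x : Z q G) : cobar_s G 0 q (cobar_delta 0 q G x) = x.
Proof. exact: ceval_eta. Qed.

Lemma cobar_sS G n q (x : cobar n.+1 q G) :
  cobar_s G n.+1 q (cobar_delta n.+1 q G x)
   + cobar_delta n q G (cobar_s G n q x) = x.
Proof.
rewrite cobar_deltaS linearB [cobar_s G n.+1 q (ccx_eta _ _ _ _)]ceval_eta.
by rewrite [cobar_s G n.+1 q (ccx_map _ _ _ _)]ceval_map subrK.
Qed.

(** Column 0 is [cobar 1]; the complex [Z], which is not coinduced, enters only through the
    augmentation [kinj_unit]. *)
Definition kinj_res : complex k U :=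
  tot (E := fun n => cobar n.+1) (delta := fun n => cobar_delta n.+1)
    (fun n => @cobar_delta2 n.+1).

Lemma kinj_res_kinj : kinj kinj_res.
Proof. by apply: tot_kinj => n; apply: ccx_kinj. Qed.

Lemma addr0z (m : int) : m = m + 0%:Z. Proof. by rewrite addr0. Qed.

Definition kinj_unit0 m : nat_trans (Z m) (cobar 1 (m + 0%:Z)) :=
  nt_comp (ct (cobar 1) (addr0z m)) (cobar_delta 0 m).

Lemma kinj_unit0_dg p q (e : p - 1 = q) (e' : p + 0%:Z - 1 = q + 0%:Z) G
    (x : Z p G) :
  kinj_unit0 q G (dg Z e G x) = dg (cobar 1) e' G (kinj_unit0 p G x).
Proof.
have e2 : p - 1 = q + 0%:Z by rewrite addr0.
rewrite -[kinj_unit0 p G x]/(ct _ _ G (ccx_eta Z p G x)) (dg_ct _ _ e2).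
rewrite -[LHS]/(ct _ (addr0z q) G (ccx_eta Z q G (dg Z e G x))) cm_dg.
exact: ct_dg.
Qed.

Definition kinj_unit_fun m G (x : Z m G) : kinj_res m G := fun n =>
  match n return cobar n.+1 (m + n%:Z) G with
  | 0%N => kinj_unit0 m G x
  | _ => 0
  end.
Lemma kinj_unit_linear m G : linear (@kinj_unit_fun m G).
Proof.
move=> a x y; apply: pifunP => -[|n]; rewrite pifunD pifunZ.
  exact: (linearP (kinj_unit0 m G)).
by rewrite /= scaler0 [RHS]addr0.
Qed.
Lemma kinj_unit_natural m (H G : member U) (e : epi H G) (x : Z m G) :
  mk_linear (@kinj_unit_linear m H) (res (Z m) e x)
  = res (kinj_res m) e (mk_linear (@kinj_unit_linear m G) x).
Proof.
apply: pifunP => -[|n]; last by apply/esym; apply: linear0.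
exact: (nt_natural (kinj_unit0 m)).
Qed.
Lemma kinj_unit_d m G (x : Z m G) :
  NatTrans (@kinj_unit_natural (m - 1)) G (diff Z m G x)
  = diff kinj_res m G (NatTrans (@kinj_unit_natural m) G x).
Proof.
apply: pifunP => n; rewrite -[RHS]/(tot_d_fun _ _ n) /tot_d_fun.
case: n => [|[|n]].
- rewrite [RHS]addr0 -[LHS]/(kinj_unit0 (m - 1) G (diff Z m G x)).
  by rewrite -(dgE erefl) (kinj_unit0_dg _ (tot_deg m 0)).
- apply/esym; transitivity (0 + (-1) ^ (m + 0%:Z) *: ct (cobar 2) (tot_degS m 0) G
    (cobar_delta 1 _ G (kinj_unit0 m G x))).
    congr (_ + _); exact: linear0.
  have -> : cobar_delta 1 _ G (kinj_unit0 m G x) = 0.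
    rewrite -[kinj_unit0 m G x]/(ct _ (addr0z m) G (ccx_eta Z m G x)) cm_ct.
    by rewrite [cobar_delta 1 m G _](@cobar_delta2 0) linear0.
  by rewrite !linear0 ?scaler0 add0r.
- apply/esym; transitivity (0 + (-1) ^ (m + n.+1%:Z) *:
      ct (cobar n.+3) (tot_degS m n.+1) G (cobar_delta n.+2 _ G 0)).
    congr (_ + _); exact: linear0.
  by rewrite !linear0 ?scaler0 add0r.
Qed.
Definition kinj_unit : chain_map Z kinj_res :=
  @ChainMap k U Z kinj_res (fun m => NatTrans (@kinj_unit_natural m)) kinj_unit_d.

(** At each group [cobar_s] in column 0 is a chain retraction [r], whence injectivity on homology.
    For surjectivity, [tot_contract] bounds [y - kinj_unit (r y)]; the correction in column 0 is the
    image of the augmentation. *)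
Lemma kinj_unit_qi : quasi_iso kinj_unit.
Proof.
apply/quasi_isoP => G n.
pose r m (w : kinj_res m G) : Z m G :=
  cobar_s G 0 m (ct (cobar 1) (esym (addr0z m)) G (w 0%N)).
have rj m (x : Z m G) : r m (kinj_unit m G x) = x.
  rewrite /r -[X in ct _ _ _ X]/(ct (cobar 1) (addr0z m) G (cobar_delta 0 m G x)).
  by rewrite ctK; apply: cobar_s0.
have rd m (w : kinj_res m G) : r (m - 1) (diff kinj_res m G w) = diff Z m G (r m w).
  rewrite /r -[diff kinj_res m G w]/(tot_d_fun _ _) /tot_d_fun.
  rewrite -[X in ct _ _ _ X]/(dg (cobar 1) (tot_deg m 0) G (w 0%N) + 0) [_ + 0]addr0.
  apply: etrans _ (@cobar_s_dg G 0 m (m - 1) erefl _); congr (cobar_s _ _ _ _).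
  have e : m + 0%:Z - 1 = m - 1 by rewrite addr0.
  by rewrite (ct_dg _ _ e) (dg_ct _ _ e).
split.
  move=> x _; elim/int_pred_ind: n => n in x *.
  by move=> /bdP[w e]; apply/bdP; exists (r n w); rewrite -rd e rj.
elim/int_pred_ind: n => n y cy; exists (r _ y).
  rewrite /cyc -rd cy /r -[X in ct _ _ _ X]/(0 : cobar 1 _ G).
  by rewrite (linear0 (ct _ _ _)) linear0.
apply/bdNE; rewrite opprB; apply/bdP.
have [w [w0 wS]] := @tot_contract k U _ _ (fun n => @cobar_delta2 n.+1) G
  (fun n => cobar_s G n.+1) (fun n => @cobar_s_dg G n.+1) _ _ cy.
exists w; apply: pifunP => -[|j].
  rewrite pifunD pifunN; apply: etrans w0 _.
  have hc p q (e : p = q) (e' : q = p) (x : cobar 1 q G) :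
      ct (cobar 1) e G (cobar_delta 0 p G (cobar_s G 0 p (ct (cobar 1) e' G x)))
      = cobar_delta 0 q G (cobar_s G 0 q x) by subst q; rewrite !ct_id.
  apply/esym; rewrite -[LHS]/(y 0%N - ct (cobar 1) (addr0z _) G (cobar_delta 0 _ G
    (cobar_s G 0 _ (ct (cobar 1) (esym (addr0z _)) G (y 0%N))))) hc.
  apply/eqP; rewrite (subr_eq (y 0%N)); apply/eqP/esym; exact: cobar_sS.
rewrite pifunD pifunN (subr0 (y j.+1)) -[RHS]cobar_sS.
exact: wS.
Qed.

End Cobar.
End Resolution.

Lemma oppr_add_eq0 (V : zmodType) (x y : V) : - x + y = 0 -> y = x.
Proof. by move/eqP; rewrite addrC subr_eq0 => /eqP. Qed.

Section Derived.
Variables (k : fieldType) (U : group_family).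
Implicit Types (X Y Z W A B C I : complex k U) (G H : member U).

Section NtTools.
Variables X Y Z : gfunctor k U.

Fact nt_scale_natural (a : k) (f : nat_trans X Y) (H G : member U) (e : epi H G) x :
  (a \*: f H) (res X e x) = res Y e ((a \*: f G) x).
Proof. by rewrite /= nt_natural linearZ_LR. Qed.
Definition nt_scale (a : k) (f : nat_trans X Y) : nat_trans X Y :=
  @NatTrans k U X Y (fun G => a \*: f G) (nt_scale_natural a f).

Fact nt_fst_linear (G : member U) : linear (fun u : gsum X Y G => u.1).
Proof. by []. Qed.
Definition nt_fst : nat_trans (gsum X Y) X :=
  @NatTrans k U (gsum X Y) X (fun G => mk_linear (@nt_fst_linear G)) (fun _ _ _ _ => erefl).

Fact nt_snd_linear (G : member U) : linear (fun u : gsum X Y G => u.2).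
Proof. by []. Qed.
Definition nt_snd : nat_trans (gsum X Y) Y :=
  @NatTrans k U (gsum X Y) Y (fun G => mk_linear (@nt_snd_linear G)) (fun _ _ _ _ => erefl).

Section Pair.
Variables (f : nat_trans Z X) (g : nat_trans Z Y).
Fact nt_pair_linear (G : member U) : linear (fun x : Z G => (f G x, g G x) : gsum X Y G).
Proof. by move=> a u v; rewrite !linearP. Qed.
Fact nt_pair_natural (H G : member U) (e : epi H G) (x : Z G) :
  mk_linear (@nt_pair_linear H) (res Z e x)
  = res (gsum X Y) e (mk_linear (@nt_pair_linear G) x).
Proof. by congr pair; rewrite /= nt_natural. Qed.
Definition nt_pair : nat_trans Z (gsum X Y) := NatTrans nt_pair_natural.
End Pair.

End NtTools.

Definition nt_inl (X Y : gfunctor k U) : nat_trans X (gsum X Y) := nt_pair (nt_id X) (nt_zero X Y).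
Definition nt_inr (X Y : gfunctor k U) : nat_trans Y (gsum X Y) := nt_pair (nt_zero Y X) (nt_id Y).

Lemma deg_reindex_chain A B (phi : forall m, nat_trans (A (m - 1)) (B (m - 1))) :
  (forall m G (x : A (m - 1) G),
     phi (m - 1) G (diff A (m - 1) G x) = diff B (m - 1) G (phi m G x)) ->
  exists g : chain_map A B, forall m G x, g (m - 1) G x = phi m G x.
Proof.
move=> hphi; have [psi psiE] := @deg_reindex k U A B phi.
have ch n G (x : A n G) : psi (n - 1) G (diff A n G x) = diff B n G (psi n G x).
  by elim/int_pred_ind: n => n in x *; rewrite !psiE hphi.
by exists (ChainMap ch).
Qed.

Section KInjTheory.
Variable I : complex k U.
Hypothesis kI : kinj I.

Lemma kinj_null A (f : chain_map A I) : acyclic A -> htpy f chain_zero.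
Proof.
move=> hA; have [|h hP] := @kI A hA id (fun=> erefl) f.
  by move=> m G x; rewrite /= cm_d.
by exists h => n G x; rewrite /= subr0 hP.
Qed.

(** The sign [(-1) ^ m] absorbs the sign in the differential of [shift I], so that the map becomes a
    closed map of degree -1 into [I]. The degree function in [kinj] allows for such maps. *)
Lemma kinj_null_shift A (f : chain_map A (shift I)) : acyclic A -> htpy f chain_zero.
Proof.
move=> hA; pose phi m : nat_trans (A m) (I (m - 1)) := nt_scale ((-1) ^ m) (f m).
have [|h hP] := @kI A hA (fun m => m - 1) (fun=> erefl) phi.
  move=> m G x; rewrite -[LHS]/((-1) ^ (m - 1) *: f (m - 1) G (diff A m G x)) cm_d.
  rewrite -[RHS]/(diff I (m - 1) G ((-1) ^ m *: f m G x)) linearZ_LR signz_pred.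
  by rewrite /= scaleNr scalerN opprK.
exists (fun n => nt_scale ((-1) ^ n) (h n)) => n G x; rewrite /= subr0.
have /(congr1 ( *:%R ((-1) ^ (n - 1)))) := hP n G x.
rewrite /phi /= scalerA signz_mul scale1r => ->.
by rewrite scalerDr linearZ_LR signz_pred -scaleNr.
Qed.

Lemma kinj_cancel A B (s : chain_map A B) (g : chain_map B I) :
  quasi_iso s -> htpy (chain_comp g s) chain_zero -> htpy g chain_zero.
Proof.
move=> sP [h hP].
have [|F FP] := @cone_factor k U A B I s g h.
  by move=> n G x; rewrite -hP /= subr0.
have F0 : htpy F chain_zero by apply/kinj_null/quasi_iso_cone.
have e : htpy g (chain_comp F (cone_in s)).
  by apply: htpy_ext => n G x; rewrite /= FP /= linear0 add0r.
apply: (htpy_trans e); apply: (htpy_trans (htpy_comp F0 (htpy_refl (cone_in s)))).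
exact: htpy_ext.
Qed.

Lemma kinj_inj A B (s : chain_map A B) (g g' : chain_map B I) :
  quasi_iso s -> htpy (chain_comp g s) (chain_comp g' s) -> htpy g g'.
Proof.
move=> sP /htpy_sub0 h; apply/htpy_subr0/(kinj_cancel sP).
by apply: (htpy_trans _ h); apply: htpy_ext.
Qed.

(** The obstruction to extending [f] is the composite from [cone s] through [shift A] to [shift I],
    null-homotopic since the cone is acyclic. On the summand [B] the null-homotopy is the extension
    [g]; on the summand [A] it is the homotopy between [g s] and [f]. *)
Lemma kinj_ext A B (s : chain_map A B) (f : chain_map A I) : quasi_iso s ->
  exists g : chain_map B I, htpy (chain_comp g s) f.
Proof.
move=> sP.
have [h hP] := kinj_null_shift (chain_comp (chain_shift f) (cone_out s))
  (proj1 (quasi_iso_cone s) sP).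
pose b m : nat_trans (B (m - 1)) (I (m - 1)) := nt_comp (h m) (nt_inr _ _).
pose a m : nat_trans (A (m - 1 - 1)) (I (m - 1)) := nt_comp (h m) (nt_inl _ _).
have E m G (x : A (m - 1 - 1) G) (y : B (m - 1) G) : f (m - 1 - 1) G x
    = - diff I (m - 1) G (h m G (x, y))
      + h (m - 1) G (- diff A (m - 1 - 1) G x, s (m - 1 - 1) G x + diff B (m - 1) G y).
  exact: etrans (esym (subr0 _)) (hP m G (x, y)).
have hab m G (x : A (m - 1 - 1) G) (y : B (m - 1) G) : h m G (x, y) = a m G x + b m G y.
  rewrite /= -linearD; by congr (h m G _); congr pair; [exact: (esym (addr0 x))|exact: (esym (add0r y))].
have [|g gE] := deg_reindex_chain (phi := b).
  move=> m G y; have /esym := E m G 0 y.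
  by rewrite !linear0 ?oppr0 add0r !hab !linear0 !add0r => /oppr_add_eq0.
have [a' a'E] := @deg_reindex k U (shift A) I a.
exists g; exists a' => n G x.
elim/int_pred_ind: n => n in x *.
rewrite -[LHS]/(g (n - 1 - 1) G (s (n - 1 - 1) G x) - f (n - 1 - 1) G x) gE.
rewrite (a'E n) (a'E (n - 1)).
have := E n G x 0; rewrite !hab !linear0 !addr0 => ->.
rewrite linearN opprD opprK addrCA; congr (_ + _).
by rewrite [- (- _ + _)]opprD opprK addrC subrK.
Qed.

End KInjTheory.
End Derived.

(** * Morphisms into a K-injective complex as homotopy classes *)

Section Hom.
Variables (k : fieldType) (U : group_family).
Implicit Types (X Y Z W A B C I : complex k U) (G H : member U).
Hypothesis U_replete : replete U.

Lemma resolution_exists X : exists R : {I : complex k U & chain_map X I},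
  kinj (tag R) /\ quasi_iso (tagged R).
Proof.
exists (Tagged (fun I => chain_map X I) (kinj_unit X)).
by split; [apply: kinj_res_kinj|apply: kinj_unit_qi].
Qed.

Definition Q X : complex k U := tag (sval (cid (resolution_exists X))).
Definition jQ X : chain_map X (Q X) := tagged (sval (cid (resolution_exists X))).
Lemma jQ_qi X : quasi_iso (jQ X).
Proof. exact: (proj2 (svalP (cid (resolution_exists X)))). Qed.
Lemma Q_kinj X : kinj (Q X).
Proof. exact: (proj1 (svalP (cid (resolution_exists X)))). Qed.

Lemma qmap_exists X Y (f : chain_map X Y) : exists g : chain_map (Q X) (Q Y),
  htpy (chain_comp g (jQ X)) (chain_comp (jQ Y) f).
Proof. exact: (kinj_ext (@Q_kinj Y) _ (@jQ_qi X)). Qed.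
Definition qmap X Y (f : chain_map X Y) := sval (cid (qmap_exists f)).
Lemma qmapP X Y (f : chain_map X Y) :
  htpy (chain_comp (qmap f) (jQ X)) (chain_comp (jQ Y) f).
Proof. exact: svalP (cid (qmap_exists f)). Qed.

Lemma chain_compA W X Y Z (h : chain_map Y Z) (g : chain_map X Y) (f : chain_map W X) :
  htpy (chain_comp h (chain_comp g f)) (chain_comp (chain_comp h g) f).
Proof. exact: htpy_ext. Qed.

Lemma qmap_uniq X Y (f : chain_map X Y) (g : chain_map (Q X) (Q Y)) :
  htpy (chain_comp g (jQ X)) (chain_comp (jQ Y) f) -> htpy g (qmap f).
Proof.
move=> h; apply: (kinj_inj (@Q_kinj Y) (@jQ_qi X)).
exact: htpy_trans h (htpy_sym (qmapP f)).
Qed.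

Lemma qmap_qi X Y (s : chain_map X Y) : quasi_iso s -> quasi_iso (qmap s).
Proof.
move=> sP; apply: (quasi_iso_cancel_r (@jQ_qi X)).
apply: (quasi_iso_htpy (htpy_sym (qmapP s))).
exact: (quasi_iso_comp (@jQ_qi Y) sP).
Qed.

Lemma kinj_qi_inv I B (s : chain_map I B) : kinj I -> quasi_iso s ->
  exists r : chain_map B I, htpy (chain_comp r s) (chain_id I).
Proof. by move=> kI sP; apply: (kinj_ext kI _ sP). Qed.

Lemma qinv_exists X Y (s : chain_map X Y) : quasi_iso s ->
  exists g : chain_map (Q Y) (Q X), htpy (chain_comp g (qmap s)) (chain_id (Q X)) /\
    htpy (chain_comp (qmap s) g) (chain_id (Q Y)).
Proof.
move=> /qmap_qi sP; have [g gP] := kinj_qi_inv (@Q_kinj X) sP.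
exists g; split=> //; apply: (kinj_inj (@Q_kinj Y) sP).
apply: htpy_trans (htpy_sym (chain_compA _ _ _)) _.
apply: htpy_trans (htpy_comp (htpy_refl _) gP) _; exact: htpy_ext.
Qed.
Definition qinv X Y (s : chain_map X Y) (sP : quasi_iso s) :=
  sval (cid (qinv_exists sP)).
Lemma qinvP X Y (s : chain_map X Y) (sP : quasi_iso s) :
  htpy (chain_comp (qinv sP) (qmap s)) (chain_id (Q X)) /\
    htpy (chain_comp (qmap s) (qinv sP)) (chain_id (Q Y)).
Proof. exact: svalP (cid (qinv_exists sP)). Qed.

(** A formal inverse can be interpreted because a quasi-isomorphism between K-injective complexes
    has an inverse up to homotopy. *)
Fixpoint act X Y (d : dhom X Y) : chain_map (Q X) (Q Y) :=
  match d with
  | dmap _ _ u => qmap u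
  | dinv _ _ _ sP => qinv sP
  | dcomp _ _ _ g h => chain_comp (act g) (act h)
  | dzero _ _ => chain_zero
  | dadd _ _ g h => chain_add (act g) (act h)
  | dopp _ _ g => chain_opp (act g)
  end.

Lemma qmap_id X : htpy (qmap (chain_id X)) (chain_id (Q X)).
Proof. by apply/htpy_sym/qmap_uniq/htpy_ext. Qed.

(** Soundness of the relations in the homotopy category. This is how facts about complexes are
    extracted from an equality of expressions. *)
Lemma act_deq X Y (d e : dhom X Y) : deq d e -> htpy (act d) (act e).
Proof.
elim=> {X Y d e} /=.
- by move=> *; apply: htpy_refl.
- by move=> *; apply: htpy_sym.
- by move=> X Y f g h _ h1 _ h2; apply: htpy_trans h1 h2.
- by move=> *; apply: htpy_comp.
- by move=> *; apply: htpy_add.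
- by move=> *; apply: htpy_opp.
- by move=> *; apply: htpy_ext.
- move=> X Y f; apply: htpy_trans (htpy_comp (@qmap_id _) (htpy_refl _)) _.
  exact: htpy_ext.
- move=> X Y f; apply: htpy_trans (htpy_comp (htpy_refl _) (@qmap_id _)) _.
  exact: htpy_ext.
- by move=> *; apply: htpy_ext => n G x; rewrite /= addrA.
- by move=> *; apply: htpy_ext => n G x; rewrite /= addrC.
- by move=> *; apply: htpy_ext => n G x; rewrite /= add0r.
- by move=> *; apply: htpy_ext => n G x; rewrite /= addNr.
- by move=> *; apply: htpy_ext.
- by move=> *; apply: htpy_ext => n G x; rewrite /= linearD.
- move=> X Y f g fg; apply: qmap_uniq; apply: htpy_trans (qmapP f) _.
  by apply: htpy_comp (htpy_refl _) _; apply: htpy_ext.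
- move=> X Y Z f g; apply/htpy_sym/qmap_uniq.
  apply: htpy_trans (htpy_sym (chain_compA _ _ _)) _.
  apply: htpy_trans (htpy_comp (htpy_refl _) (qmapP g)) _.
  apply: htpy_trans (chain_compA _ _ _) _.
  apply: htpy_trans (htpy_comp (qmapP f) (htpy_refl _)) _.
  exact: htpy_ext.
- move=> X Y f g; apply/htpy_sym/qmap_uniq.
  apply: htpy_trans (htpy_add (qmapP f) (qmapP g)) _.
  by apply: htpy_ext => n G x; apply/esym; exact: (linearD (jQ Y n G)).
- by move=> X Y s sP; apply: htpy_trans (proj1 (qinvP sP)) (htpy_sym (@qmap_id _)).
- by move=> X Y s sP; apply: htpy_trans (proj2 (qinvP sP)) (htpy_sym (@qmap_id _)).
Qed.

(** The interpretation loses nothing: [act d] is [d] itself, conjugated by the isomorphisms [jQ]. *)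
Lemma act_mor X Y (d : dhom X Y) : mm (act d) *d mm (jQ X) = mm (jQ Y) *d cl d.
Proof.
elim: d => {X Y}.
- by move=> X Y f; rewrite -!mmM; apply/htpy_mm/qmapP.
- move=> X Y s sP; apply: (mm_qi_injr sP).
  rewrite -[cl _]/(minv sP) -mcompA -mmM -(htpy_mm (qmapP s)) -mmM.
  rewrite (htpy_mm (chain_compA _ _ _)).
  rewrite (htpy_mm (htpy_comp (proj1 (qinvP sP)) (htpy_refl _))).
  by rewrite mmM mcomp1l -mcompA minv_mm mcomp1r.
- move=> X Y Z g ihg f ihf; rewrite [act _]/= mmM clM -mcompA ihf mcompA ihg.
  by rewrite mcompA.
- by move=> X Y; rewrite [act _]/= mm0 mcomp0l -[cl _]/(@m0 k U X Y) mcomp0r.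
- move=> X Y f ihf g ihg; rewrite [act _]/= mmD mcompDl ihf ihg.
  by rewrite clD mcompDr.
- by move=> X Y f ihf; rewrite [act _]/= mmN mcompNl ihf clN mcompNr.
Qed.

(** Any morphism into a K-injective [I] comes from a chain map, namely its action preceded by [jQ X]
    and followed by a retraction of [jQ I]. *)
Lemma hom_surj X I (d : mor X I) : kinj I -> exists g : chain_map X I, d = mm g.
Proof.
move=> kI; have [r rP] := kinj_qi_inv kI (@jQ_qi I).
exists (chain_comp r (chain_comp (act (mrep d)) (jQ X))).
rewrite !mmM act_mor mrepK mcompA -mmM (htpy_mm rP); exact/esym/mcomp1l.
Qed.

Lemma hom_inj X I (f g : chain_map X I) : kinj I -> mm f = mm g -> htpy f g.
Proof.
move=> kI /cl_eq/act_deq /= fg; have [r rP] := kinj_qi_inv kI (@jQ_qi I).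
have {}fg : htpy (chain_comp (jQ I) f) (chain_comp (jQ I) g).
  apply: htpy_trans (htpy_sym (qmapP f)) _.
  exact: htpy_trans (htpy_comp fg (htpy_refl _)) (qmapP g).
have h (u : chain_map X I) : htpy u (chain_comp r (chain_comp (jQ I) u)).
  apply: (htpy_trans _ (htpy_sym (chain_compA _ _ _))).
  by apply: (htpy_trans _ (htpy_comp (htpy_sym rP) (htpy_refl u))); apply: htpy_ext.
apply: (htpy_trans (h f)); apply: (htpy_trans _ (htpy_sym (h g))).
exact: htpy_comp (htpy_refl _) fg.
Qed.

Lemma acyclic_Q X : acyclic (Q X) -> acyclic X.
Proof.
move=> /acyclicP hQ; apply/acyclicP => G n x cx.
have [i _] := proj1 (quasi_isoP (jQ X)) (@jQ_qi X) G n.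
by apply: i => //; apply/hQ/cm_cyc.
Qed.

Lemma htpy_id0_acyclic X : htpy (chain_id X) chain_zero -> acyclic X.
Proof.
move=> [h hP]; apply/acyclicP => G; elim/int_pred_ind => n x cx.
rewrite (etrans (esym (subr0 x)) (hP n G x)) cx linear0 addr0; exact: Bd.
Qed.

(** Converse of [acyclic_m1]: the identity of [Q X] is null-homotopic, which contracts [Q X]. *)
Lemma m1_0_acyclic X : m1 X = m0 -> acyclic X.
Proof.
rewrite -mm0 => /cl_eq/act_deq /= h; apply/acyclic_Q/htpy_id0_acyclic.
apply: htpy_trans (htpy_sym (@qmap_id X)) _; apply: htpy_trans h _.
by apply/htpy_sym/qmap_uniq; apply: htpy_ext => n G x; apply/esym; exact: (linear0 (jQ X n G)).
Qed.

Section ConeDg.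
Variables (X Y : complex k U) (f : chain_map X Y).
Lemma cone_dg1 p q (e : p - 1 = q) G (w : cone f p G) (e' : p - 1 - 1 = q - 1) :
  (dg (cone f) e G w).1 = - dg X e' G w.1.
Proof. by subst q; rewrite (eq_irrelevance e' erefl). Qed.
Lemma cone_dg2 p q (e : p - 1 = q) G (w : cone f p G) :
  (dg (cone f) e G w).2 = f q G (ct X e G w.1) + dg Y e G w.2.
Proof. by subst q. Qed.
End ConeDg.

(** The first coordinate is a closed map into [I], up to sign, and has a null-homotopy [a].
    Subtracting the image of [a] under [f] makes the second coordinate closed, and K-injectivity of
    [J] finishes. *)
Lemma kinj_cone I J (f : chain_map I J) : kinj I -> kinj J -> kinj (cone f).
Proof.
move=> kI kJ A hA t te phi closed.
have te1 m : t m - 1 - 1 = t (m - 1) - 1 by rewrite te.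
pose p1 m : nat_trans (A m) (I (t m - 1)) := nt_comp (nt_fst _ _) (phi m).
pose p2 m : nat_trans (A m) (J (t m)) := nt_comp (nt_snd _ _) (phi m).
have c1 m G (x : A m G) : p1 (m - 1) G (diff A m G x) = - dg I (te1 m) G (p1 m G x).
  by rewrite /= -[LHS]/(phi _ _ _).1 closed (cone_dg1 _ _ (te1 m)).
have c2 m G (x : A m G) : p2 (m - 1) G (diff A m G x) =
    f _ G (ct I (te m) G (p1 m G x)) + dg J (te m) G (p2 m G x).
  by rewrite /= -[LHS]/(phi _ _ _).2 closed cone_dg2.
have [|h1 h1P] := @kI A hA (fun m => t m - 1) te1 (fun m => nt_scale ((-1) ^ m) (p1 m)).
  move=> m G x; rewrite -[LHS]/((-1) ^ (m - 1) *: p1 (m - 1) G (diff A m G x)) c1.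
  rewrite -[in RHS]/((-1) ^ m *: p1 m G x) linearZ_LR signz_pred.
  by rewrite /= scaleNr scalerN opprK.
pose a m := nt_scale ((-1) ^ m) (h1 m).
have aP m G (x : A (m - 1) G) : p1 (m - 1) G x =
    - dg I (te1 m) G (a m G x) + a (m - 1) G (diff A (m - 1) G x).
  have /(congr1 ( *:%R ((-1) ^ (m - 1)))) := h1P m G x.
  rewrite -[nt_scale _ _ _ _]/((-1) ^ (m - 1) *: p1 (m - 1) G x).
  rewrite scalerA signz_mul scale1r => ->.
  rewrite scalerDr; congr (_ + _).
  by rewrite -[in RHS]/((-1) ^ m *: h1 m G x) linearZ_LR signz_pred scaleNr.
pose fa m : nat_trans (A (m - 1)) (J (t (m - 1))) :=
  nt_comp (f (t (m - 1))) (nt_comp (ct I (te m)) (a m)).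
have [psi psiE] := @deg_reindex k U A (fun m => J (t m))
  (fun m => nt_add (p2 (m - 1)) (nt_opp (fa m))).
have psi_closed m G (x : A m G) :
    psi (m - 1) G (diff A m G x) = dg J (te m) G (psi m G x).
  elim/int_pred_ind: m => m in x *; rewrite !psiE.
  rewrite -[LHS]/(p2 (m - 1 - 1) G (diff A (m - 1) G x)
     - f _ G (ct I (te (m - 1)) G (a (m - 1) G (diff A (m - 1) G x)))).
  rewrite -[in RHS]/(p2 (m - 1) G x - f _ G (ct I (te m) G (a m G x))).
  rewrite c2 aP linearB -cm_dg.
  have e : t m - 1 - 1 = t (m - 1 - 1) by rewrite te1 te.
  rewrite (dg_ct _ _ e) !linearD !linearN (ct_dg _ _ e).
  set u := f _ _ (dg _ _ _ _); set v := f _ _ (ct _ _ _ _); set w := dg _ _ _ _.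
  by rewrite [LHS]addrAC addrK [LHS]addrC.
have [b bP] := @kJ A hA t te psi psi_closed.
exists (fun m => nt_pair (a m) (b m)) => m G x.
rewrite [LHS]surjective_pairing [RHS]surjective_pairing; congr pair.
  by rewrite -[LHS]/(p1 (m - 1) G x) aP /= (cone_dg1 _ _ (te1 m)).
have := bP m G x; rewrite psiE -[nt_add _ _ _ _]/(p2 (m - 1) G x - fa m G x).
move/eqP; rewrite subr_eq => /eqP; rewrite -[LHS]/(phi (m - 1) G x).2 => ->.
rewrite -[RHS]/((dg (cone f) (te m) G (a m G x, b m G x)).2
   + b (m - 1) G (diff A (m - 1) G x)) cone_dg2 /=.
by rewrite [LHS]addrC [LHS]addrA.
Qed.

End Hom.

(** * Long exact sequences *)

Section Exact.
Variables (k : fieldType) (U : group_family).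
Implicit Types (X Y Z W A B C I : complex k U) (G H : member U).

Section Rotation.
Variables (A B : complex k U) (f : chain_map A B).

(** Rotation of the triangle: [cone (cone_in f)] is quasi-isomorphic to [shift A]. *)
Definition rot1_nt n : nat_trans (cone (cone_in f) n) (shift A n) :=
  nt_comp (nt_fst (A (n - 1)) (B n)) (nt_snd (B (n - 1)) (cone f n)).
Definition rot1 : chain_map (cone (cone_in f)) (shift A).
Proof.
apply: (@ChainMap k U (cone (cone_in f)) (shift A) rot1_nt) => n G [b [a b']].
exact: add0r.
Defined.

Lemma rot1_qi : quasi_iso rot1.
Proof.
apply/quasi_isoP => G n; split.
  elim/int_pred_ind: n => n [b [a b']] /cone_cyc[/= cb [/= ca e]].
  move=> /bdP[z /= ez]; apply/cone_bd; exists (b' - f _ _ z), (z, 0); split => /=.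
    move/eqP: e; rewrite -ez linearN addr_eq0 => /eqP ->.
    by rewrite linearB -cm_d; congr (- _); exact: addrC.
  congr pair; first by rewrite /= add0r -ez.
  by rewrite /= linear0 addr0 subrK.
move=> a ca; exists (- f (n - 1) G a, (a, 0)).
  apply/cone_cyc; split=> /=.
    by rewrite /cyc linearN -cm_d; move/eqP: ca; rewrite /= oppr_eq0 => /eqP ->; rewrite linear0 oppr0.
  congr pair; rewrite /= ?add0r.
    by move: ca; rewrite /cyc /=.
  by rewrite linear0 addr0 addNr.
rewrite /= subrr; exact: bd0.
Qed.

(** Second rotation. The summand [f] makes the projection to [B] a chain map, and on the target of
    [cone_out f] it is [chain_shift f], without a sign. *)
Definition rot2_nt n : nat_trans (cone (cone_out f) n) (shift B n) :=
  nt_add (nt_comp (nt_snd (A (n - 1 - 1)) (B (n - 1))) (nt_fst (cone f (n - 1)) (A (n - 1))))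
         (nt_comp (f (n - 1)) (nt_snd (cone f (n - 1)) (A (n - 1)))).
Definition rot2 : chain_map (cone (cone_out f)) (shift B).
Proof.
apply: (@ChainMap k U (cone (cone_out f)) (shift B) rot2_nt) => n G [[a' b] a] /=.
rewrite linearB [in RHS]linearD -cm_d.
set u := f _ _ a'; set v := diff B _ _ b; set w := f _ _ (diff _ _ _ _).
by rewrite [- (u + v)]opprD addrACA addNr add0r opprD.
Defined.

Lemma rot2_in n G u : rot2 n G (cone_in (cone_out f) n G u) = chain_shift f n G u.
Proof. exact: add0r. Qed.

Lemma rot2_qi : quasi_iso rot2.
Proof.
apply/quasi_isoP => G n; split.
  elim/int_pred_ind: n => n [[a' b] a] /cone_cyc[/= cu e].
  have ea : a' = diff A (n - 1 - 1) G a.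
    by apply/eqP; rewrite -subr_eq0; apply/eqP.
  move=> /bdP[z /= ez]; apply/cone_bd; exists (a, z), 0; split => /=.
    congr pair; rewrite /= ?opprK //.
    by rewrite opprD ez; set t := f _ _ a; rewrite addrCA addNr addr0.
  by rewrite linear0 oppr0 addr0.
move=> b cb; exists ((0, b), 0).
  apply/cone_cyc; split=> /=; last by rewrite linear0 oppr0 addr0.
  apply/cone_cyc; split; rewrite /cyc /= !linear0 ?add0r //.
  by move/eqP: cb; rewrite /= oppr_eq0 => /eqP.
by rewrite /= linear0 addr0 subrr; exact: bd0.
Qed.

End Rotation.

Section Contravariant.
Hypothesis U_replete : replete U.
Local Notation Q := (Q U_replete).
Local Notation jQ := (jQ U_replete).

(** A null-homotopy of [h f], computed in the resolution of [Z], extends [h] over the cone. *)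
Lemma exact_con_B A B Z (f : chain_map A B) (h : mor B Z) : h *d mm f = m0 ->
  exists h' : mor (cone f) Z, h = h' *d mm (cone_in f).
Proof.
move=> hf; have [g gE] := hom_surj U_replete (mm (jQ Z) *d h) (@Q_kinj _ _ U_replete Z).
have : mm (chain_comp g f) = mm chain_zero.
  by rewrite mmM -gE -mcompA hf mcomp0r mm0.
move=> /(hom_inj U_replete (@Q_kinj _ _ U_replete Z))[l lP].
have [|F FP] := @cone_factor k U A B (Q Z) f g l.
  by move=> n G x; apply: etrans (esym (subr0 _)) (lP n G x).
exists (minv (jQ_qi U_replete Z) *d mm F).
apply: (mm_qi_injl (jQ_qi U_replete Z)); rewrite gE !mcompA mm_minv mcomp1l -mmM.
by apply: mm_ext => n G x; rewrite /= FP /= linear0 add0r.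
Qed.

Lemma exact_con_C A B Z (f : chain_map A B) (h : mor (cone f) Z) :
  h *d mm (cone_in f) = m0 -> exists h' : mor (shift A) Z, h = h' *d mm (cone_out f).
Proof.
move=> hf; have [g gE] := hom_surj U_replete (mm (jQ Z) *d h) (@Q_kinj _ _ U_replete Z).
have : mm (chain_comp g (cone_in f)) = mm chain_zero.
  by rewrite mmM -gE -mcompA hf mcomp0r mm0.
move=> /(hom_inj U_replete (@Q_kinj _ _ U_replete Z))[l lP].
have lE n G (y : B (n - 1) G) : g (n - 1) G (0, y)
    = diff (Q Z) n G (l n G y) + l (n - 1) G (diff B (n - 1) G y).
  exact: etrans (esym (subr0 _)) (lP n G y).
(* On the summand [A], the map [g] fails to be a chain map on [shift A] by the value [g (0, f x)].
   The null-homotopy [l] of [g] on [B] corrects this. *)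
pose a n : nat_trans (shift A n) (Q Z n) :=
  nt_add (nt_comp (g n) (nt_inl (A (n - 1)) (B n))) (nt_opp (nt_comp (l n) (f (n - 1)))).
have gD n G (x : A (n - 1) G) (y : B n G) : g n G (x, y) = g n G (x, 0) + g n G (0, y).
  rewrite -linearD; congr (g n G _).
  by congr pair; [exact: (esym (addr0 x))|exact: (esym (add0r y))].
have a_d n G (x : shift A n G) : a (n - 1) G (diff (shift A) n G x) = diff (Q Z) n G (a n G x).
  rewrite -[LHS]/(g (n - 1) G (- diff A (n - 1) G x, 0)
     - l (n - 1) G (f (n - 1 - 1) G (- diff A (n - 1) G x))).
  rewrite -[RHS]/(diff (Q Z) n G (g n G (x, 0) - l n G (f (n - 1) G x))).
  rewrite (linearB (diff (Q Z) n G)) -cm_d.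
  rewrite -[diff (cone f) n G (x, 0)]/(- diff A (n - 1) G x, f (n - 1) G x + diff B n G 0).
  rewrite linear0 addr0 (gD _ _ _ (f (n - 1) G x)) (lE _ _ (f _ _ _)) !linearN opprK.
  rewrite -(cm_d f); set w := l (n - 1) G _; set v := diff (Q Z) _ _ _.
  by rewrite -[RHS]addrA [v + w]addrC addrK.
exists (minv (jQ_qi U_replete Z) *d mm (ChainMap a_d)).
apply: (mm_qi_injl (jQ_qi U_replete Z)); rewrite gE !mcompA mm_minv mcomp1l -mmM.
apply: htpy_mm; exists (fun n => nt_comp (l n) (nt_snd (A (n - 1 - 1)) (B (n - 1)))) => n G [x y].
rewrite -[LHS]/(g (n - 1) G (x, y) - (g (n - 1) G (x, 0)
    - l (n - 1) G (f (n - 1 - 1) G x))).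
rewrite -[RHS]/(diff (Q Z) n G (l n G y)
  + l (n - 1) G (f (n - 1 - 1) G x + diff B (n - 1) G y)).
rewrite (gD _ _ _ y) (lE _ _ y) (linearD (l (n - 1) G)).
set u := g _ _ _; set v := diff _ _ _ _; set w := l _ _ (diff _ _ _ _); set t := l _ _ _.
by rewrite [- (u - t)]opprB [LHS]addrC -addrA addKr addrCA.
Qed.

(** Null-homotopies of maps into the cone are available once the cone is K-injective, so [f] is
    replaced by the map [u] of resolutions. The square between [f] and [u] commutes up to homotopy
    only. *)
Lemma exact_cov_B W A B (f : chain_map A B) (d : mor W B) :
  mm (cone_in f) *d d = m0 -> exists d' : mor W A, d = mm f *d d'.
Proof.
move=> hd; pose u := qmap U_replete f.
have [l lP] := htpy_sym (qmapP U_replete f).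
(* The comparison of the cones has the homotopy [l] of the square as its off-diagonal entry. *)
have [c cE] : exists c : chain_map (cone f) (cone u), forall n G y,
    c n G (cone_in f n G y) = cone_in u n G (jQ B n G y).
  pose c n : nat_trans (cone f n) (cone u n) :=
    nt_pair (nt_comp (jQ A (n - 1)) (nt_fst _ _))
      (nt_add (nt_comp (l n) (nt_fst _ _)) (nt_comp (jQ B n) (nt_snd _ _))).
  have c_d n G (w : cone f n G) : c (n - 1) G (diff (cone f) n G w)
      = diff (cone u) n G (c n G w).
    case: w => x y; congr pair.
      apply: etrans (linearN (jQ A (n - 1 - 1) G) _) _.
      by congr (- _); exact: (cm_d (jQ A)).
    rewrite -[LHS]/(l (n - 1) G (- diff A (n - 1) G x)
      + jQ B (n - 1) G (f (n - 1) G x + diff B n G y)).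
    rewrite -[RHS]/(u (n - 1) G (jQ A (n - 1) G x) + diff (Q B) n G (l n G x + jQ B n G y)).
    have := lP n G x.
    rewrite -[LHS]/(jQ B (n - 1) G (f (n - 1) G x) - u (n - 1) G (jQ A (n - 1) G x)).
    move/eqP; rewrite subr_eq => /eqP e.
    rewrite (linearN (l (n - 1) G)) (linearD (jQ B (n - 1) G)) e.
    rewrite (linearD (diff (Q B) n G)) (cm_d (jQ B)).
    set L := l (n - 1) G _; set M := diff _ _ _ (l n G x); set R := u _ _ _.
    set S := diff _ _ _ _.
    by rewrite [M + L]addrC -!addrA addKr addrCA.
  exists (ChainMap c_d) => n G y; congr pair; rewrite /= ?linear0 //.
  by rewrite add0r.
have [g gE] := hom_surj U_replete (mm (jQ B) *d d) (@Q_kinj _ _ U_replete B).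
have : mm (chain_comp (cone_in u) g) = mm chain_zero.
  rewrite mmM -gE mcompA -mmM -(mm_ext (f := chain_comp c (cone_in f)) (g := chain_comp (cone_in u) (jQ B)) cE).
  by rewrite mmM -mcompA hd mcomp0r mm0.
have kC := @kinj_cone _ _ _ _ u (@Q_kinj _ _ U_replete A) (@Q_kinj _ _ U_replete B).
move=> /(hom_inj U_replete kC)[h hP].
(* In the null-homotopy [h] the component in [Q A] is a chain map, the lift sought, and the
   component in [Q B] is the homotopy from [g] to its composite with [u]. *)
pose a m : nat_trans (W (m - 1)) (Q A (m - 1)) := nt_comp (nt_fst _ _) (h m).
pose b m : nat_trans (W (m - 1)) (Q B m) := nt_comp (nt_snd _ _) (h m).
have hE m G (x : W (m - 1) G) : (0, g (m - 1) G x) =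
   (- diff (Q A) (m - 1) G (a m G x) + a (m - 1) G (diff W (m - 1) G x),
    u (m - 1) G (a m G x) + diff (Q B) m G (b m G x) + b (m - 1) G (diff W (m - 1) G x)).
  exact: etrans (esym (subr0 _)) (hP m G x).
have [|a' a'E] := @deg_reindex_chain _ _ W (Q A) a.
  by move=> m G x; have [/esym/oppr_add_eq0] := hE m G x.
have e : mm g = mm u *d mm a'.
  rewrite -mmM; apply: htpy_mm; exists b => n G x.
  rewrite -[LHS]/(g (n - 1) G x - u (n - 1) G (a' (n - 1) G x)) a'E.
  have e : g (n - 1) G x = u (n - 1) G (a n G x) + diff (Q B) n G (b n G x)
     + b (n - 1) G (diff W (n - 1) G x) := congr1 snd (hE n G x).
  rewrite e; move: (u _ _ _) (diff (Q B) _ _ _) (b (n - 1) _ _) => p q r.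
  by rewrite -[p + q + r]addrA [p + _]addrC addrK.
exists (minv (jQ_qi U_replete A) *d mm a'); apply: (mm_qi_injl (jQ_qi U_replete B)).
have sq : mm (jQ B) *d mm f = mm u *d mm (jQ A).
  by rewrite -!mmM; apply/esym/htpy_mm/qmapP.
by rewrite gE e !mcompA sq -[mm u *d _ *d _]mcompA mm_minv mcomp1r.
Qed.

Lemma exact_cov_C W A B (f : chain_map A B) (d : mor W (cone f)) :
  mm (cone_out f) *d d = m0 -> exists d' : mor W B, d = mm (cone_in f) *d d'.
Proof.
move=> hd; apply: exact_cov_B; apply: (mm_qi_injl (rot1_qi f)).
by rewrite mcompA -mmM (mm_ext (g := cone_out f)) // mcomp0r.
Qed.

Lemma exact_cov_S W A B (f : chain_map A B) (d : mor W (shift A)) :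
  mm (chain_shift f) *d d = m0 -> exists d' : mor W (cone f), d = mm (cone_out f) *d d'.
Proof.
move=> hd; apply: exact_cov_B; apply: (mm_qi_injl (rot2_qi f)).
rewrite mcompA -mmM (mm_ext (g := chain_shift f)) ?mcomp0r // => n G x.
exact: rot2_in.
Qed.

End Contravariant.
End Exact.

(** * Compact objects *)

Section Equivalence.
Variables (k : fieldType) (U : group_family).
Implicit Types (X Y Z W A B C I : complex k U) (G H : member U).

Lemma mor_ind (P : forall X Y, mor X Y -> Prop) :
  (forall X Y (f : chain_map X Y), P _ _ (mm f)) ->
  (forall X Y (s : chain_map X Y) (sP : quasi_iso s), P _ _ (minv sP)) ->
  (forall X Y Z (g : mor Y Z) (f : mor X Y), P _ _ g -> P _ _ f -> P _ _ (g *d f)) ->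
  (forall X Y, P X Y m0) ->
  (forall X Y (f g : mor X Y), P _ _ f -> P _ _ g -> P _ _ (f +d g)) ->
  (forall X Y (f : mor X Y), P _ _ f -> P _ _ (-d f)) ->
  forall X Y (m : mor X Y), P _ _ m.
Proof.
move=> h1 h2 h3 h4 h5 h6 X Y m; rewrite -[m]mrepK.
elim: (mrep m) => {X Y m} //.
- by move=> X Y Z g hg f hf; rewrite clM; apply: h3.
- by move=> X Y f hf g hg; rewrite clD; apply: h5.
- by move=> X Y f hf; rewrite clN; apply: h6.
Qed.

Definition shiftF : cfun k U U.
Proof.
exists (@shift k U) (@chain_shift k U).
- by move=> X Y f g fg n G x; apply: fg.
- by [].
- by [].
- by [].
- exact: quasi_iso_shift.
Defined.

Lemma unshift_deg (n : int) : n + 1 - 1 = n - 1 + 1.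
Proof. by rewrite addrAC. Qed.

Lemma unshift_dd X n G (x : X (n + 1) G) :
  nt_opp (dg X (unshift_deg (n - 1))) G (nt_opp (dg X (unshift_deg n)) G x) = 0.
Proof. by rewrite /= linearN dg_dg !oppr0. Qed.

(** A quasi-inverse of [shift]. The composites have [X (n - 1 + 1)] and [X (n + 1 - 1)] in degree
    [n], which are isomorphic to [X n] but not convertible to it. *)
Definition unshift X : complex k U :=
  @Complex k U (fun n => X (n + 1)) (fun n => nt_opp (dg X (unshift_deg n))) (@unshift_dd X).

Lemma unshift_diff X n G (x : unshift X n G) (e : n + 1 - 1 = n - 1 + 1) :
  diff (unshift X) n G x = - dg X e G x.
Proof. by rewrite /= (eq_irrelevance e (unshift_deg n)). Qed.

Definition unshift_map X Y (f : chain_map X Y) : chain_map (unshift X) (unshift Y).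
Proof.
apply: (@ChainMap k U (unshift X) (unshift Y) (fun n => f (n + 1))) => n G x.
apply: etrans (linearN (f _ G) _) _; congr (- _); exact: cm_dg.
Defined.

Lemma unshift_cyc X n G (x : unshift X n G) : cyc x <-> @cyc k U X G (n + 1) x.
Proof.
rewrite (@cyc_dg k U X _ _ (unshift_deg n)) /cyc (unshift_diff _ (unshift_deg n)).
by split=> [/eqP|->]; rewrite ?oppr0 // oppr_eq0 => /eqP.
Qed.

Lemma unshift_bd X n G (x : unshift X n G) : bd x <-> @bd k U X G (n + 1) x.
Proof.
elim/int_pred_ind: n => n in x *.
rewrite (bd_dgP (unshift_deg n)); split=> [/bdP[z <-]|[z <-]].
  by exists (- z); rewrite (unshift_diff _ (unshift_deg n)) linearN.
by apply/bdP; exists (- z); rewrite (unshift_diff _ (unshift_deg n)) linearN opprK.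
Qed.

Lemma unshift_qi X Y (f : chain_map X Y) : quasi_iso f -> quasi_iso (unshift_map f).
Proof.
move=> /quasi_isoP fP; apply/quasi_isoP => G n; have [i s] := fP G (n + 1); split.
  by move=> x /unshift_cyc cx /unshift_bd bx; apply/unshift_bd/i.
move=> y /unshift_cyc/s[x cx bx]; exists x; first exact/unshift_cyc.
exact/unshift_bd.
Qed.

Definition unshiftF : cfun k U U.
Proof.
exists unshift unshift_map.
- by move=> X Y f g fg n G x; apply: fg.
- by [].
- by [].
- by [].
- exact: unshift_qi.
Defined.

Lemma deg_su (n : int) : n - 1 + 1 = n. Proof. by rewrite subrK. Qed.
Lemma deg_us (n : int) : n + 1 - 1 = n. Proof. by rewrite addrK. Qed.

Lemma su_iso_d X n G (x : shift (unshift X) n G) :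
  ct X (deg_su (n - 1)) G (diff (shift (unshift X)) n G x) = diff X n G (ct X (deg_su n) G x).
Proof.
rewrite /= opprK (ct_dg _ _ (etrans (congr1 (fun i => i - 1) (deg_su n)) erefl)).
by rewrite -(dgE erefl) (dg_ct _ _ (etrans (congr1 (fun i => i - 1) (deg_su n)) erefl)).
Qed.
Definition su_iso X : chain_map (shift (unshift X)) X :=
  @ChainMap k U (shift (unshift X)) X (fun n => ct X (deg_su n)) (@su_iso_d X).

Lemma dg_shift X p q (e : p - 1 = q) (e' : p - 1 - 1 = q - 1) G (x : shift X p G) :
  dg (shift X) e G x = - dg X e' G x.
Proof. by subst q; rewrite (eq_irrelevance e' erefl). Qed.

Lemma us_iso_d X n G (x : unshift (shift X) n G) :
  ct X (deg_us (n - 1)) G (diff (unshift (shift X)) n G x) = diff X n G (ct X (deg_us n) G x).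
Proof.
rewrite (unshift_diff _ (unshift_deg n)).
have e : n + 1 - 1 - 1 = n - 1 + 1 - 1 by rewrite deg_us deg_us.
rewrite (dg_shift _ e) opprK.
have e2 : n + 1 - 1 - 1 = n - 1 by rewrite deg_us.
by rewrite (ct_dg _ _ e2) -(dgE erefl) (dg_ct _ _ e2).
Qed.
Definition us_iso X : chain_map (unshift (shift X)) X :=
  @ChainMap k U (unshift (shift X)) X (fun n => ct X (deg_us n)) (@us_iso_d X).

Lemma bij_qi X Y (f : chain_map X Y) (g : forall n G, Y n G -> X n G) :
  (forall n G x, g n G (f n G x) = x) -> (forall n G y, f n G (g n G y) = y) ->
  quasi_iso f.
Proof.
move=> fK gK; have gd n G (y : Y n G) : g (n - 1) G (diff Y n G y) = diff X n G (g n G y).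
  by rewrite -[in LHS](gK n G y) -cm_d fK.
have g0 n G : g n G 0 = 0 by rewrite -[0 in LHS](linear0 (f n G)) fK.
apply/quasi_isoP => G n; split.
  elim/int_pred_ind: n => n x _ /bdP[z e]; apply/bdP; exists (g n G z).
  by rewrite -gd e fK.
move=> y cy; exists (g n G y); first by rewrite /cyc -gd cy g0.
by rewrite gK subrr; apply: bd0.
Qed.

Lemma su_qi X : quasi_iso (su_iso X).
Proof.
apply: (@bij_qi (shift (unshift X)) X (su_iso X)
  (fun n G (y : X n G) => ct X (esym (deg_su n)) G y)) => n G x.
  exact: (ctK (deg_su n)).
exact: (ctK (esym (deg_su n))).
Qed.
Lemma us_qi X : quasi_iso (us_iso X).
Proof.
apply: (@bij_qi (unshift (shift X)) X (us_iso X)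
  (fun n G (y : X n G) => ct X (esym (deg_us n)) G y)) => n G x.
  exact: (ctK (deg_us n)).
exact: (ctK (esym (deg_us n))).
Qed.

(** Naturality extends from chain maps to all morphisms by induction on expressions; for a formal
    inverse one cancels the quasi-isomorphism. [FF] is any functorial operation, so that composites
    of two functors are covered. *)
Lemma nat_mor (F0 : complex k U -> complex k U)
    (FF : forall X Y, mor X Y -> mor (F0 X) (F0 Y))
    (theta : forall X, chain_map (F0 X) X) :
  (forall X, FF X X (m1 X) = m1 (F0 X)) ->
  (forall X Y Z (g : mor Y Z) (f : mor X Y), FF _ _ (g *d f) = FF _ _ g *d FF _ _ f) ->
  (forall X Y, FF X Y m0 = m0) ->
  (forall X Y (f g : mor X Y), FF _ _ (f +d g) = FF _ _ f +d FF _ _ g) ->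
  (forall X Y (f : mor X Y), FF _ _ (-d f) = -d FF _ _ f) ->
  (forall X Y (f : chain_map X Y), mm (theta Y) *d FF _ _ (mm f) = mm f *d mm (theta X)) ->
  forall X Y (m : mor X Y), mm (theta Y) *d FF _ _ m = m *d mm (theta X).
Proof.
move=> h1 hM h0 hD hN hm.
apply: (@mor_ind (fun X Y m => mm (theta Y) *d FF _ _ m = m *d mm (theta X))) => //.
- move=> X Y s sP; apply: (mm_qi_injl sP); rewrite !mcompA mm_minv mcomp1l.
  by rewrite -hm -mcompA -hM mm_minv h1 mcomp1r.
- by move=> X Y Z g f hg hf; rewrite hM mcompA hg -mcompA hf mcompA.
- by move=> X Y; rewrite h0 mcomp0l mcomp0r.
- by move=> X Y f g hf hg; rewrite hD mcompDr hf hg mcompDl.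
- by move=> X Y f hf; rewrite hN mcompNr hf mcompNl.
Qed.

Lemma su_nat X Y (m : mor X Y) :
  mm (su_iso Y) *d fd shiftF (fd unshiftF m) = m *d mm (su_iso X).
Proof.
apply: (@nat_mor _ (fun X Y m => fd shiftF (fd unshiftF m))) => {X Y m}.
- by move=> X; rewrite !fd1.
- by move=> X Y Z g f; rewrite !fdM.
- by move=> X Y; rewrite !fd0.
- by move=> X Y f g; rewrite !fdD.
- by move=> X Y f; rewrite !fdN.
- move=> X Y f; rewrite !fd_mm -!mmM; apply: mm_ext => n G x; exact/esym/cm_ct.
Qed.

Lemma us_nat X Y (m : mor X Y) :
  mm (us_iso Y) *d fd unshiftF (fd shiftF m) = m *d mm (us_iso X).
Proof.
apply: (@nat_mor _ (fun X Y m => fd unshiftF (fd shiftF m))) => {X Y m}.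
- by move=> X; rewrite !fd1.
- by move=> X Y Z g f; rewrite !fdM.
- by move=> X Y; rewrite !fd0.
- by move=> X Y f g; rewrite !fdD.
- by move=> X Y f; rewrite !fdN.
- move=> X Y f; rewrite !fd_mm -!mmM; apply: mm_ext => n G x; exact/esym/cm_ct.
Qed.

Definition coproduct (I : Type) (Y : I -> complex k U) S (inj : forall i, mor (Y i) S) :=
  forall Z (g : forall i, mor (Y i) Z),
    (exists h : mor S Z, forall i, h *d inj i = g i) /\
    (forall h h' : mor S Z, (forall i, h *d inj i = h' *d inj i) -> h = h').

Definition fin_sum (I : Type) (Y : I -> complex k U) S (inj : forall i, mor (Y i) S) X
    (h : mor X S) := exists l : seq {i : I & mor X (Y i)},
  h = \big[@madd k U X S/m0]_(p <- l) (inj (tag p) *d tagged p).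

(** Only the surjective half of compactness. The injective half holds for every object, by
    projecting the coproduct to its summands. *)
Definition cpt X := forall (I : choiceType) (Y : I -> complex k U) S
  (inj : forall i, mor (Y i) S), coproduct inj -> forall h : mor X S, fin_sum inj h.

Lemma fd_sum (U' : group_family) (G : cfun k U U') X Y J (s : seq J) (f : J -> mor X Y) :
  fd G (\big[@madd k U X Y/m0]_(i <- s) f i) = \big[@madd k U' _ _/m0]_(i <- s) fd G (f i).
Proof. exact: (big_morph (@fd _ _ _ G X Y) (@fdD _ _ _ G X Y) (@fd0 _ _ _ G X Y)). Qed.

Section AbstractEquivalence.
Variables (F T : cfun k U U).
Variables (alpha : forall X, chain_map (F (T X)) X) (beta : forall X, chain_map (T (F X)) X).
Hypothesis alpha_qi : forall X, quasi_iso (alpha X).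
Hypothesis beta_qi : forall X, quasi_iso (beta X).
Hypothesis alpha_nat : forall X Y (m : mor X Y),
  mm (alpha Y) *d fd F (fd T m) = m *d mm (alpha X).
Hypothesis beta_nat : forall X Y (m : mor X Y),
  mm (beta Y) *d fd T (fd F m) = m *d mm (beta X).

Lemma equiv_faithfulT X Y (m m' : mor X Y) : fd T m = fd T m' -> m = m'.
Proof. by move=> e; apply: (mm_qi_injr (alpha_qi X)); rewrite -!alpha_nat e. Qed.

Lemma equiv_faithfulF X Y (m m' : mor X Y) : fd F m = fd F m' -> m = m'.
Proof. by move=> e; apply: (mm_qi_injr (beta_qi X)); rewrite -!beta_nat e. Qed.

Lemma equiv_fullT X Y (m : mor (T X) (T Y)) : exists u : mor X Y, fd T u = m.
Proof.
exists (mm (alpha Y) *d fd F m *d minv (alpha_qi X)).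
apply: equiv_faithfulF; apply: (mm_qi_injl (alpha_qi Y)); rewrite alpha_nat.
by rewrite -!mcompA minv_mm mcomp1r.
Qed.

Lemma equiv_coproduct (I : Type) (Y : I -> complex k U) S (inj : forall i, mor (Y i) S) :
  coproduct inj -> coproduct (fun i => fd F (inj i)).
Proof.
move=> co Z g; split.
  have [[h hP] _] := co (T Z) (fun i => fd T (g i) *d minv (beta_qi (Y i))).
  have [u uP] := equiv_fullT (h *d mm (beta S)); exists u => i.
  apply: equiv_faithfulT; rewrite fdM uP -mcompA beta_nat mcompA hP.
  by rewrite -mcompA minv_mm mcomp1r.
move=> h h' hh; apply: equiv_faithfulT.
have [_ co2] := co (T Z) (fun i => fd T (h *d fd F (inj i)) *d minv (beta_qi (Y i))).
have e : fd T h *d minv (beta_qi S) = fd T h' *d minv (beta_qi S).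
  apply: co2 => i; apply: (mm_qi_injr (beta_qi (Y i))).
  rewrite -!mcompA -!beta_nat ![minv _ *d _]mcompA !minv_mm !mcomp1l.
  by rewrite -!fdM hh.
by move/(congr1 (fun x => x *d mm (beta S))): e; rewrite -!mcompA minv_mm !mcomp1r.
Qed.

Lemma sum_compl X Y Z J (s : seq J) (f : J -> mor X Y) (g : mor Y Z) :
  g *d (\big[@madd k U X Y/m0]_(i <- s) f i) = \big[@madd k U _ _/m0]_(i <- s) (g *d f i).
Proof. by apply: (big_morph (mcomp g)); [apply: mcompDr|apply: mcomp0r]. Qed.

Lemma sum_compr X Y Z J (s : seq J) (f : J -> mor Y Z) (g : mor X Y) :
  (\big[@madd k U Y Z/m0]_(i <- s) f i) *d g = \big[@madd k U _ _/m0]_(i <- s) (f i *d g).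
Proof.
by apply: (big_morph (fun h => mcomp h g)); [move=> ? ?; apply: mcompDl|apply: mcomp0l].
Qed.

End AbstractEquivalence.

Section AbstractCompact.
Variables (F T : cfun k U U).
Variables (alpha : forall X, chain_map (F (T X)) X) (beta : forall X, chain_map (T (F X)) X).
Hypothesis alpha_qi : forall X, quasi_iso (alpha X).
Hypothesis beta_qi : forall X, quasi_iso (beta X).
Hypothesis alpha_nat : forall X Y (m : mor X Y),
  mm (alpha Y) *d fd F (fd T m) = m *d mm (alpha X).
Hypothesis beta_nat : forall X Y (m : mor X Y),
  mm (beta Y) *d fd T (fd F m) = m *d mm (beta X).

(** A map from [F X] to a coproduct is transposed along [beta] to a map from [X]; [T] preserves the
    coproduct, and fullness of [T] carries the finite sum back. *)
Lemma equiv_compact X : cpt X -> cpt (F X).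
Proof.
move=> cX I Y S inj co h.
have co' := equiv_coproduct beta_qi alpha_qi beta_nat alpha_nat co.
have [l e] := cX I _ _ _ co' (fd T h *d minv (beta_qi X)).
have ex (p : {i : I & mor X (T (Y i))}) :
    exists u : mor (F X) (Y (tag p)), fd T u = tagged p *d mm (beta X).
  exact: (equiv_fullT alpha_qi beta_qi alpha_nat beta_nat).
pose u p := sval (cid (ex p)).
exists [seq Tagged (fun i => mor (F X) (Y i)) (u p) | p <- l].
apply: (equiv_faithfulT alpha_qi alpha_nat); rewrite fd_sum big_map.
transitivity (fd T h *d minv (beta_qi X) *d mm (beta X)).
  by rewrite -mcompA minv_mm mcomp1r.
rewrite e sum_compr; apply: eq_bigr => p _.
by rewrite fdM /u; case: cid => v /= ->; rewrite mcompA.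
Qed.

End AbstractCompact.

Lemma cpt_shift X : cpt X -> cpt (shift X).
Proof. exact: (@equiv_compact shiftF unshiftF su_iso us_iso su_qi us_qi su_nat us_nat X). Qed.
Lemma cpt_unshift X : cpt X -> cpt (unshift X).
Proof. exact: (@equiv_compact unshiftF shiftF us_iso su_iso us_qi su_qi us_nat su_nat X). Qed.

Lemma shift_coproduct (I : Type) (Y : I -> complex k U) S (inj : forall i, mor (Y i) S) :
  coproduct inj -> coproduct (fun i => fd shiftF (inj i)).
Proof. exact: (@equiv_coproduct shiftF unshiftF su_iso us_iso su_qi us_qi su_nat us_nat I Y S inj). Qed.
Section FinSum.
Variables (I : Type) (Y : I -> complex k U) (S : complex k U).
Variable inj : forall i, mor (Y i) S.

Lemma fin_sum0 X : fin_sum inj (@m0 k U X S).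
Proof. by exists [::]; rewrite big_nil. Qed.

Lemma fin_sum1 X i (f : mor X (Y i)) : fin_sum inj (inj i *d f).
Proof. by exists [:: Tagged (fun i => mor X (Y i)) f]; rewrite big_seq1. Qed.

Lemma fin_sumD X (g h : mor X S) : fin_sum inj g -> fin_sum inj h -> fin_sum inj (g +d h).
Proof. by move=> [l ->] [m ->]; exists (l ++ m); rewrite big_cat. Qed.

Lemma fin_sum_comp W X (h : mor X S) (g : mor W X) : fin_sum inj h -> fin_sum inj (h *d g).
Proof.
move=> [l ->]; exists (map (fun p : {i : I & mor X (Y i)} =>
  existT (fun i => mor W (Y i)) (tag p) (tagged p *d g)) l).
by rewrite sum_compr big_map; apply: eq_bigr => p _; rewrite mcompA.
Qed.

Hypothesis co : coproduct inj.

Lemma coproduct_proj i : exists p : mor S (Y i), p *d inj i = m1 (Y i) /\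
  forall j, j <> i -> p *d inj j = m0.
Proof.
pose g j : mor (Y j) (Y i) :=
  match pselect (j = i) with left e => ecast x (mor (Y j) (Y x)) e (m1 (Y j))
  | right _ => m0 end.
have [[p pP] _] := co g; exists p; split=> [|j ji]; rewrite pP /g.
  by case: pselect => // e; rewrite (Prop_irrelevance e erefl).
by case: pselect.
Qed.

End FinSum.

Lemma coproduct_fin_sum_inj (I : choiceType) (Y : I -> complex k U) S
   (inj : forall i, mor (Y i) S) X (s : seq I) (f : forall i, mor X (Y i)) :
  coproduct inj -> uniq s -> \big[@madd k U X S/m0]_(i <- s) (inj i *d f i) = m0 ->
  forall i, i \in s -> f i = m0.
Proof.
move=> co us e i si; have [p [p1 p0]] := coproduct_proj co i.
have /(congr1 (mcomp p)) := e; rewrite sum_compl mcomp0r (bigD1_seq i) //=.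
rewrite mcompA p1 mcomp1l big1 ?Monoid.mulm1 // => j /eqP ji.
by rewrite mcompA p0 // mcomp0l.
Qed.

(** Repeated indices are merged by adding their coefficients, the form that compactness in terms of
    [dhom] requires. *)
Lemma fin_sum_uniq (I : choiceType) (Y : I -> complex k U) S
   (inj : forall i, mor (Y i) S) X (h : mor X S) : fin_sum inj h ->
  exists (s : seq I) (f : forall i, mor X (Y i)), [/\ uniq s,
    forall i, i \notin s -> f i = m0 & h = \big[@madd k U X S/m0]_(i <- s) (inj i *d f i)].
Proof.
move=> [l ->] {h}; elim: l => [|[i g] l [s [f [us f0 e]]]].
  by exists [::], (fun=> m0); rewrite !big_nil.
pose d j : mor X (Y j) :=
  match pselect (i = j) with left e => ecast x (mor X (Y x)) e g | right _ => m0 end.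
have dE : d i = g by rewrite /d; case: pselect => // a; rewrite (Prop_irrelevance a erefl).
have d0 j : i <> j -> d j = m0 by rewrite /d; case: pselect.
exists (undup (i :: s)), (fun j => d j +d f j); rewrite big_cons e.
split; first exact: undup_uniq.
  move=> j; rewrite mem_undup inE negb_or => /andP[/eqP ji js].
  by rewrite f0 // d0 ?madd0l // => /esym.
have -> : \big[@madd k U X S/m0]_(j <- undup (i :: s)) (inj j *d (d j +d f j))
  = \big[@madd k U X S/m0]_(j <- undup (i :: s)) (inj j *d d j) +d
    \big[@madd k U X S/m0]_(j <- undup (i :: s)) (inj j *d f j).
  by rewrite -big_split; apply: eq_bigr => j _; rewrite mcompDr.
apply: esym; congr (madd _ _).
  rewrite (bigD1_seq i) ?mem_undup ?mem_head ?undup_uniq // dE big1 ?Monoid.mulm1 //.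
  by move=> j /eqP ji; rewrite d0 ?mcomp0r // => /esym.
rewrite /= (undup_id us); case: ifPn => // si.
by rewrite big_cons f0 // mcomp0r madd0l.
Qed.

Lemma cl_dsum X Y (s : seq (dhom X Y)) :
  cl (dsum s) = \big[@madd k U X Y/m0]_(d <- s) cl d.
Proof. by elim: s => [|d s IH]; rewrite ?big_nil // big_cons -IH -clD. Qed.

Lemma coproductP (I : Type) (Y : I -> complex k U) S (inj : forall i, dhom (Y i) S) :
  is_coproduct inj <-> coproduct (fun i => cl (inj i)).
Proof.
split=> h Z g.
  have [[u uP] uU] := h Z (fun i => mrep (g i)); split.
    by exists (cl u) => i; rewrite -[RHS]mrepK -clM; apply/cl_eq.
  move=> a b ab; rewrite -[a]mrepK -[b]mrepK; apply/cl_eq/uU => i.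
  by apply/cl_eq; rewrite !clM !mrepK.
have [[u uP] uU] := h Z (fun i => cl (g i)); split.
  exists (mrep u) => i; apply/cl_eq; rewrite clM mrepK; exact: uP.
move=> a b ab; apply/cl_eq/uU => i; rewrite -!clM; exact/cl_eq.
Qed.

Lemma compactP X : compact X <-> cpt X.
Proof.
split=> [cX I Y S inj co h|cX I Y S inj /coproductP co fin can].
  have co' : is_coproduct (fun i => mrep (inj i)).
    apply/coproductP; move: co; congr (coproduct _).
    by apply: functional_extensionality_dep => i; rewrite mrepK.
  have [_ /(_ (mrep h))[s [f _ /cl_eq e]]] := cX I Y S _ co'.
  rewrite -[h]mrepK -e cl_dsum big_map.
  exists [seq Tagged (fun i => mor X (Y i)) (cl (f i)) | i <- s].
  by rewrite big_map; apply: eq_bigr => i _; rewrite clM mrepK.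
split.
  move=> s f [us f0] /cl_eq; rewrite cl_dsum big_map => e i.
  have [si|si] := boolP (i \in s); last exact: f0.
  apply/cl_eq; apply: (coproduct_fin_sum_inj (f := fun i => cl (f i)) co us) => //.
  by rewrite -[RHS]e; apply: eq_bigr => j _; rewrite clM.
move=> h; have [s [f [us f0 e]]] := fin_sum_uniq (cX I Y S _ co (cl h)).
exists s, (fun i => mrep (f i)).
  by split=> // i /f0 fi; apply/cl_eq; rewrite mrepK fi.
apply/cl_eq; rewrite e cl_dsum big_map; apply: eq_bigr => i _.
by rewrite clM mrepK.
Qed.

(* The hypothesis says that [X] is a retract of [E1 + E2] in D(U). *)
Lemma cpt_sumretract X E1 E2 (i1 : mor X E1) (r1 : mor E1 X) (i2 : mor X E2)
    (r2 : mor E2 X) : r1 *d i1 +d r2 *d i2 = m1 X -> cpt E1 -> cpt E2 -> cpt X.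
Proof.
move=> e c1 c2 I Y S inj co h.
rewrite -[h]mcomp1r -e mcompDr !mcompA; apply: fin_sumD; apply: fin_sum_comp.
  exact: c1.
exact: c2.
Qed.

Lemma cpt_retract X E (i : mor X E) (r : mor E X) : r *d i = m1 X -> cpt E -> cpt X.
Proof.
move=> e cE; have e' : r *d i +d @m0 k U E X *d @m0 k U X E = m1 X by rewrite mcomp0l madd0r.
exact: (cpt_sumretract e' cE cE).
Qed.

Lemma cpt_qi X Y (s : chain_map X Y) : quasi_iso s -> cpt X <-> cpt Y.
Proof.
move=> sP; split; first exact: (cpt_retract (mm_minv sP)).
exact: (cpt_retract (minv_mm sP)).
Qed.

Lemma cpt_shiftE X : cpt (shift X) <-> cpt X.
Proof.
split=> [/cpt_unshift|]; last exact: cpt_shift.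
exact: (proj1 (cpt_qi (us_qi X))).
Qed.

Hypothesis U_replete : replete U.

(** A diagram chase. The restriction of [h] to [B] is a finite sum, whose components kill [f] by
    injectivity and so extend to the cone. Subtracting the extension leaves a map that factors
    through the compact object [shift A]. *)
Lemma cpt_cone A B (f : chain_map A B) : cpt A -> cpt B -> cpt (cone f).
Proof.
move=> /cpt_shift cA cB I Y S inj co h.
have [s [b [us b0 e]]] := fin_sum_uniq (cB I Y S inj co (h *d mm (cone_in f))).
have bf i : b i *d mm f = m0.
  have [si|/b0 ->] := boolP (i \in s); last by rewrite mcomp0l.
  apply: (coproduct_fin_sum_inj (f := fun i => b i *d mm f) co us) => //.
  transitivity (h *d mm (cone_in f) *d mm f); last first.
    by rewrite -mcompA cone_in_comp mcomp0r.
  by rewrite e sum_compr; apply: eq_bigr => j _; rewrite mcompA.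
have [c cP] : exists c : forall i, mor (cone f) (Y i), forall i, b i = c i *d mm (cone_in f).
  exists (fun i => sval (cid (exact_con_B U_replete (bf i)))) => i.
  by case: cid.
pose h0 : mor (cone f) S := \big[@madd k U _ S/m0]_(i <- s) (inj i *d c i).
have h0P : fin_sum inj h0.
  exists [seq Tagged (fun i => mor (cone f) (Y i)) (c i) | i <- s].
  by rewrite big_map.
have [|h' h'E] := @exact_con_C _ _ U_replete _ _ S f (h -d h0).
  rewrite mcompDl mcompNl e /h0 sum_compr.
  rewrite (eq_bigr (fun i => inj i *d c i *d mm (cone_in f))) ?maddNr // => i _.
  by rewrite cP mcompA.
rewrite -(msubK h h0) h'E; apply: fin_sumD => //; apply: fin_sum_comp; exact: cA.
Qed.

Lemma cpt_cone_source A B (f : chain_map A B) : cpt B -> cpt (cone f) -> cpt A.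
Proof.
move=> cB cC; apply/cpt_shiftE/(cpt_qi (rot1_qi f)).
exact: cpt_cone.
Qed.

End Equivalence.

(** * Direct sums of complexes *)

Section PresInd.
Variables (k : fieldType) (S : Type) (R : term k S -> term k S -> Prop).
Lemma pres_ind (P : pres R -> Prop) : (forall x, P (pres_gen R x)) -> P 0 ->
  (forall x y, P x -> P y -> P (x + y)) -> (forall a x, P x -> P (a *: x)) ->
  forall x, P x.
Proof.
move=> h1 h0 hD hZ x; have [c0 cD cN cZ] := clsE R; rewrite -[x]repK.
elim: (rep x) => [y||t ft u fu|t ft|a t ft].
- exact: h1.
- by rewrite c0.
- by rewrite cD; apply: hD.
- by rewrite cN -scaleN1r; apply: hZ.
- by rewrite cZ; apply: hZ.
Qed.
End PresInd.

Section DirectSum.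
Variables (k : fieldType) (U : group_family) (I : Type) (V : I -> gfunctor k U).

Section At.
Variable G : member U.

Inductive ds_rel : term k {i : I & V i G} -> term k {i : I & V i G} -> Prop :=
| DsRel i a (x y : V i G) : ds_rel
    (Gen k (existT (fun i => V i G : Type) i (a *: x + y)))
    (Add (Scale a (Gen k (existT (fun i => V i G : Type) i x)))
         (Gen k (existT (fun i => V i G : Type) i y))).

Definition ds_ob : lmodType k := pres ds_rel.

Definition ds_gen i (x : V i G) : ds_ob :=
  pres_gen ds_rel (existT (fun i => V i G : Type) i x).

Lemma ds_gen_linear i : linear (@ds_gen i).
Proof.
move=> a x y; have [_ cD _ cZ] := clsE ds_rel.
by rewrite /ds_gen /pres_gen -cZ -cD; apply/cls_eqP/teq_rel/DsRel.
Qed.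

Section Lift.
Variables (M : lmodType k) (f : forall i, {linear V i G -> M}).
Lemma ds_lift_rel t u : ds_rel t u ->
  term_eval (fun p : {i : I & V i G} => f (projT1 p) (projT2 p)) t
  = term_eval (fun p : {i : I & V i G} => f (projT1 p) (projT2 p)) u.
Proof. by case=> i a x y /=; rewrite linearP. Qed.
Definition ds_lift : {linear ds_ob -> M} := pres_lift ds_lift_rel.
Lemma ds_liftE i x : ds_lift (@ds_gen i x) = f i x.
Proof. exact: pres_liftE. Qed.
End Lift.

Lemma ds_ext (M : lmodType k) (f g : {linear ds_ob -> M}) :
  (forall i x, f (@ds_gen i x) = g (ds_gen x)) -> f =1 g.
Proof. by move=> fg; apply: pres_ext => -[i x]; apply: fg. Qed.
End At.
Arguments ds_lift : simpl never.

Definition ds_res H G (e : epi (member_group H) (member_group G)) : {linear ds_ob G -> ds_ob H} :=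
  ds_lift (fun i => mk_linear (@ds_gen_linear H i) \o res (V i) e).

Lemma ds_resE H G (e : epi (member_group H) (member_group G)) i (x : V i G) :
  ds_res e (ds_gen x) = ds_gen (res (V i) e x).
Proof. by rewrite /ds_res ds_liftE. Qed.

Fact ds_res_conj H G (f g : epi (member_group H) (member_group G)) :
  epi_conj f g -> ds_res f =1 ds_res g.
Proof. by move=> fg; apply: (@ds_ext G _ (ds_res f) (ds_res g)) => i x; rewrite !ds_resE (res_conj fg). Qed.
Fact ds_res_id (G : member U) (x : ds_ob G) : ds_res (id_epi G) x = x.
Proof.
apply: (@ds_ext G _ (ds_res (id_epi G)) idfun) => i y.
by rewrite ds_resE res_id.
Qed.
Fact ds_res_comp (K H G : member U) (f : epi H G) (g : epi K H) (x : ds_ob G) :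
  ds_res (comp_epi f g) x = ds_res g (ds_res f x).
Proof.
apply: (@ds_ext G _ (ds_res (comp_epi f g)) (ds_res g \o ds_res f)) => i y.
by rewrite -[RHS]/(ds_res g (ds_res f (ds_gen y))) !ds_resE res_comp.
Qed.
Definition ds : gfunctor k U := @GFunctor k U ds_ob ds_res ds_res_conj ds_res_id ds_res_comp.

Lemma ds_in_natural i H G (e : epi (member_group H) (member_group G)) (x : V i G) :
  mk_linear (@ds_gen_linear H i) (res (V i) e x)
  = res ds e (mk_linear (@ds_gen_linear G i) x).
Proof. exact/esym/ds_resE. Qed.
Definition ds_in i : nat_trans (V i) ds :=
  @NatTrans k U (V i) ds (fun G => mk_linear (@ds_gen_linear G i)) (@ds_in_natural i).

Section DsLift.
Variables (M : gfunctor k U) (f : forall i, nat_trans (V i) M).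
Lemma ds_out_natural H G (e : epi (member_group H) (member_group G)) (x : ds G) :
  ds_lift (fun i => f i H) (res ds e x) = res M e (ds_lift (fun i => f i G) x).
Proof.
rewrite -[LHS]/((ds_lift (fun i => f i H) \o ds_res e) x).
rewrite -[RHS]/((res M e \o ds_lift (fun i => f i G)) x).
apply: (@ds_ext G _ (ds_lift (fun i => f i H) \o ds_res e) (res M e \o ds_lift (fun i => f i G))) => i y.
rewrite -[LHS]/(ds_lift (fun i => f i H) (ds_res e (ds_gen y))).
rewrite -[RHS]/(res M e (ds_lift (fun i => f i G) (ds_gen y))).
by rewrite ds_resE !ds_liftE nt_natural.
Qed.
Definition ds_out : nat_trans ds M :=
  @NatTrans k U ds M (fun G => ds_lift (fun i => f i G)) ds_out_natural.
Lemma ds_outE i G (x : V i G) : ds_out G (ds_in i G x) = f i G x.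
Proof. exact: ds_liftE. Qed.
End DsLift.

Lemma ds_nt_ext (M : gfunctor k U) (f g : nat_trans ds M) :
  (forall i G x, f G (ds_in i G x) = g G (ds_in i G x)) -> forall G x, f G x = g G x.
Proof. by move=> fg G; apply: (@ds_ext G _ (f G) (g G)) => i x; apply: fg. Qed.

Definition ds_delta i j : nat_trans (V j) (V i) :=
  match pselect (j = i) with
  | left e => ecast x (nat_trans (V j) (V x)) e (nt_id (V j))
  | right _ => nt_zero _ _
  end.
Lemma ds_delta1 i G x : ds_delta i i G x = x.
Proof. by rewrite /ds_delta; case: pselect => // e; rewrite (Prop_irrelevance e erefl). Qed.
Lemma ds_delta0 i j G x : j <> i -> ds_delta i j G x = 0.
Proof. by rewrite /ds_delta; case: pselect. Qed.

Definition ds_pr i : nat_trans ds (V i) := ds_out (ds_delta i).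
Lemma ds_pr1 i G x : ds_pr i G (ds_in i G x) = x.
Proof. by rewrite ds_outE ds_delta1. Qed.
Lemma ds_pr0 i j G x : j <> i -> ds_pr i G (ds_in j G x) = 0.
Proof. by move=> ji; rewrite ds_outE ds_delta0. Qed.

End DirectSum.

Lemma ds_decomp (k : fieldType) (U : group_family) (I : choiceType)
    (V : I -> gfunctor k U) G (x : ds V G) :
  exists2 s : seq I, uniq s & x = \sum_(i <- s) ds_in V i G (ds_pr V i G x).
Proof.
have incl (s : seq I) : uniq s -> forall i0 (y : V i0 G), i0 \in s ->
    \sum_(i <- s) ds_in V i G (ds_pr V i G (ds_in V i0 G y)) = ds_in V i0 G y.
  move=> us i0 y si; rewrite (bigD1_seq i0) // ds_pr1 big1; first exact: addr0.
  move=> i /eqP ii0.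
  by rewrite ds_pr0 ?linear0 // => e; apply: ii0.
(* The claim is strengthened to every duplicate-free list containing the support, so that the
   supports of two summands can be joined. *)
suff [s sP] : exists s : seq I, forall s', uniq s' -> {subset s <= s'} ->
    x = \sum_(i <- s') ds_in V i G (ds_pr V i G x).
  exists (undup s); first exact: undup_uniq.
  by apply: sP => [|i]; rewrite ?undup_uniq ?mem_undup.
pose P (x : ds_ob V G) := exists s : seq I, forall s', uniq s' -> {subset s <= s'} ->
  x = \sum_(i <- s') ds_in V i G (ds_pr V i G x).
move: x; refine (@pres_ind k _ (@ds_rel _ _ _ V G) P _ _ _ _);
  [case=> i x| |move=> x y [s sP] [t tP]|move=> a x [s sP]].
- exists [:: i] => s us si; apply/esym/incl => //; apply: si; exact: mem_head.
- by exists [::] => s _ _; rewrite big1 // => i _; rewrite !linear0.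
- exists (s ++ t) => s' us ss.
  have s1 : {subset s <= s'} by move=> i si; apply: ss; rewrite mem_cat si.
  have s2 : {subset t <= s'} by move=> i si; apply: ss; rewrite mem_cat si orbT.
  have ex := sP s' us s1; have ey := tP s' us s2.
  transitivity (\sum_(i <- s') ds_in V i G (ds_pr V i G x)
    + \sum_(i <- s') ds_in V i G (ds_pr V i G y)); first exact: (f_equal2 +%R ex ey).
  rewrite -big_split; apply: eq_bigr => i _.
  apply: etrans (esym (congr1 (ds_in V i G) (linearD (ds_pr V i G) x y))).
  exact: esym (linearD (ds_in V i G) _ _).
- exists s => s' us ss.
  transitivity (a *: \sum_(i <- s') ds_in V i G (ds_pr V i G x)); first exact: (congr1 ( *:%R a) (sP s' us ss)).
  rewrite scaler_sumr; apply: eq_bigr => i _.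
  apply: etrans (esym (congr1 (ds_in V i G) (linearZ_LR (ds_pr V i G) a x))).
  exact: esym (linearZ_LR (ds_in V i G) _ _).
Qed.
Section BigSum.
Variables (k : fieldType) (U : group_family) (I : Type) (Y : I -> complex k U).

Definition bs_diff n : nat_trans (ds (fun i => Y i n)) (ds (fun i => Y i (n - 1))) :=
  ds_out (fun i => nt_comp (ds_in (fun i => Y i (n - 1)) i) (diff (Y i) n)).

Lemma bs_diffE i n G (x : Y i n G) :
  bs_diff n G (ds_in (fun i => Y i n) i G x)
  = ds_in (fun i => Y i (n - 1)) i G (diff (Y i) n G x).
Proof. exact: ds_outE. Qed.

Lemma bs_dd n G (x : ds (fun i => Y i n) G) : bs_diff (n - 1) G (bs_diff n G x) = 0.
Proof.
rewrite -[LHS]/(nt_comp (bs_diff (n - 1)) (bs_diff n) G x) -[RHS]/(nt_zero _ _ G x).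
apply: (@ds_nt_ext _ _ _ _ _ (nt_comp (bs_diff (n - 1)) (bs_diff n)) (nt_zero _ _)) => i H y.
rewrite -[LHS]/(bs_diff (n - 1) H (bs_diff n H (ds_in (fun i => Y i n) i H y))).
by rewrite !bs_diffE dd linear0.
Qed.

Definition bigsum : complex k U := Complex bs_dd.

Definition bin_nt i n : nat_trans (Y i n) (bigsum n) := ds_in (fun i => Y i n) i.
Lemma bin_d i n G (x : Y i n G) : bin_nt i (n - 1) G (diff (Y i) n G x)
  = diff bigsum n G (bin_nt i n G x).
Proof. exact/esym/bs_diffE. Qed.
Definition bin i : chain_map (Y i) bigsum :=
  @ChainMap k U (Y i) bigsum (bin_nt i) (@bin_d i).

Section BLift.
Variables (Z : complex k U) (f : forall i, chain_map (Y i) Z).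
Definition bout_nt n : nat_trans (bigsum n) (Z n) := ds_out (fun i => f i n).
Lemma bout_d n G (x : bigsum n G) : bout_nt (n - 1) G (diff bigsum n G x)
  = diff Z n G (bout_nt n G x).
Proof.
apply: (@ds_nt_ext _ _ _ _ _ (nt_comp (bout_nt (n - 1)) (bs_diff n))
  (nt_comp (diff Z n) (bout_nt n))) => i H y.
rewrite -[LHS]/(bout_nt (n - 1) H (bs_diff n H (ds_in (fun i => Y i n) i H y))).
rewrite -[RHS]/(diff Z n H (bout_nt n H (ds_in (fun i => Y i n) i H y))).
by rewrite bs_diffE /bout_nt !ds_outE cm_d.
Qed.
Definition bout : chain_map bigsum Z := @ChainMap k U bigsum Z bout_nt bout_d.
Lemma boutE i n G x : bout n G (bin i n G x) = f i n G x.
Proof. exact: ds_outE. Qed.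
End BLift.

Lemma bigsum_ext (Z : complex k U) (f g : chain_map bigsum Z) :
  (forall i n G x, f n G (bin i n G x) = g n G (bin i n G x)) ->
  forall n G x, f n G x = g n G x.
Proof. by move=> fg n; apply: ds_nt_ext => i G x; apply: fg. Qed.

(** Into the K-injective resolution of [Z], a family of morphisms is a family of chain maps, and
    homotopies chosen on each summand assemble into one on the sum. *)
Lemma bigsum_coproduct : replete U -> coproduct (fun i => mm (bin i)).
Proof.
move=> hU Z g; have kQ := @Q_kinj _ _ hU Z; split.
  have ex i : exists c : chain_map (Y i) (Q hU Z), mm (jQ hU Z) *d g i = mm c.
    exact: hom_surj.
  pose c i := sval (cid (ex i)).
  have cP i : mm (jQ hU Z) *d g i = mm (c i) by rewrite /c; case: cid.
  exists (minv (jQ_qi hU Z) *d mm (bout c)) => i.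
  apply: (mm_qi_injl (jQ_qi hU Z)); rewrite !mcompA mm_minv mcomp1l cP -mmM.
  by apply: mm_ext => n G x; apply: boutE.
move=> h h' hh; apply: (mm_qi_injl (jQ_qi hU Z)).
have [c cE] := hom_surj hU (mm (jQ hU Z) *d h) kQ.
have [c' cE'] := hom_surj hU (mm (jQ hU Z) *d h') kQ.
rewrite cE cE'; apply: htpy_mm.
have ht i : htpy (chain_comp c (bin i)) (chain_comp c' (bin i)).
  by apply: (hom_inj hU kQ); rewrite !mmM -cE -cE' -!mcompA hh.
pose l i := sval (cid (ht i)).
have lP i n G (x : Y i (n - 1) G) : c (n - 1) G (bin i (n - 1) G x) -
   c' (n - 1) G (bin i (n - 1) G x)
   = diff (Q hU Z) n G (l i n G x) + l i (n - 1) G (diff (Y i) (n - 1) G x).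
  rewrite /l; case: cid => t tP /=; exact: tP.
exists (fun n => ds_out (fun i => l i n)) => n G x.
pose L n : nat_trans (bigsum (n - 1)) (Q hU Z n) := ds_out (fun i => l i n).
apply: (@ds_nt_ext _ _ _ _ _ (nt_add (c (n - 1)) (nt_opp (c' (n - 1))))
  (nt_add (nt_comp (diff (Q hU Z) n) (L n)) (nt_comp (L (n - 1)) (diff bigsum (n - 1))))) => i H y.
rewrite -[LHS]/(c (n - 1) H (bin i (n - 1) H y) - c' (n - 1) H (bin i (n - 1) H y)) lP.
rewrite -[RHS]/(diff (Q hU Z) n H (L n H (bin i (n - 1) H y))
  + L (n - 1) H (diff bigsum (n - 1) H (bin i (n - 1) H y))) -cm_d.
congr (diff (Q hU Z) n H _ + _); apply/esym; exact: ds_outE.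
Qed.

Definition bdelta i j : chain_map (Y j) (Y i) :=
  match pselect (j = i) with
  | left e => ecast x (chain_map (Y j) (Y x)) e (chain_id (Y j))
  | right _ => chain_zero
  end.
Lemma bdelta1 i n G x : bdelta i i n G x = x.
Proof. by rewrite /bdelta; case: pselect => // e; rewrite (Prop_irrelevance e erefl). Qed.
Lemma bdelta0 i j n G x : j <> i -> bdelta i j n G x = 0.
Proof. by rewrite /bdelta; case: pselect. Qed.

Definition bpr i : chain_map bigsum (Y i) := bout (bdelta i).
Lemma bpr1 i n G x : bpr i n G (bin i n G x) = x.
Proof. by rewrite boutE bdelta1. Qed.
Lemma bpr0 i j n G x : j <> i -> bpr i n G (bin j n G x) = 0.
Proof. by move=> ji; rewrite boutE bdelta0. Qed.

End BigSum.

Lemma bigsum_decomp (k : fieldType) (U : group_family) (I : choiceType)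
    (Y : I -> complex k U) n G (x : bigsum Y n G) :
  exists2 s : seq I, uniq s & x = \sum_(i <- s) bin Y i n G (bpr Y i n G x).
Proof.
have [s us e] := ds_decomp x; exists s => //; rewrite {1}e.
apply: eq_bigr => i _; congr (bin Y i n G _).
apply: ds_nt_ext => j H y; case: (pselect (j = i)) => ji.
  by subst j; rewrite ds_pr1; apply/esym/bpr1.
by rewrite ds_pr0 //; apply/esym/bpr0.
Qed.

(** * The generators *)

Section Free.
Variables (k : fieldType) (S : Type).
Definition free_rel (_ _ : term k S) := False.
Definition freemod : lmodType k := pres free_rel.
Definition fgen (x : S) : freemod := pres_gen free_rel x.
Lemma flift_rel (M : lmodType k) (phi : S -> M) t u :
  free_rel t u -> term_eval phi t = term_eval phi u.
Proof. by []. Qed.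
Definition flift (M : lmodType k) (phi : S -> M) : {linear freemod -> M} :=
  pres_lift (flift_rel phi).
Lemma fliftE M phi x : @flift M phi (fgen x) = phi x.
Proof. exact: pres_liftE. Qed.
Lemma free_ext (M : lmodType k) (f g : {linear freemod -> M}) :
  (forall x, f (fgen x) = g (fgen x)) -> f =1 g.
Proof. exact: pres_ext. Qed.
End Free.
Arguments flift : simpl never.
Arguments fgen : simpl never.

Section Sphere.
Variables (k : fieldType) (U : group_family) (n : int) (G : member U).

Section Degree.
Variable m : int.

(** The proof of [m = n] is part of a basis element, so that the functor vanishes outside degree [n]
    without a case distinction. *)
Definition sph_idx (T : member U) : Type := ((m = n) * ecls T G)%type.
Definition sph_res H T (e : epi (member_group H) (member_group T)) :
    {linear freemod k (sph_idx T) -> freemod k (sph_idx H)} :=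
  flift (fun p : sph_idx T => fgen k (p.1, ecl (comp_epi (erep p.2) e))).

Lemma sph_resE H T (e : epi (member_group H) (member_group T)) (p : sph_idx T) :
  sph_res e (fgen k p) = fgen k (p.1, ecl (comp_epi (erep p.2) e)).
Proof. exact: fliftE. Qed.

Fact sph_res_conj H T (e f : epi (member_group H) (member_group T)) :
  epi_conj e f -> sph_res e =1 sph_res f.
Proof.
move=> ef; apply: free_ext => p; rewrite !sph_resE; congr (fgen k (_, _)).
exact/ecl_eq/epi_conj_comp/ef/epi_conj_refl.
Qed.
Fact sph_res_id (T : member U) x : sph_res (id_epi T) x = x.
Proof.
apply: (@free_ext _ _ _ (sph_res (id_epi T)) idfun) => -[e c]; rewrite sph_resE.
congr (fgen k (_, _)); rewrite /= -[RHS]erepK; exact/ecl_eq/epi_conj_ext.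
Qed.
Fact sph_res_comp (K H T : member U) (f : epi H T) (g : epi K H) x :
  sph_res (comp_epi f g) x = sph_res g (sph_res f x).
Proof.
apply: (@free_ext _ _ _ (sph_res (comp_epi f g)) (sph_res g \o sph_res f)) => p.
rewrite -[RHS]/(sph_res g (sph_res f (fgen k p))) !sph_resE; congr (fgen k (_, _)).
apply/ecl_eq; apply: epi_conj_trans (epi_conj_comp (erep_ecl _) (epi_conj_refl g)).
exact: epi_conj_ext.
Qed.
Definition sph_ob : gfunctor k U := GFunctor sph_res_conj sph_res_id sph_res_comp.
End Degree.

Definition sph : complex k U :=
  @Complex k U sph_ob (fun m => nt_zero _ _) (fun _ _ _ => erefl).

Definition sph_u : sph n G := fgen k (erefl, ecl (id_epi G)).

Lemma sph_genE m (e : n = m) (T : member U) (c : ecls T G) :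
  fgen k (esym e, c) = res (sph m) (erep c) (ct sph e G sph_u).
Proof.
subst m; rewrite [RHS]sph_resE; congr (fgen k (_, _)).
rewrite -[LHS]erepK; apply/ecl_eq.
apply: epi_conj_trans (epi_conj_comp (erep_ecl _) (epi_conj_refl _)).
exact: epi_conj_ext.
Qed.

Lemma sph_ext m (M : gfunctor k U) (f g : nat_trans (sph m) M) :
  (forall e : n = m, f G (ct sph e G sph_u) = g G (ct sph e G sph_u)) ->
  forall T x, f T x = g T x.
Proof.
move=> fg T; apply: (@free_ext _ _ _ (f T) (g T)) => -[e c].
rewrite -[e]esymK.
have -> : fgen k (esym (esym e), c) = res (sph m) (erep c) (ct sph (esym e) G sph_u).
  exact: sph_genE.
by rewrite !nt_natural fg.
Qed.

Lemma sph_ctE m (e : n = m) : ct sph e G sph_u = fgen k (esym e, ecl (id_epi G)).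
Proof. by subst m. Qed.

Section Out.
Variables (m : int) (M : gfunctor k U) (z : forall e : n = m, M G).
Definition sph_out_fun T : {linear sph m T -> M T} :=
  flift (fun p : sph_idx m T => res M (erep p.2) (z (esym p.1))).
Fact sph_out_natural H T (e : epi (member_group H) (member_group T)) (x : sph m T) :
  sph_out_fun H (res (sph m) e x) = res M e (sph_out_fun T x).
Proof.
apply: (@free_ext _ _ _ (sph_out_fun H \o res (sph m) e) (res M e \o sph_out_fun T)) => p.
rewrite -[LHS]/(sph_out_fun H (sph_res m e (fgen k p))).
rewrite -[RHS]/(res M e (sph_out_fun T (fgen k p))) sph_resE.
rewrite [LHS]fliftE [in RHS]fliftE /= -res_comp; apply: res_conj.
exact/epi_conj_sym/erep_ecl.
Qed.
Definition sph_out : nat_trans (sph m) M := NatTrans sph_out_natural.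
Lemma sph_outE (e : n = m) : sph_out G (ct sph e G sph_u) = z e.
Proof.
rewrite sph_ctE [LHS]fliftE /= esymK -[RHS]res_id; apply: res_conj.
exact/epi_conj_sym/erep_ecl.
Qed.
End Out.

Section Map.
Variables (Z : complex k U) (z : Z n G) (cz : cyc z).
Definition sph_map_nt m : nat_trans (sph m) (Z m) := sph_out (fun e => ct Z e G z).
Fact sph_map_d m T (x : sph m T) :
  sph_map_nt (m - 1) T (diff sph m T x) = diff Z m T (sph_map_nt m T x).
Proof.
rewrite [LHS]linear0; apply/esym.
rewrite -[LHS]/(nt_comp (diff Z m) (sph_map_nt m) T x) -[RHS]/(nt_zero (sph m) _ T x).
apply: (@sph_ext m _ (nt_comp (diff Z m) (sph_map_nt m)) (nt_zero _ _)) => e.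
rewrite -[LHS]/(diff Z m G (sph_map_nt m G (ct sph e G sph_u))) sph_outE.
by subst m.
Qed.
Definition sph_map : chain_map sph Z := ChainMap sph_map_d.
Lemma sph_mapE : sph_map n G sph_u = z.
Proof. exact: (sph_outE _ erefl). Qed.
End Map.

Lemma sph_map_ext (Z : complex k U) (f g : chain_map sph Z) :
  f n G sph_u = g n G sph_u -> forall m T x, f m T x = g m T x.
Proof. by move=> e m; apply: sph_ext => d; subst m. Qed.
End Sphere.

(** By the Yoneda property of the generator, homologous cycles give homotopic maps; the element
    bounding the difference defines the homotopy. *)
Lemma sph_htpy (k : fieldType) (U : group_family) n (G : member U) (Z : complex k U)
    (f g : chain_map (sph k n G) Z) :
  bd (f n G (sph_u k n G) - g n G (sph_u k n G)) -> htpy f g.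
Proof.
have e : n + 1 - 1 = n by rewrite addrK.
move=> /(bd_dgP e)[y yE].
have e2 (m : int) : n = m - 1 -> n + 1 = m by move->; rewrite subrK.
pose h (m : int) : nat_trans (sph k n G (m - 1)) (Z m) := sph_out (fun d => ct Z (e2 m d) G y).
exists h => m T x; rewrite -[diff _ _ _ x]/(0 : sph k n G (m - 1 - 1) T) linear0 addr0.
pose L := nt_add (f (m - 1)) (nt_opp (g (m - 1))).
rewrite -[LHS]/(L T x) -[RHS]/(nt_comp (diff Z m) (h m) T x).
apply: sph_ext => d.
rewrite -[RHS]/(diff Z m G (h m G (ct (sph k n G) d G (sph_u k n G)))) sph_outE.
rewrite -[LHS]/(f (m - 1) G (ct (sph k n G) d G (sph_u k n G))
  - g (m - 1) G (ct (sph k n G) d G (sph_u k n G))) !cm_ct.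
rewrite -linearB -yE (ct_dg _ _ (etrans e d)) -(dgE erefl).
by rewrite (dg_ct _ _ (etrans e d)).
Qed.

Section SphereCompact.
Variables (k : fieldType) (U : group_family).
Hypothesis U_replete : replete U.

(** Morphisms from a sphere to [Z] are homology classes of [Z] at [G]: a representing cycle in the
    resolution comes, up to a boundary, from a cycle of [Z]. Which cycles give zero is settled in
    [sph_map_bd]. *)
Lemma sph_hom n (G : member U) (Z : complex k U) (d : mor (sph k n G) Z) :
  exists (z : Z n G) (cz : cyc z), d = mm (sph_map cz).
Proof.
have [g gE] := hom_surj U_replete (mm (jQ U_replete Z) *d d) (@Q_kinj _ _ U_replete Z).
have [_ /(_ (g n G (sph_u k n G)))[]] := proj1 (quasi_isoP _) (jQ_qi U_replete Z) G n.
  exact: cm_cyc.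
move=> z cz zE; exists z, cz; apply: (mm_qi_injl (jQ_qi U_replete Z)).
rewrite gE -mmM; apply/htpy_mm/htpy_sym/sph_htpy.
rewrite -[chain_comp _ _ _ _ _]/(jQ U_replete Z n G (sph_map cz n G _)).
by rewrite sph_mapE.
Qed.

(** An abstract coproduct is compared with the concrete [bigsum], where a morphism from a sphere is
    a cycle and an element has finite support. *)
Lemma cpt_sph n (G : member U) : cpt (sph k n G).
Proof.
move=> I Y S inj co h.
have [[t tE] _] := co _ (fun i => mm (bin Y i)).
have [[s sE] _] := bigsum_coproduct U_replete inj.
have [_ un] := co S inj.
have st : s *d t = m1 S by apply: un => i; rewrite -mcompA tE sE mcomp1l.
rewrite -[h]mcomp1l -st -mcompA; have [b [cb ->]] := sph_hom (t *d h).
have [l us bE] := bigsum_decomp b.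
(* Every partial sum of the components of [b] is again a cycle, so the induction can run over the
   support. *)
suff H (r : seq I) (c : bigsum Y n G) (cc : cyc c) :
    c = \sum_(i <- r) bin Y i n G (bpr Y i n G b) -> fin_sum inj (s *d mm (sph_map cc)).
  exact: (H l).
elim: r => [|i r IH] in c cc *; rewrite ?big_nil ?big_cons => cE.
  have -> : mm (sph_map cc) = m0.
    rewrite -mm0; apply: mm_ext; apply: sph_map_ext.
    by rewrite sph_mapE cE /= .
  by rewrite mcomp0r; apply: fin_sum0.
have ci : cyc (bpr Y i n G b) by apply: cm_cyc.
have cr : cyc (\sum_(i <- r) bin Y i n G (bpr Y i n G b)).
  rewrite /cyc linear_sum big1 // => j _; exact/cm_cyc/cm_cyc.
have -> : mm (sph_map cc) = mm (bin Y i) *d mm (sph_map ci) +d mm (sph_map cr).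
  rewrite -mmM -mmD; apply: mm_ext; apply: sph_map_ext.
  rewrite sph_mapE cE.
  rewrite -[RHS]/(bin Y i n G (sph_map ci n G _) + sph_map cr n G _).
  by rewrite !sph_mapE.
rewrite mcompDr mcompA sE; apply: fin_sumD; first exact: fin_sum1.
exact: IH.
Qed.
End SphereCompact.

(** * Building compact objects *)

Section BinarySum.
Variables (k : fieldType) (U : group_family) (E1 E2 : complex k U).
Definition two_summands (b : bool) : complex k U := if b then E1 else E2.
Definition csum := bigsum two_summands.
Definition in1 : chain_map E1 csum := bin two_summands true.
Definition in2 : chain_map E2 csum := bin two_summands false.
Definition pr1 : chain_map csum E1 := bpr two_summands true.
Definition pr2 : chain_map csum E2 := bpr two_summands false.

Lemma pr1in1 : mm pr1 *d mm in1 = m1 E1.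
Proof. by rewrite -mmM; apply: mm_ext => n G x; exact: (@bpr1 k U bool two_summands true n G x). Qed.
Lemma pr2in2 : mm pr2 *d mm in2 = m1 E2.
Proof. by rewrite -mmM; apply: mm_ext => n G x; exact: (@bpr1 k U bool two_summands false n G x). Qed.
Lemma pr1in2 : mm pr1 *d mm in2 = m0.
Proof. by rewrite -mmM -mm0; apply: mm_ext => n G x; exact: (@bpr0 k U bool two_summands true false n G x). Qed.
Lemma pr2in1 : mm pr2 *d mm in1 = m0.
Proof. by rewrite -mmM -mm0; apply: mm_ext => n G x; exact: (@bpr0 k U bool two_summands false true n G x). Qed.

Lemma csum1 : mm in1 *d mm pr1 +d mm in2 *d mm pr2 = m1 csum.
Proof.
rewrite -!mmM -mmD; apply: mm_ext; apply: bigsum_ext => b n G x.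
rewrite -[LHS]/(in1 n G (pr1 n G (bin two_summands b n G x)) + in2 n G (pr2 n G (bin two_summands b n G x))).
case: b x => x.
  rewrite /pr1 /pr2 bpr1 bpr0 // linear0; exact: addr0.
rewrite /pr1 /pr2 bpr1 bpr0 // linear0; exact: add0r.
Qed.
End BinarySum.

Section Tower.
Variables (k : fieldType) (U : group_family).
Hypothesis U_replete : replete U.
Section Cells.
Variable Y : complex k U.

(** One cell for every cycle at every group of the skeleton: coning off all of them kills all
    homology classes at once. *)
Definition cell_idx := {c : skel U & {n : int & {x : Y n (sk c) | cyc x}}}.
HB.instance Definition _ := gen_eqMixin cell_idx.
HB.instance Definition _ := gen_choiceMixin cell_idx.

Definition cell_sph (i : cell_idx) : complex k U := sph k (tag (tagged i)) (sk (tag i)).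
Definition cells : complex k U := bigsum cell_sph.
Definition attach : chain_map cells Y :=
  bout (fun i : cell_idx => sph_map (svalP (tagged (tagged i)))).

Lemma attach_surj n (G : member U) (y : Y n G) : cyc y ->
  exists2 w : cells n G, cyc w & attach n G w = y.
Proof.
move=> cy; have cy' : cyc (res (Y n) (sk_to U_replete G) y).
  by rewrite /cyc nt_natural cy linear0.
pose i : cell_idx := existT _ (skof U_replete G) (existT _ n (exist _ _ cy')).
exists (res (cells n) (sk_from U_replete G) (bin cell_sph i n _ (sph_u k n (sk (skof U_replete G))))).
  have ci : cyc (bin cell_sph i n _ (sph_u k n (sk (skof U_replete G)))) by exact: cm_cyc.
  by rewrite /cyc nt_natural ci linear0.
rewrite nt_natural.
have -> : attach n _ (bin cell_sph i n _ (sph_u k n (sk (skof U_replete G))))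
   = res (Y n) (sk_to U_replete G) y.
  apply: etrans (boutE _ _) _; exact: sph_mapE.
rewrite -res_comp -[RHS]res_id; apply: res_conj; apply: epi_conj_ext => x.
exact: sk_fromK.
Qed.

Lemma cell_in_bd n (G : member U) (y : Y n G) : cyc y -> bd (cone_in attach n G y).
Proof.
elim/int_pred_ind: n => n in y *; move=> /attach_surj[w cw <-].
apply/cone_bd; exists w, 0; split; last by rewrite linear0 addr0.
have -> : diff cells (n - 1) G w = 0 by exact: cw.
by rewrite oppr0.
Qed.
End Cells.

Variable X : complex k U.
Hypothesis cX : cpt X.

Fixpoint tower j : complex k U :=
  if j is j'.+1 then cone (attach (tower j')) else X.
Definition tower_in j : chain_map (tower j) (tower j.+1) := cone_in (attach (tower j)).

Definition tel : complex k U := bigsum tower.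
Definition tel_shift : chain_map tel tel :=
  bout (fun j => chain_comp (bin tower j.+1) (tower_in j)).
Definition tel_map : chain_map tel tel := chain_add (chain_id tel) (chain_opp tel_shift).

Lemma tel_shift_bd n G (x : tel n G) : cyc x -> bd (tel_shift n G x).
Proof.
move=> cx; have [s _ ->] := bigsum_decomp x.
elim: s => [|j s IH]; first by rewrite big_nil linear0; apply: bd0.
rewrite big_cons linearD; apply: bdD => //.
have -> : tel_shift n G (bin tower j n G (bpr tower j n G x))
  = bin tower j.+1 n G (tower_in j n G (bpr tower j n G x)) by exact: boutE.
apply/cm_bd/cell_in_bd/cm_cyc/cx.
Qed.

(** [tel_shift] is zero on homology, so [1 - tel_shift] induces the identity: the homotopy colimit
    of the tower vanishes. *)
Lemma tel_qi : quasi_iso tel_map.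
Proof.
apply/quasi_isoP => G n; split=> x cx.
  by move=> h; apply: (bd_subr h); apply: tel_shift_bd.
exists x => //; rewrite -[tel_map n G x]/(x - tel_shift n G x) addrAC subrr add0r.
exact/bdN/tel_shift_bd.
Qed.

(** Dividing the inclusion of stage 0 by [1 - tel_shift] gives [h]. Its components start with the
    identity and each determines the next, so they are the composites of the tower maps; by
    compactness of [X] all but finitely many of them are zero. *)
Lemma tower_maps : exists f : forall j, mor X (tower j),
  [/\ f 0%N = m1 X, forall j, f j.+1 = mm (tower_in j) *d f j & exists N, f N = m0].
Proof.
pose h := minv tel_qi *d mm (bin tower 0%N).
have hE : mm tel_map *d h = mm (bin tower 0%N) by rewrite mcompA mm_minv mcomp1l.
exists (fun j => mm (bpr tower j) *d h).
have pb0 i j : j <> i -> mm (bpr tower i) *d mm (bin tower j) = m0.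
  by move=> ij; rewrite -mmM -mm0; apply: mm_ext => n G x; apply: bpr0.
have pb1 i : mm (bpr tower i) *d mm (bin tower i) = m1 (tower i).
  by rewrite -mmM; apply: mm_ext => n G x; apply: bpr1.
split.
- rewrite -(pb1 0%N) -hE [RHS]mcompA; congr (_ *d _); rewrite -mmM.
  apply: mm_ext; apply: bigsum_ext => j n G x.
  rewrite -[RHS]/(bpr tower 0%N n G (bin tower j n G x - tel_shift n G (bin tower j n G x))).
  rewrite linearB; have -> : tel_shift n G (bin tower j n G x)
    = bin tower j.+1 n G (tower_in j n G x) by exact: boutE.
  by rewrite [X in _ - X]bpr0 // subr0.
- move=> j.
  have e : mm (bpr tower j.+1) *d mm tel_map
     = mm (bpr tower j.+1) -d mm (tower_in j) *d mm (bpr tower j).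
    rewrite -!mmM -mmN -mmD; apply: mm_ext; apply: bigsum_ext => i n G x.
    rewrite -[LHS]/(bpr tower j.+1 n G (bin tower i n G x - tel_shift n G (bin tower i n G x))).
    rewrite linearB; have -> : tel_shift n G (bin tower i n G x)
      = bin tower i.+1 n G (tower_in i n G x) by exact: boutE.
    rewrite -[RHS]/(bpr tower j.+1 n G (bin tower i n G x)
       - tower_in j n G (bpr tower j n G (bin tower i n G x))).
    congr (_ - _); case: (pselect (i = j)) => ij; first by subst i; rewrite !bpr1.
    by rewrite !bpr0 ?linear0 // => -[].
  apply/msub_eq0; rewrite [_ *d (_ *d h)]mcompA -mcompNl -mcompDl -e -mcompA hE.
  exact: (@pb0 j.+1 0%N).
have [l lE] := cX (bigsum_coproduct U_replete) h.
have [N NP] : exists N, all (fun p : {i : nat & mor X (tower i)} => (tag p < N)%N) l.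
  elim: (l) => [|p s [N NP]]; first by exists 0%N.
  exists (maxn N (tag p).+1); rewrite /= leq_max ltnSn orbT /=.
  by apply: sub_all NP => q /leq_trans -> //; apply: leq_maxl.
exists N; rewrite lE sum_compl.
elim: l NP {lE} => [|p s IH]; first by rewrite big_nil.
rewrite big_cons /= => /andP[pN /IH ->]; rewrite mcompA pb0 ?mcomp0l ?madd0l //.
by move=> e; rewrite e ltnn in pN.
Qed.
End Tower.

Section Principle.
Variables (k : fieldType) (U : group_family).
Hypothesis U_replete : replete U.
Implicit Types X Y Z E A B : complex k U.

(** Closure under cones and under sources of maps replaces closure under triangles, and shifts
    follow with [cx_zero]. Retracts are taken of a sum of two objects, so that binary sums follow as
    well. *)
Record building (P : complex k U -> Prop) : Prop := Building {
  building0 : P (@cx_zero k U);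
  building_sph : forall n G, P (sph k n G);
  building_cone : forall A B (f : chain_map A B), P A -> P B -> P (cone f);
  building_source : forall A B (f : chain_map A B), P B -> P (cone f) -> P A;
  building_retract : forall X E1 E2 (i1 : mor X E1) (r1 : mor E1 X) (i2 : mor X E2)
    (r2 : mor E2 X), r1 *d i1 +d r2 *d i2 = m1 X -> P E1 -> P E2 -> P X }.

Lemma building_cpt : building (@cpt k U).
Proof.
split.
- move=> I Y S inj co h; rewrite (m1_mor0 h); last exact/acyclic_m1/acyclic_zero.
  exact: fin_sum0.
- exact: cpt_sph.
- exact: cpt_cone.
- exact: cpt_cone_source.
- exact: cpt_sumretract.
Qed.

Lemma building_and (P Q : complex k U -> Prop) : building P -> building Q ->
  building (fun X => P X /\ Q X).
Proof.
move=> [p1 p2 p3 p4 p5] [q1 q2 q3 q4 q5]; split=> //.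
- by move=> A B f [? ?] [? ?]; split; [apply: p3|apply: q3].
- by move=> A B f [? ?] [? ?]; split; [apply: (p4 A B f)|apply: (q4 A B f)].
- by move=> X E1 E2 i1 r1 i2 r2 e [? ?] [? ?]; split; [apply: (p5 _ _ _ _ _ _ _ e)|apply: (q5 _ _ _ _ _ _ _ e)].
Qed.

Section Closure.
Variable P : complex k U -> Prop.
Hypothesis bP : building P.

Lemma building_retract1 X E (i : mor X E) (r : mor E X) : r *d i = m1 X -> P E -> P X.
Proof.
move=> e pE; have e' : r *d i +d @m0 k U E X *d @m0 k U X E = m1 X by rewrite mcomp0l madd0r.
exact: (building_retract bP e' pE pE).
Qed.

Lemma building_qi X Y (s : chain_map X Y) : quasi_iso s -> P X <-> P Y.
Proof.
move=> sP; split; first exact: (building_retract1 (mm_minv sP)).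
exact: (building_retract1 (minv_mm sP)).
Qed.

Lemma cone_to0_qi X : quasi_iso (cone_out (@chain_zero k U X (@cx_zero k U))).
Proof.
pose g n G (x : shift X n G) : cone (@chain_zero k U X (@cx_zero k U)) n G := (x, 0).
apply: (@bij_qi _ _ _ _ (cone_out (@chain_zero k U X (@cx_zero k U))) g) => // n G [x y].
by have -> : y = 0 by apply/matrixP => -[].
Qed.

Lemma building_shift X : P X <-> P (shift X).
Proof.
split=> h.
  apply/(building_qi (@cone_to0_qi X)); apply: (building_cone bP) => //.
  exact: building0 bP.
apply: (building_source bP (f := @chain_zero k U X (@cx_zero k U))).
  exact: building0 bP.
by apply/(building_qi (@cone_to0_qi X)).
Qed.

Lemma building_unshift X : P X <-> P (unshift X).
Proof.
split=> h; first exact/building_shift/(building_qi (@su_qi k U X)).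
by apply/(building_qi (@su_qi k U X)); apply: (proj1 (building_shift _)) h.
Qed.

Lemma building_csum A B : P A -> P B -> P (csum A B).
Proof. exact: (building_retract bP (csum1 A B)). Qed.

(* The homotopy fibre of [d], as a triangle [e' -> e -> B] whose second term
   detects the lifting of maps into [e]. *)
Lemma building_fibre A B (d : mor A B) : P A -> P B ->
  exists A' (q : mor A' A), [/\ P A', d *d q = m0 &
    forall W (v : mor W A), d *d v = m0 -> exists v', v = q *d v'].
Proof.
move=> pA pB.
have [w wE] := hom_surj U_replete (mm (jQ U_replete B) *d d) (@Q_kinj _ _ U_replete B).
exists (unshift (cone w)), (mm (us_iso A) *d fd (@unshiftF k U) (mm (cone_out w))); split.
- apply: (proj1 (building_unshift _)); apply: (building_cone bP) => //.
  exact/(building_qi (jQ_qi U_replete B)).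
- apply: (mm_qi_injl (jQ_qi U_replete B)); rewrite mcompA wE mcomp0r mcompA.
  rewrite -us_nat -mcompA. rewrite -(@fdM _ _ _ (unshiftF k U) _ _ _ (fd (shiftF k U) (mm w)) (mm (cone_out w))) fd_mm.
  have -> : mm (fm (@shiftF k U) w) *d mm (cone_out w) = m0.
    have -> : mm (fm (@shiftF k U) w) = mm (rot2 w) *d mm (cone_in (cone_out w)).
      by rewrite -mmM; apply: mm_ext => n G x; rewrite -rot2_in.
    by rewrite -mcompA cone_in_comp mcomp0r.
  by rewrite fd0 mcomp0r.
move=> W v dv.
have [|v' v'E] := @exact_cov_S _ _ U_replete (shift W) _ _ w (fd (@shiftF k U) v).
  have -> : mm (chain_shift w) = fd (shiftF k U) (mm w) by rewrite fd_mm.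
  by rewrite -(@fdM _ _ _ (shiftF k U) _ _ _ (mm w) v) -wE -mcompA dv mcomp0r fd0.
exists (fd (unshiftF k U) v' *d minv (us_qi W)).
apply: (mm_qi_injr (us_qi W)); rewrite -us_nat v'E -!mcompA minv_mm mcomp1r.
by rewrite -(@fdM _ _ _ (unshiftF k U) _ _ _ (mm (cone_out w)) v').
Qed.

(** Fibres are taken one after the other until finitely many maps [g i] vanish; [a] lifts at each
    stage because it is killed by them. *)
Lemma building_fibres (I : choiceType) (B : I -> complex k U) X A (a : mor X A)
    (s : seq I) (g : forall i, mor A (B i)) :
  P A -> (forall i, P (B i)) -> (forall i, i \in s -> g i *d a = m0) ->
  exists A' (q : mor A' A) a', [/\ P A', a = q *d a' & forall i, i \in s -> g i *d q = m0].
Proof.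
move=> pA pB; elim: s => [|i s IH] ga.
  by exists A, (m1 A), a; split; rewrite ?mcomp1l.
have [|A1 [q1 [a1 [pA1 aE gq]]]] := IH; first by move=> j js; apply: ga; rewrite inE js orbT.
have [A2 [q2 [pA2 gq2 lift]]] := building_fibre (g i *d q1) pA1 (pB i).
have [|a2 a2E] := lift _ a1; first by rewrite -mcompA -aE; apply: ga; rewrite mem_head.
exists A2, (q1 *d q2), a2; split=> //; first by rewrite -mcompA -a2E.
move=> j; rewrite inE => /orP[/eqP ->|js]; first by rewrite mcompA.
by rewrite mcompA gq // mcomp0l.
Qed.

Hypothesis P_cpt : forall X, P X -> cpt X.

Definition factors X Y (u : mor X Y) := exists E (a : mor X E) (b : mor E Y), P E /\ u = b *d a.

Lemma factors_add X Y (u v : mor X Y) : factors u -> factors v -> factors (u +d v).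
Proof.
move=> [E [a [b [pE ->]]]] [F [c [d [pF ->]]]].
exists (csum E F), (mm (in1 E F) *d a +d mm (in2 E F) *d c),
  (b *d mm (pr1 E F) +d d *d mm (pr2 E F)); split; first exact: building_csum.
rewrite mcompDl !mcompDr -!mcompA ![mm _ *d (mm _ *d _)]mcompA.
by rewrite pr1in1 pr2in2 pr1in2 pr2in1 !mcomp1l !mcomp0l !mcomp0r madd0r madd0l.
Qed.

Lemma factors0 X Y : factors (@m0 k U X Y).
Proof.
by exists (@cx_zero k U), m0, m0; rewrite mcomp0r; split=> //; apply: building0 bP.
Qed.

(** The inductive step down the tower: a factorization through [P] one stage later is pulled back to
    [Y], up to a map that comes from the cells. *)
Lemma factors_step X Y (u : mor X Y) : cpt X ->
  factors (mm (cone_in (attach Y)) *d u) -> factors u.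
Proof.
move=> cX [E [a [b [pE uE]]]].
have co := bigsum_coproduct U_replete (Y := @cell_sph k U Y).
have sphP (i : cell_idx Y) : P (cell_sph i) by apply: building_sph bP _ _.
(* As [E] is compact, its map to the shifted cells meets finitely many of them. They are the
   obstruction to lifting [b] to [Y], and they vanish on the fibre [E']. *)
have [s [g [us g0 gE]]] := fin_sum_uniq (P_cpt pE (shift_coproduct co)
  (mm (cone_out (attach Y)) *d b)).
have [|E' [q [a' [pE' aE gq]]]] := @building_fibres _ (fun i : cell_idx Y => shift (cell_sph i))
    X E a s g pE (fun i => proj1 (building_shift _) (sphP i)).
  apply: (coproduct_fin_sum_inj (f := fun i => g i *d a) (shift_coproduct co) us).
  transitivity (mm (cone_out (attach Y)) *d b *d a); last first.
    by rewrite -mcompA -uE mcompA cone_out_in mcomp0l.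
  by rewrite gE sum_compr; apply: eq_bigr => i _; rewrite mcompA.
have [|c cE] := exact_cov_C U_replete (d := b *d q).
  rewrite mcompA gE sum_compr big_seq big1 // => i si.
  by rewrite -mcompA gq // mcomp0r.
(* [u] and [c a'] agree in the cone, so their difference comes from the cells, and by compactness of
   [X] from finitely many spheres. *)
have [|v vE] := exact_cov_B U_replete (f := attach Y) (d := u -d c *d a').
  by rewrite mcompDr mcompNr uE aE 2!mcompA cE -!mcompA maddNr.
rewrite -(msubK u (c *d a')); apply: factors_add; last by exists E', a', c.
rewrite vE; have [l ->] := cX _ _ _ _ co v; rewrite sum_compl.
elim: l => [|i l IH]; first by rewrite big_nil; apply: factors0.
rewrite big_cons; apply: factors_add => //; rewrite mcompA.
by exists (cell_sph (tag i)), (tagged i), (mm (attach Y) *d mm (bin (@cell_sph k U Y) (tag i))).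
Qed.

(** The map from [X] to stage [N] is zero and so factors through [P]. Descending to stage 0, the
    identity of [X] factors through [P], and [X] is a retract. *)
Lemma building_all X : cpt X -> P X.
Proof.
move=> cX; have [f [f0 fS [N fN]]] := tower_maps U_replete cX.
suff [E [a [b [pE e]]]] : factors (m1 X) by apply: building_retract1 pE; exact: esym e.
have -> : m1 X = f 0%N by rewrite f0.
have {}fN : factors (f N) by rewrite fN; apply: factors0.
elim: N fN => // N IH fN; apply: IH; apply: factors_step => //.
by rewrite fS in fN.
Qed.
End Closure.

(** Intersecting [P] with the compact objects supplies the hypothesis [P_cpt] without assuming it of
    [P]. *)
Lemma compact_ind (P : complex k U -> Prop) : building P -> forall X, cpt X -> P X.
Proof.
move=> bP X cX.
by have [] := building_all (building_and bP building_cpt) (fun X => @proj2 _ _) cX.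
Qed.
End Principle.

(** * Tensor products *)

Arguments tens : simpl never.

Section TensorOps.
Variables (k : fieldType) (U : group_family).
Implicit Types (X Y Z W A B : complex k U) (G : member U).

Definition tensl X Y G (n p q : int) (e : p + q = n) (y : Y q G) :
  {linear X p G -> tens_ob X Y G n} := mk_linear (@tens_linear_l k U X Y G n p q e y).
Definition tensr X Y G (n p q : int) (e : p + q = n) (x : X p G) :
  {linear Y q G -> tens_ob X Y G n} := mk_linear (@tens_linear_r k U X Y G n p q e x).

Section Laws.
Variables (X Y : complex k U) (G : member U) (n p q : int) (e : p + q = n).
Implicit Types (x : X p G) (y : Y q G).
Lemma tens0l y : tens e (0 : X p G) y = 0 :> tens_ob X Y G n.
Proof. exact: (linear0 (tensl X e y)). Qed.
Lemma tens0r x : tens e x (0 : Y q G) = 0 :> tens_ob X Y G n.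
Proof. exact: (linear0 (tensr Y e x)). Qed.
Lemma tensDl x x' y : tens e (x + x') y = tens e x y + tens e x' y :> tens_ob X Y G n.
Proof. exact: (linearD (tensl X e y)). Qed.
Lemma tensDr x y y' : tens e x (y + y') = tens e x y + tens e x y' :> tens_ob X Y G n.
Proof. exact: (linearD (tensr Y e x)). Qed.
Lemma tensNl x y : tens e (- x) y = - tens e x y :> tens_ob X Y G n.
Proof. exact: (linearN (tensl X e y)). Qed.
Lemma tensZl a x y : tens e (a *: x) y = a *: tens e x y :> tens_ob X Y G n.
Proof. exact: (linearZ_LR (tensl X e y)). Qed.
Lemma tensZr a x y : tens e x (a *: y) = a *: tens e x y :> tens_ob X Y G n.
Proof. exact: (linearZ_LR (tensr Y e x)). Qed.
End Laws.

Lemma tens_irr X Y G (n p q : int) (e e' : p + q = n) (x : X p G) (y : Y q G) :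
  tens e x y = tens e' x y :> tens_ob X Y G n.
Proof. by rewrite (Prop_irrelevance e e'). Qed.

Lemma tens_ctl X Y G (n p p' q : int) (d : p = p') (e : p + q = n) (e' : p' + q = n)
    (x : X p G) (y : Y q G) :
  tens e' (ct X d G x) y = tens e x y :> tens_ob X Y G n.
Proof. by subst p'; apply: tens_irr. Qed.

Lemma tensor_dE X Y G (n p q : int) (e : p + q = n) (x : X p G) (y : Y q G) :
  diff (tensor X Y) n G (tens e x y) = tens (deg_l e) (diff X p G x) y
    + (-1) ^ p *: tens (deg_r e) x (diff Y q G y).
Proof. exact: tens_dE. Qed.

Lemma tensor_resE X Y (H G : member U) (f : epi H G) (n p q : int) (e : p + q = n)
   (x : X p G) (y : Y q G) : res (tensor X Y n) f (tens e x y)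
   = tens e (res (X p) f x) (res (Y q) f y) :> tens_ob X Y H n.
Proof. exact: tens_resE. Qed.

Section TensorMap.
Variables (X X' W : complex k U) (f : chain_map X X').

Fact tmap_l n G (p q : int) (e : p + q = n) (w : W q G) :
  linear (fun x => tens e (f p G x) w : tens_ob X' W G n).
Proof. by move=> a x y; rewrite linearP tensDl tensZl. Qed.
Fact tmap_r n G (p q : int) (e : p + q = n) (x : X p G) :
  linear (fun w : W q G => tens e (f p G x) w : tens_ob X' W G n).
Proof. by move=> a v w; rewrite tensDr tensZr. Qed.
Definition tmap_fun n G : {linear tens_ob X W G n -> tens_ob X' W G n} :=
  tens_lift (@tmap_l n G) (@tmap_r n G).
Lemma tmap_funE n G (p q : int) (e : p + q = n) (x : X p G) (w : W q G) :
  tmap_fun n G (tens e x w) = tens e (f p G x) w.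
Proof. exact: tens_liftE. Qed.

Fact tmap_natural n (H G : member U) (g : epi H G) (z : tensor X W n G) :
  tmap_fun n H (res (tensor X W n) g z) = res (tensor X' W n) g (tmap_fun n G z).
Proof.
apply: (@tens_ext _ _ _ _ _ _ _ (tmap_fun n H \o res (tensor X W n) g)
  (res (tensor X' W n) g \o tmap_fun n G)) => p q e x w.
rewrite -[LHS]/(tmap_fun n H (res (tensor X W n) g (tens e x w))).
rewrite -[RHS]/(res (tensor X' W n) g (tmap_fun n G (tens e x w))).
by rewrite tensor_resE !tmap_funE tensor_resE nt_natural.
Qed.
Definition tmap_nt n : nat_trans (tensor X W n) (tensor X' W n) :=
  @NatTrans k U (tensor X W n) (tensor X' W n) (tmap_fun n) (@tmap_natural n).

Fact tmap_d n G (z : tensor X W n G) :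
  tmap_nt (n - 1) G (diff (tensor X W) n G z) = diff (tensor X' W) n G (tmap_nt n G z).
Proof.
apply: (@tens_ext _ _ _ _ _ _ _ (tmap_fun (n - 1) G \o diff (tensor X W) n G)
  (diff (tensor X' W) n G \o tmap_fun n G)) => p q e x w.
rewrite -[LHS]/(tmap_fun (n - 1) G (diff (tensor X W) n G (tens e x w))).
rewrite -[RHS]/(diff (tensor X' W) n G (tmap_fun n G (tens e x w))).
by rewrite tensor_dE linearD linearZ_LR !tmap_funE tensor_dE cm_d.
Qed.
Definition tmap : chain_map (tensor X W) (tensor X' W) :=
  @ChainMap k U (tensor X W) (tensor X' W) tmap_nt tmap_d.
Lemma tmapE n G (p q : int) (e : p + q = n) (x : X p G) (w : W q G) :
  tmap n G (tens e x w) = tens e (f p G x) w.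
Proof. exact: tmap_funE. Qed.
End TensorMap.

Section Contraction.
Variables (X W : complex k U) (G : member U).
Variable kap : forall m, {linear X (m - 1) G -> X m G}.
Hypothesis kapP : forall m x,
  diff X m G (kap m x) + kap (m - 1) (diff X (m - 1) G x) = x.

Fact tcon_deg (n p q : int) (e : p + q = n - 1) : p + 1 + q = n.
Proof. by rewrite addrAC e subrK. Qed.
Fact tcon_pred (p : int) : p = p + 1 - 1. Proof. by rewrite addrK. Qed.

Fact tcon_l n (p q : int) (e : p + q = n - 1) (w : W q G) :
  linear (fun x => tens (tcon_deg e) (kap (p + 1) (ct X (tcon_pred p) G x)) w : tens_ob X W G n).
Proof. by move=> a x y; rewrite !linearP tensDl tensZl. Qed.
Fact tcon_r n (p q : int) (e : p + q = n - 1) (x : X p G) :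
  linear (fun w : W q G => tens (tcon_deg e) (kap (p + 1) (ct X (tcon_pred p) G x)) w : tens_ob X W G n).
Proof. by move=> a v w; rewrite tensDr tensZr. Qed.
Definition tcon n : {linear tens_ob X W G (n - 1) -> tens_ob X W G n} :=
  tens_lift (@tcon_l n) (@tcon_r n).

Lemma kap_ct p p' (d : p = p') (d' : p - 1 = p' - 1) x :
  kap p' (ct X d' G x) = ct X d G (kap p x).
Proof. by subst p'; rewrite ct_id. Qed.

Lemma tconE n (p q : int) (e : p - 1 + q = n - 1) (e' : p + q = n) (x : X (p - 1) G) (w : W q G) :
  tcon n (tens e x w) = tens e' (kap p x) w.
Proof.
apply: etrans (tens_liftE _ _ _ _ _) _.
have d : p = p - 1 + 1 by rewrite subrK.
by rewrite (kap_ct d); apply: tens_ctl.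
Qed.

Lemma tcon_homotopy n (z : tensor X W (n - 1) G) :
  diff (tensor X W) n G (tcon n z) + tcon (n - 1) (diff (tensor X W) (n - 1) G z) = z.
Proof.
apply: (@tens_ext _ _ _ _ _ _ _ ((diff (tensor X W) n G \o tcon n) \+
  (tcon (n - 1) \o diff (tensor X W) (n - 1) G)) idfun) => p q e x w.
rewrite -[LHS]/(diff (tensor X W) n G (tcon n (tens e x w)) +
  tcon (n - 1) (diff (tensor X W) (n - 1) G (tens e x w))) -[RHS]/(tens e x w).
elim/int_pred_ind: p => p in e x *.
have e' : p + q = n by apply: (addIr (-1)); rewrite addrAC.
rewrite tensor_dE linearD linearZ_LR (tconE _ e) (tconE _ (deg_r e')) (tconE _ e').
rewrite tensor_dE signz_pred scaleNr.
set s := (-1) ^ p *: _; rewrite -addrA (addrCA s) subrr (addr0 (tens _ _ _)).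
rewrite (tens_irr (deg_l e') e) -tensDl kapP //.
Qed.
End Contraction.

Lemma tensor_homology_zero X W G : homology_zero X G -> homology_zero (tensor X W) G.
Proof.
move=> /acyclic_contraction[kap kapP]; apply/homology_zeroP.
elim/int_pred_ind => n z cz; apply/bdP; exists (tcon W kap n z).
by rewrite -[RHS](tcon_homotopy kapP) cz linear0 addr0.
Qed.

End TensorOps.

Section TensorCone.
Variables (k : fieldType) (U : group_family) (X Y W : complex k U) (f : chain_map X Y).

Notation T := (tmap W f).

Definition tcone_phi n G (p q : int) (e : p + q = n) (u : cone f p G) (w : W q G) :
  cone T n G := (tens (deg_l e) u.1 w, tens e u.2 w).
Fact tcone_l n G (p q : int) (e : p + q = n) (w : W q G) : linear (fun u => tcone_phi e u w : cone T n G).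
Proof. by move=> a u v; congr pair; rewrite /= tensDl tensZl. Qed.
Fact tcone_r n G (p q : int) (e : p + q = n) (u : cone f p G) :
  linear (fun w : W q G => tcone_phi e u w : cone T n G).
Proof. by move=> a v w; congr pair; rewrite /= tensDr tensZr. Qed.
Definition tcone_fun n G : {linear tens_ob (cone f) W G n -> cone T n G} :=
  tens_lift (@tcone_l n G) (@tcone_r n G).
Lemma tcone_funE n G (p q : int) (e : p + q = n) (u : cone f p G) (w : W q G) :
  tcone_fun n G (tens e u w) = (tens (deg_l e) u.1 w, tens e u.2 w).
Proof. exact: tens_liftE. Qed.

Fact tcone_natural n (H G : member U) (g : epi H G) (z : tensor (cone f) W n G) :
  tcone_fun n H (res (tensor (cone f) W n) g z) = res (cone T n) g (tcone_fun n G z).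
Proof.
apply: (@tens_ext _ _ _ _ _ _ _ (tcone_fun n H \o res (tensor (cone f) W n) g)
  (res (cone T n) g \o tcone_fun n G)) => p q e u w.
rewrite -[LHS]/(tcone_fun n H (res (tensor (cone f) W n) g (tens e u w))).
rewrite -[RHS]/(res (cone T n) g (tcone_fun n G (tens e u w))).
rewrite tensor_resE !tcone_funE; congr pair; exact/esym/tensor_resE.
Qed.
Definition tcone_nt n : nat_trans (tensor (cone f) W n) (cone T n) :=
  @NatTrans k U (tensor (cone f) W n) (cone T n) (tcone_fun n) (@tcone_natural n).

Fact tcone_d n G (z : tensor (cone f) W n G) :
  tcone_nt (n - 1) G (diff (tensor (cone f) W) n G z) = diff (cone T) n G (tcone_nt n G z).
Proof.
apply: (@tens_ext _ _ _ _ _ _ _ (tcone_fun (n - 1) G \o diff (tensor (cone f) W) n G)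
  (diff (cone T) n G \o tcone_fun n G)) => p q e u w.
rewrite -[LHS]/(tcone_fun (n - 1) G (diff (tensor (cone f) W) n G (tens e u w))).
rewrite -[RHS]/(diff (cone T) n G (tcone_fun n G (tens e u w))).
rewrite tensor_dE linearD linearZ_LR !tcone_funE.
rewrite -[RHS]/(- diff (tensor X W) (n - 1) G (tens (deg_l e) u.1 w),
  T (n - 1) G (tens (deg_l e) u.1 w) + diff (tensor Y W) n G (tens e u.2 w)).
rewrite !tensor_dE tmapE.
rewrite -[LHS]/(tens (deg_l (deg_l e)) (- diff X (p - 1) G u.1) w
    + (-1) ^ p *: tens (deg_l (deg_r e)) u.1 (diff W q G w),
  tens (deg_l e) (f (p - 1) G u.1 + diff Y p G u.2) w
    + (-1) ^ p *: tens (deg_r e) u.2 (diff W q G w)).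
congr pair; last by rewrite tensDl -addrA.
rewrite signz_pred scaleNr tensNl [RHS]opprD opprK.
by rewrite (tens_irr (deg_r (deg_l e)) (deg_l (deg_r e))).
Qed.
Definition tcone : chain_map (tensor (cone f) W) (cone T) :=
  @ChainMap k U (tensor (cone f) W) (cone T) tcone_nt tcone_d.

Definition tcone_inv1_phi n G (p q : int) (e : p + q = n - 1) (x : X p G) (w : W q G) :
  tens_ob (cone f) W G n :=
  tens (tcon_deg e) ((ct X (tcon_pred p) G x, 0) : cone f (p + 1) G) w.
Lemma cone_pairD n G a (x x' : X (n - 1) G) (y y' : Y n G) :
  ((a *: x + x', a *: y + y') : cone f n G) = a *: ((x, y) : cone f n G) + ((x', y') : cone f n G).
Proof. by []. Qed.
Fact tcone_inv1_l n G (p q : int) (e : p + q = n - 1) (w : W q G) :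
  linear (fun x => @tcone_inv1_phi n G p q e x w).
Proof.
move=> a x y; rewrite /tcone_inv1_phi linearP -tensZl -tensDl -cone_pairD.
by rewrite scaler0 addr0.
Qed.
Fact tcone_inv1_r n G (p q : int) (e : p + q = n - 1) (x : X p G) :
  linear (@tcone_inv1_phi n G p q e x).
Proof. by move=> a v w; rewrite /tcone_inv1_phi tensDr tensZr. Qed.
Definition tcone_inv1 n G : {linear tens_ob X W G (n - 1) -> tens_ob (cone f) W G n} :=
  tens_lift (@tcone_inv1_l n G) (@tcone_inv1_r n G).
Definition tcone_inv n G (z : cone T n G) : tensor (cone f) W n G :=
  tcone_inv1 n G z.1 + tmap W (cone_in f) n G z.2.

Lemma ct_cone p p' (d : p = p') (d' : p - 1 = p' - 1) G (x : X (p - 1) G) (y : Y p G) :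
  ct (cone f) d G ((x, y) : cone f p G) = ((ct X d' G x, ct Y d G y) : cone f p' G).
Proof. by subst p'; rewrite (eq_irrelevance d' erefl). Qed.

Lemma tcone_inv1E n G (p q : int) (e : p + q = n) (x : X (p - 1) G) (w : W q G) :
  tcone_inv1 n G (tens (deg_l e) x w) = tens e ((x, 0) : cone f p G) w.
Proof.
apply: etrans (tens_liftE _ _ _ _ _) _; rewrite /tcone_inv1_phi.
have d : p = p - 1 + 1 by rewrite subrK.
rewrite -(linear0 (ct Y d G)) -(ct_cone d); exact: tens_ctl.
Qed.

Lemma tcone_invK n G z : tcone_inv (tcone n G z) = z.
Proof.
pose A : {linear cone T n G -> tensor X W (n - 1) G} := mk_linear (@cone_out_linear _ _ _ _ T n G).
pose B := nt_snd (tensor X W (n - 1)) (tensor Y W n) G.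
apply: (@tens_ext _ _ _ _ _ _ _ ((tcone_inv1 n G \o (A \o tcone_fun n G)) \+
   (tmap W (cone_in f) n G \o (B \o tcone_fun n G))) idfun) => p q e u w.
rewrite -[LHS]/(tcone_inv1 n G (tcone_fun n G (tens e u w)).1 +
  tmap W (cone_in f) n G (tcone_fun n G (tens e u w)).2) tcone_funE.
rewrite -[LHS]/(tcone_inv1 n G (tens (deg_l e) u.1 w) + tmap W (cone_in f) n G (tens e u.2 w)).
rewrite tcone_inv1E tmapE -tensDl; case: u => x y; congr tens.
by congr pair; [exact: addr0|exact: add0r].
Qed.

Lemma tcone_K n G z : tcone n G (tcone_inv z) = z.
Proof.
rewrite /tcone_inv linearD; case: z => s t.
have -> : tcone n G (tcone_inv1 n G s) = (s, 0) :> cone T n G.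
  apply: (@tens_ext _ _ _ _ _ _ _ (tcone_fun n G \o tcone_inv1 n G)
    (nt_inl (tensor X W (n - 1)) (tensor Y W n) G)) => p q e x w.
  rewrite -[LHS]/(tcone_fun n G (tcone_inv1 n G (tens e x w))).
  rewrite -[RHS]/((tens e x w, 0) : cone T n G).
  have -> : tcone_inv1 n G (tens e x w) = tcone_inv1_phi e x w by apply: tens_liftE.
  rewrite tcone_funE; congr pair; last exact: tens0l.
  exact: tens_ctl.
have -> : tcone n G (tmap W (cone_in f) n G t) = (0, t) :> cone T n G.
  apply: (@tens_ext _ _ _ _ _ _ _ (tcone_fun n G \o tmap W (cone_in f) n G)
    (cone_in T n G)) => p q e y w.
  rewrite -[LHS]/(tcone_fun n G (tmap W (cone_in f) n G (tens e y w))) tmapE tcone_funE.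
  by congr pair; exact: tens0l.
by congr pair; [exact: addr0|exact: add0r].
Qed.

Lemma tcone_qi : quasi_iso tcone.
Proof. exact: (bij_qi tcone_invK tcone_K). Qed.
End TensorCone.

Section TensorFunctor.
Variables (k : fieldType) (U : group_family) (W : complex k U).

Lemma tmap_qi X Y (f : chain_map X Y) : quasi_iso f -> quasi_iso (tmap W f).
Proof.
move=> /quasi_iso_cone hf; apply/quasi_iso_cone/acyclicP => G n z cz.
have [i s] := proj1 (quasi_isoP _) (tcone_qi W f) G n; have [z' cz' e] := s z cz.
apply: (bd_subl e); apply: cm_bd.
have /homology_zeroP h := tensor_homology_zero (W := W) (hf G); exact: h.
Qed.

Definition tensF : cfun k U U.
Proof.
exists (fun X => tensor X W) (fun X Y f => tmap W f).
- move=> X Y f g fg n G; apply: tens_ext => p q e x w.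
  rewrite -[LHS]/(tmap W f n G (tens e x w)) -[RHS]/(tmap W g n G (tens e x w)).
  by rewrite !tmapE fg.
- move=> X n G x; apply: (@tens_ext _ _ _ _ _ _ _ (tmap W (chain_id X) n G) idfun) => p q e {}x w.
  exact: tmapE.
- move=> X Y Z g f n G x.
  apply: (@tens_ext _ _ _ _ _ _ _ (tmap W (chain_comp g f) n G) (tmap W g n G \o tmap W f n G)) => p q e {}x w.
  rewrite -[RHS]/(tmap W g n G (tmap W f n G (tens e x w))).
  by rewrite -[LHS]/(tmap W (chain_comp g f) n G (tens e x w)) !tmapE.
- move=> X Y f g n G x.
  apply: (@tens_ext _ _ _ _ _ _ _ (tmap W (chain_add f g) n G) (tmap W f n G \+ tmap W g n G)) => p q e {}x w.
  rewrite -[RHS]/(tmap W f n G (tens e x w) + tmap W g n G (tens e x w)).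
  rewrite -[LHS]/(tmap W (chain_add f g) n G (tens e x w)) !tmapE; exact: tensDl.
- exact: tmap_qi.
Defined.
End TensorFunctor.

Section Swap.
Variables (k : fieldType) (U : group_family).

Lemma signz_swap (n : int) : (-1) ^ n = ((-1) ^ n)^-1 :> k.
Proof.
have nz : (-1 : k) ^ n != 0 by rewrite expfz_neq0 // oppr_eq0 oner_eq0.
by apply: (mulfI nz); rewrite signz_mul divff.
Qed.

Section Map.
Variables (X W : complex k U).
Fact swap_deg (n p q : int) (e : p + q = n) : q + p = n. Proof. by rewrite addrC. Qed.
Fact swap_l n G (p q : int) (e : p + q = n) (w : W q G) :
  linear (fun x : X p G => (-1) ^ (p * q) *: (tens (swap_deg e) w x : tens_ob W X G n)).
Proof. by move=> a x y; rewrite tensDr tensZr scalerDr !scalerA mulrC. Qed.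
Fact swap_r n G (p q : int) (e : p + q = n) (x : X p G) :
  linear (fun w : W q G => (-1) ^ (p * q) *: (tens (swap_deg e) w x : tens_ob W X G n)).
Proof. by move=> a v w; rewrite tensDl tensZl scalerDr !scalerA mulrC. Qed.
Definition swap_fun n G : {linear tens_ob X W G n -> tens_ob W X G n} :=
  tens_lift (@swap_l n G) (@swap_r n G).
Lemma swap_funE n G (p q : int) (e : p + q = n) (e' : q + p = n) (x : X p G) (w : W q G) :
  swap_fun n G (tens e x w) = (-1) ^ (p * q) *: tens e' w x.
Proof. by apply: etrans (tens_liftE _ _ _ _ _) _; rewrite (tens_irr _ e'). Qed.

Fact swap_natural n (H G : member U) (g : epi H G) (z : tensor X W n G) :
  swap_fun n H (res (tensor X W n) g z) = res (tensor W X n) g (swap_fun n G z).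
Proof.
apply: (@tens_ext _ _ _ _ _ _ _ (swap_fun n H \o res (tensor X W n) g)
  (res (tensor W X n) g \o swap_fun n G)) => p q e x w.
rewrite -[LHS]/(swap_fun n H (res (tensor X W n) g (tens e x w))).
rewrite -[RHS]/(res (tensor W X n) g (swap_fun n G (tens e x w))).
by rewrite tensor_resE !(swap_funE _ (swap_deg e)) linearZ_LR tensor_resE.
Qed.
Definition swap_nt n : nat_trans (tensor X W n) (tensor W X n) :=
  @NatTrans k U (tensor X W n) (tensor W X n) (swap_fun n) (@swap_natural n).

Fact swap_d n G (z : tensor X W n G) :
  swap_nt (n - 1) G (diff (tensor X W) n G z) = diff (tensor W X) n G (swap_nt n G z).
Proof.
apply: (@tens_ext _ _ _ _ _ _ _ (swap_fun (n - 1) G \o diff (tensor X W) n G)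
  (diff (tensor W X) n G \o swap_fun n G)) => p q e x w.
rewrite -[LHS]/(swap_fun (n - 1) G (diff (tensor X W) n G (tens e x w))).
rewrite -[RHS]/(diff (tensor W X) n G (swap_fun n G (tens e x w))).
rewrite tensor_dE linearD linearZ_LR (swap_funE _ (deg_r (swap_deg e))).
rewrite (swap_funE _ (deg_l (swap_deg e))) (swap_funE _ (swap_deg e)).
rewrite [RHS](linearZ_LR (diff (tensor W X) n G)) tensor_dE scalerDr !scalerA [RHS]addrC.
have nz : (-1 : k) != 0 by rewrite oppr_eq0 oner_eq0.
congr (_ *: _ + _ *: _); rewrite -?expfzDr //.
  by rewrite mulrBl mul1r !expfzDr // [(-1) ^ q]signz_swap invr_expz.
rewrite mulrBr mulr1 addrCA subrr; congr (_ ^ _); exact: addr0.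
Qed.
Definition swap : chain_map (tensor X W) (tensor W X) :=
  @ChainMap k U (tensor X W) (tensor W X) swap_nt swap_d.
Lemma swapE n G (p q : int) (e : p + q = n) (e' : q + p = n) (x : X p G) (w : W q G) :
  swap n G (tens e x w) = (-1) ^ (p * q) *: tens e' w x.
Proof. exact: swap_funE. Qed.
End Map.

Lemma swapK X W n G z : swap W X n G (swap X W n G z) = z.
Proof.
apply: (@tens_ext _ _ _ _ _ _ _ (swap W X n G \o swap X W n G) idfun) => p q e x w.
rewrite -[LHS]/(swap W X n G (swap X W n G (tens e x w))).
rewrite (swapE e (swap_deg e)) [LHS](linearZ_LR (swap W X n G)) (swapE (swap_deg e) e) scalerA.
by rewrite [q * p]mulrC signz_mul scale1r.
Qed.

Lemma swap_qi X W : quasi_iso (swap X W).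
Proof. exact: (bij_qi (@swapK X W) (@swapK W X)). Qed.
End Swap.

Lemma cpt_finretract (k : fieldType) (U : group_family) (X : complex k U) (J : finType)
    (E : J -> complex k U) (i : forall j, mor X (E j)) (r : forall j, mor (E j) X) :
  \big[@madd k U X X/m0]_j (r j *d i j) = m1 X -> (forall j, cpt (E j)) -> cpt X.
Proof.
move=> e cE I Y S inj co h; rewrite -[h]mcomp1r -e sum_compl.
elim/big_rec: _ => [|j g _ IH]; first exact: fin_sum0.
apply: fin_sumD IH; rewrite mcompA; apply: fin_sum_comp; exact: cE.
Qed.

Lemma free_ind (k : fieldType) (S : Type) (P : freemod k S -> Prop) :
  (forall x, P (fgen k x)) -> P 0 -> (forall x y, P x -> P y -> P (x + y)) ->
  (forall a x, P x -> P (a *: x)) -> forall x, P x.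
Proof. exact: (@pres_ind k S (@free_rel k S) P). Qed.

Section ConjEpi.
Variables (T G : finGroupType) (f : epi T G) (a : G).
Fact conj_epi_morph : {morph (fun x => f x ^ a)%g : x y / (x * y)%g}.
Proof. by move=> x y; rewrite epiM conjMg. Qed.
Fact conj_epi_surj y : exists x, (f x ^ a)%g = y.
Proof. by have [x e] := epi_surj f (y ^ a^-1)%g; exists x; rewrite e conjgKV. Qed.
Definition conj_epi : epi T G := mk_epi conj_epi_morph conj_epi_surj.
Lemma conj_epiE x : conj_epi x = (f x ^ a)%g. Proof. by []. Qed.
Lemma conj_epi_conj : epi_conj conj_epi f.
Proof. by apply: epi_conj_sym; exists a. Qed.
End ConjEpi.

Section Corestriction.
Variables (T G H : finGroupType) (K : {group (G * H)%type}).

Section Def.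
Variables (f : epi T G) (g : epi T H).
Hypothesis fgK : epi_pair_image f g = K :> {set _}.
Fact cores_in x : (f x, g x) \in K.
Proof. by rewrite -fgK; apply/imsetP; exists x. Qed.
Definition cores_fun x : subg_of K := Subg (cores_in x).
Fact cores_morph : {morph cores_fun : x y / (x * y)%g}.
Proof. by move=> x y; apply: val_inj; rewrite /= !epiM. Qed.
Fact cores_surj y : exists x, cores_fun x = y.
Proof.
have : val y \in epi_pair_image f g by rewrite fgK; apply: valP.
by case/imsetP => x _ e; exists x; apply: val_inj.
Qed.
Definition cores : epi T (subg_of K) := mk_epi cores_morph cores_surj.
End Def.

Hypothesis K1 : forall x, exists y, (x, y) \in K.
Hypothesis K2 : forall y, exists x, (x, y) \in K.
Definition wide1_fun (u : subg_of K) : G := (val u).1.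
Fact wide1_morph : {morph wide1_fun : x y / (x * y)%g}. Proof. by []. Qed.
Fact wide1_surj y : exists x, wide1_fun x = y.
Proof. by have [z h] := K1 y; exists (Subg h). Qed.
Definition wide1 : epi (subg_of K) G := mk_epi wide1_morph wide1_surj.
Definition wide2_fun (u : subg_of K) : H := (val u).2.
Fact wide2_morph : {morph wide2_fun : x y / (x * y)%g}. Proof. by []. Qed.
Fact wide2_surj y : exists x, wide2_fun x = y.
Proof. by have [z h] := K2 y; exists (Subg h). Qed.
Definition wide2 : epi (subg_of K) H := mk_epi wide2_morph wide2_surj.
End Corestriction.

Section ChainSum.
Variables (k : fieldType) (U : group_family) (X Y : complex k U) (J : Type).
Variables (s : seq J) (f : J -> chain_map X Y).
Definition chain_sum := \big[@chain_add k U X Y/@chain_zero k U X Y]_(j <- s) f j.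
Lemma mm_chain_sum : mm chain_sum = \big[@madd k U X Y/m0]_(j <- s) mm (f j).
Proof. exact: (big_morph (@mm k U X Y) (@mmD _ _ _ _) (@mm0 _ _ _ _)). Qed.
Lemma chain_sumE n G x : chain_sum n G x = \sum_(j <- s) f j n G x.
Proof. exact: (big_morph (fun h : chain_map X Y => h n G x) (fun _ _ => erefl) erefl). Qed.
End ChainSum.

Lemma sph_map_gen (k : fieldType) (U : group_family) n (G : member U) (Z : complex k U)
    (z : Z n G) (cz : cyc z) l (T : member U) (d : l = n) (c : ecls T G) :
  sph_map cz l T (fgen k (d, c)) = res (Z l) (erep c) (ct Z (esym d) G z).
Proof. exact: fliftE. Qed.

Lemma res_sph_u (k : fieldType) (U : group_family) n (G T : member U) (f : epi T G) :
  res (sph k n G n) f (sph_u k n G) = fgen k (erefl, ecl f).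
Proof.
rewrite [LHS]sph_resE; congr (fgen k (_, _)); apply/ecl_eq.
apply: epi_conj_trans (epi_conj_comp (epi_conj_sym (erep_ecl _)) (epi_conj_refl _)) _.
exact: epi_conj_ext.
Qed.

(** * The tensor product of two generators *)

Section SphereTensor.
Variables (k : fieldType) (U : group_family).
Hypothesis char_k : [pchar k]%R =i pred0.
Hypothesis U_replete : replete U.
Hypothesis U_wide : widely_closed U.
Variables (n m : int) (G H : member U).

Definition wide_pred (K : {group (G * H)%type}) : bool :=
  `[< [/\ U (subg_of K), forall x, exists y, (x, y) \in K
       & forall y, exists x, (x, y) \in K] >].
Definition wide_idx := {K : {group (G * H)%type} | wide_pred K}.
Lemma wideP (K : wide_idx) : [/\ U (subg_of (val K)), forall x, exists y, (x, y) \in val K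
       & forall y, exists x, (x, y) \in val K].
Proof. exact/asboolP/(valP K). Qed.
Definition wide_member (K : wide_idx) : member U :=
  Member (let: And3 h _ _ := wideP K in h).
Definition wpr1 (K : wide_idx) : epi (wide_member K) G :=
  wide1 (let: And3 _ h _ := wideP K in h).
Definition wpr2 (K : wide_idx) : epi (wide_member K) H :=
  wide2 (let: And3 _ _ h := wideP K in h).

Definition image_idx_wide (T : member U) (f : epi T G) (g : epi T H) :
  wide_pred (epi_pair_image f g).
Proof.
apply/asboolP; split.
- exact: (U_wide f g (memberP G) (memberP T) (memberP H)).
- move=> y; have [x <-] := epi_surj f y; exists (g x); apply/imsetP; by exists x.
- move=> y; have [x <-] := epi_surj g y; exists (f x); apply/imsetP; by exists x.
Qed.
Definition image_idx (T : member U) (f : epi T G) (g : epi T H) : wide_idx :=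
  exist _ (epi_pair_image f g) (image_idx_wide f g).

Notation A := (tensor (sph k n G) (sph k m H)).
Notation S K := (sph k (n + m) (wide_member K)).

Section Avg.
Variable K : wide_idx.

(** A pair [(f, g)] is an epimorphism onto its image, and it counts for [K] only if this image is
    [K] itself. The test depends on the representatives [f] and [g], whence the sum over all
    conjugates in [avg]. *)
Definition pair_gen l (T : member U) (d : l = n + m) (f : epi T G) (g : epi T H) : S K l T :=
  match pselect (epi_pair_image f g = val K :> {set _}) with
  | left h => fgen k (d, ecl (cores h))
  | right _ => 0
  end.

Lemma pair_gen_ext l T (d : l = n + m) (f f' : epi (member_group T) G)
  (g g' : epi (member_group T) H) : f =1 f' -> g =1 g' -> pair_gen d f g = pair_gen d f' g'.
Proof.
move=> ff gg; have e : epi_pair_image f g = epi_pair_image f' g' :> {set _}.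
  by apply: eq_imset => x; rewrite ff gg.
rewrite /pair_gen; case: pselect => h; case: pselect => h' //.
- congr (fgen k (_, _)); apply/ecl_eq/epi_conj_ext => x.
  by apply: val_inj; rewrite /= ff gg.
- by case: h'; rewrite -e.
- by case: h; rewrite e.
Qed.

Lemma pair_gen_res l (T' T : member U) (e : epi T' T) (d : l = n + m) (f : epi T G) (g : epi T H) :
  res (S K l) e (pair_gen d f g) = pair_gen d (comp_epi f e) (comp_epi g e).
Proof.
have i : epi_pair_image (comp_epi f e) (comp_epi g e) = epi_pair_image f g :> {set _}.
  apply/setP => u; apply/imsetP/imsetP => -[x _ ->]; first by exists (e x).
  by have [y <-] := epi_surj e x; exists y.
rewrite /pair_gen; case: pselect => h; case: pselect => h'; rewrite ?linear0 //.
- rewrite [LHS]sph_resE; congr (fgen k (_, _)); apply/ecl_eq.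
  apply: epi_conj_trans (epi_conj_comp (epi_conj_sym (erep_ecl _)) (epi_conj_refl _)) _.
  by apply: epi_conj_ext => x; apply: val_inj.
- by case: h'; rewrite i.
- by case: h; rewrite -i.
Qed.

(* The sum over [G * H] does not depend on the representatives of the classes of
   [f] and [g]; characteristic zero is needed to divide by its length. *)
Definition avg l (T : member U) (d : l = n + m) (f : epi T G) (g : epi T H) : S K l T :=
  \sum_(ab : G * H) pair_gen d (conj_epi f ab.1) (conj_epi g ab.2).

Lemma avg_conj l T (d : l = n + m) (f f' : epi (member_group T) G)
  (g g' : epi (member_group T) H) :
  epi_conj f f' -> epi_conj g g' -> avg d f g = avg d f' g'.
Proof.
move=> [a fa] [b gb]; rewrite /avg.
rewrite (reindex_inj (h := fun ab : G * H => (a * ab.1, b * ab.2)%g)); last first.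
  by move=> [x y] [x' y'] [/mulgI -> /mulgI ->].
by apply: eq_bigr => -[x y] _; apply: pair_gen_ext => t; rewrite !conj_epiE /= conjgM ?fa ?gb.
Qed.

Lemma avg_res l (T' T : member U) (e : epi T' T) (d : l = n + m) (f : epi T G) (g : epi T H) :
  res (S K l) e (avg d f g) = avg d (comp_epi f e) (comp_epi g e).
Proof.
rewrite linear_sum; apply: eq_bigr => ab _; rewrite pair_gen_res.
exact: pair_gen_ext.
Qed.

Fact avg_deg (l p q : int) (e : p + q = l) (e1 : p = n) (e2 : q = m) : l = n + m.
Proof. by rewrite -e e1 e2. Qed.

Definition avg_phi l T (p q : int) (e : p + q = l) (x : sph k n G p T) (y : sph k m H q T) :
    S K l T :=
  flift (fun c : sph_idx n G p T => flift (fun c' : sph_idx m H q T =>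
    avg (avg_deg e c.1 c'.1) (erep c.2) (erep c'.2)) y) x.
Fact avg_l l T (p q : int) (e : p + q = l) y : linear (fun x => @avg_phi l T p q e x y).
Proof. by move=> a x x'; rewrite /avg_phi linearP. Qed.
Fact avg_r l T (p q : int) (e : p + q = l) x : linear (@avg_phi l T p q e x).
Proof.
move=> a y y'; rewrite /avg_phi; elim/free_ind: x => [c||x x' IH IH'|b x IH].
- by rewrite !fliftE linearP.
- by rewrite !linear0 ?scaler0 addr0.
- by rewrite ![flift _ (x + x')]linearD IH IH' scalerDr addrACA.
- by rewrite ![flift _ (b *: x)]linearZ_LR IH scalerDr !scalerA mulrC.
Qed.
Definition avg_fun l T : {linear tens_ob (sph k n G) (sph k m H) T l -> S K l T} :=
  tens_lift (@avg_l l T) (@avg_r l T).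
Lemma avg_funE l T (p q : int) (e : p + q = l) c c' :
  avg_fun l T (tens e (fgen k c : sph k n G p T) (fgen k c' : sph k m H q T))
  = avg (avg_deg e c.1 c'.1) (erep c.2) (erep c'.2).
Proof. by apply: etrans (tens_liftE _ _ _ _ _) _; rewrite /avg_phi !fliftE. Qed.
End Avg.

Lemma sph_tens_ext l T (M : lmodType k) (f g : {linear tens_ob (sph k n G) (sph k m H) T l -> M}) :
  (forall (p q : int) (e : p + q = l) c c',
    f (tens e (fgen k c : sph k n G p T) (fgen k c' : sph k m H q T))
    = g (tens e (fgen k c : sph k n G p T) (fgen k c' : sph k m H q T))) -> f =1 g.
Proof.
move=> fg; apply: tens_ext => p q e x y.
elim/free_ind: x => [c||x x' IH IH'|b x IH].
- elim/free_ind: y => [c'||y y' IH IH'|b y IH].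
  + exact: fg.
  + by rewrite tens0r !linear0.
  + by rewrite tensDr !linearD IH IH'.
  + by rewrite tensZr !linearZ_LR IH.
- by rewrite tens0l !linear0.
- by rewrite tensDl !linearD IH IH'.
- by rewrite tensZl !linearZ_LR IH.
Qed.

Fact avg_natural K l (T' T : member U) (e : epi T' T) (x : A l T) :
  avg_fun K l T' (res (A l) e x) = res (S K l) e (avg_fun K l T x).
Proof.
apply: (@sph_tens_ext l T _ (avg_fun K l T' \o res (A l) e) (res (S K l) e \o avg_fun K l T)).
move=> p q d c c'; rewrite -[RHS]/(res (S K l) e (avg_fun K l T (tens d (fgen k c : sph k n G p T) (fgen k c' : sph k m H q T)))).
rewrite -[LHS]/(avg_fun K l T' (res (A l) e (tens d (fgen k c : sph k n G p T) (fgen k c' : sph k m H q T)))).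
rewrite tensor_resE ![res (sph _ _ _ _) _ _]sph_resE !avg_funE avg_res.
by rewrite (Prop_irrelevance (avg_deg d _ _) (avg_deg d c.1 c'.1)); apply/esym/avg_conj; apply: erep_ecl.
Qed.
Definition avg_nt K l : nat_trans (A l) (S K l) :=
  @NatTrans k U (A l) (S K l) (avg_fun K l) (@avg_natural K l).
Lemma tensor_sph_d0 l T (x : A l T) : diff A l T x = 0.
Proof.
apply: (@sph_tens_ext l T _ (diff A l T) \0) => p q e c c'.
rewrite tensor_dE -[diff (sph k n G) _ _ _]/(0 : sph k n G (p - 1) T) tens0l.
by rewrite -[diff (sph k m H) _ _ _]/(0 : sph k m H (q - 1) T) tens0r scaler0 addr0.
Qed.
Fact avg_d K l T (x : A l T) :
  avg_nt K (l - 1) T (diff A l T x) = diff (S K) l T (avg_nt K l T x).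
Proof. by rewrite tensor_sph_d0 linear0. Qed.
Definition avg_map K : chain_map A (S K) := @ChainMap k U A (S K) (avg_nt K) (@avg_d K).

Definition wgen K : A (n + m) (wide_member K) :=
  tens erefl (res (sph k n G n) (wpr1 K) (sph_u k n G)) (res (sph k m H m) (wpr2 K) (sph_u k m H)).
Lemma wgen_cyc K : cyc (wgen K). Proof. exact: tensor_sph_d0. Qed.
Definition wmap K : chain_map (S K) A := sph_map (wgen_cyc K).

(** Exactly one [K], the image of the pair, contributes, and projecting it to the factors recovers
    [f] and [g]. *)
Lemma wmap_pair_gen l (T : member U) (p q : int) (e : p + q = l) (e1 : p = n) (e2 : q = m)
    (f : epi T G) (g : epi T H) :
  \sum_K wmap K l T (pair_gen K (avg_deg e e1 e2) f g)
  = tens e (fgen k (e1, ecl f) : sph k n G p T) (fgen k (e2, ecl g) : sph k m H q T).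
Proof.
rewrite (bigD1 (image_idx f g)) // big1; last first.
  move=> K /eqP Kfg; rewrite /pair_gen; case: pselect => h; last exact: linear0.
  by case: Kfg; apply: val_inj; apply: val_inj; rewrite /= -h.
apply: etrans (addr0 (wmap _ l T _)) _.
rewrite /pair_gen; case: pselect => // h.
subst p q l; rewrite (Prop_irrelevance (avg_deg _ _ _) erefl) sph_map_gen ct_id.
rewrite tensor_resE -!res_comp !res_sph_u.
have -> : ecl (comp_epi (wpr1 (image_idx f g)) (erep (ecl (cores h)))) = ecl f.
  apply/ecl_eq; apply: epi_conj_trans (epi_conj_comp (epi_conj_refl _) (epi_conj_sym (erep_ecl _))) _.
  exact: epi_conj_ext.
have -> // : ecl (comp_epi (wpr2 (image_idx f g)) (erep (ecl (cores h)))) = ecl g.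
apply/ecl_eq; apply: epi_conj_trans (epi_conj_comp (epi_conj_refl _) (epi_conj_sym (erep_ecl _))) _.
exact: epi_conj_ext.
Qed.

Lemma ecl_conj_epi (T : member U) (L : member U) (c : ecls T L) a : ecl (conj_epi (erep c) a) = c.
Proof. by rewrite -[RHS]erepK; apply/ecl_eq/conj_epi_conj. Qed.

(** Each of the [#|G * H|] conjugated pairs returns the same basis tensor, because conjugation does
    not change the classes. *)
Lemma wmap_avg l T (x : A l T) :
  \sum_K wmap K l T (avg_map K l T x) = #|{: G * H}|%:R *: x.
Proof.
pose F := chain_sum (index_enum _) (fun K => chain_comp (wmap K) (avg_map K)).
have -> : \sum_K wmap K l T (avg_map K l T x) = F l T x by rewrite chain_sumE.
apply: (@sph_tens_ext l T _ (F l T) ( *:%R #|{: G * H}|%:R)) => p q e c c'.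
rewrite chain_sumE.
rewrite (eq_bigr (fun K => \sum_(ab : G * H) wmap K l T (pair_gen K (avg_deg e c.1 c'.1)
   (conj_epi (erep c.2) ab.1) (conj_epi (erep c'.2) ab.2)))); last first.
  move=> K _; rewrite -linear_sum; congr (wmap K l T _); exact: avg_funE.
rewrite exchange_big (eq_bigr (fun=> tens e (fgen k c : sph k n G p T) (fgen k c' : sph k m H q T))); last first.
  by move=> ab _; rewrite wmap_pair_gen !ecl_conj_epi -!surjective_pairing.
rewrite sumr_const; exact/esym/scaler_nat.
Qed.

Lemma cpt_sph_tensor : cpt A.
Proof.
have nz : #|{: G * H}|%:R != 0 :> k.
  rewrite (proj1 (pcharf0P k) char_k) -lt0n; apply/card_gt0P; by exists (1, 1)%g.
have lin l T : linear (fun x : A l T => #|{: G * H}|%:R^-1 *: x).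
  by move=> a x y; rewrite scalerDr !scalerA mulrC.
have nat l (T' T : member U) (e : epi T' T) (x : A l T) :
   mk_linear (@lin l T') (res (A l) e x) = res (A l) e (mk_linear (@lin l T) x).
  exact: esym (linearZ_LR (res (A l) e) _ _).
have chn l T (x : A l T) : NatTrans (@nat (l - 1)) T (diff A l T x)
  = diff A l T (NatTrans (@nat l) T x).
  exact: esym (linearZ_LR (diff A l T) _ _).
pose sc := ChainMap chn.
apply: (@cpt_finretract k U A _ (fun K => S K) (fun K => mm (avg_map K))
  (fun K => mm sc *d mm (wmap K))) => [|K]; last exact: cpt_sph.
rewrite (eq_bigr (fun K => mm (chain_comp sc (chain_comp (wmap K) (avg_map K))))); last first.
  by move=> K _; rewrite !mmM mcompA.
rewrite -mm_chain_sum; apply: mm_ext => l T x; rewrite chain_sumE.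
rewrite -[LHS](linear_sum (sc l T)) wmap_avg.
by rewrite -[LHS]/(_^-1 *: (_ *: x)) scalerA mulVf // scale1r.
Qed.
End SphereTensor.

Section CompactTensor.
Variables (k : fieldType) (U : group_family).
Hypothesis char_k : [pchar k]%R =i pred0.
Hypothesis U_replete : replete U.
Hypothesis U_wide : widely_closed U.

Lemma building_acyclic (P : complex k U -> Prop) X : building P -> acyclic X -> P X.
Proof.
move=> bP /acyclic_m1 e.
apply: (building_retract1 bP (i := @m0 k U X (@cx_zero k U)) (r := m0)).
  by rewrite mcomp0l e.
exact: building0 bP.
Qed.

Lemma building_tensor (P : complex k U -> Prop) W : building P ->
  (forall n G, P (tensor (sph k n G) W)) -> building (fun X => P (tensor X W)).
Proof.
move=> bP sphP; split.
- apply: (building_acyclic bP) => G; apply: tensor_homology_zero.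
  exact: acyclic_zero.
- exact: sphP.
- move=> A B f pA pB; apply/(building_qi bP (tcone_qi W f)).
  exact: (building_cone bP).
- move=> A B f pB pC; apply: (building_source bP (f := tmap W f)) => //.
  exact/(building_qi bP (tcone_qi W f)).
- move=> X E1 E2 i1 r1 i2 r2 e p1 p2.
  apply: (building_retract bP (i1 := fd (tensF W) i1) (r1 := fd (tensF W) r1)
    (i2 := fd (tensF W) i2) (r2 := fd (tensF W) r2)) p1 p2.
  by rewrite -!fdM -fdD e fd1.
Qed.

(** [compact_ind] is applied twice to the left factor: with a sphere on the right, then with [W] on
    the right, where [swap] reduces the case of a sphere on the left to the first. *)
Lemma cpt_tensor (X W : complex k U) : cpt X -> cpt W -> cpt (tensor X W).
Proof.
have bc := building_cpt k U_replete.
have sphW n (G : member U) (Y : complex k U) : cpt Y -> cpt (tensor Y (sph k n G)).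
  apply: (compact_ind U_replete (P := fun Y => cpt (tensor Y (sph k n G)))).
  by apply: building_tensor => // m H; apply: cpt_sph_tensor.
move=> cX cW; move: X cX.
apply: (compact_ind U_replete (P := fun X => cpt (tensor X W))).
apply: building_tensor => // n G.
apply/(cpt_qi (swap_qi (sph k n G) W)); exact: sphW.
Qed.
End CompactTensor.

(** * Nonvanishing of the tensor product of two homology classes *)

Section Kunneth.
Variable k : fieldType.

Lemma functional_exists (V : lmodType k) (v : V) : v != 0 ->
  exists l : {linear V -> k^o}, l v = 1.
Proof.
move=> nv; have lin : linear (fun a : k^o => a *: v).
  by move=> a b c; rewrite scalerDl scalerA.
have [s sP] := lin_pinv (mk_linear lin); exists s.
have /= e := sP 1; rewrite !scale1r in e.
apply/eqP; rewrite -subr_eq0; apply: contraNT nv => nz.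
have : (s v - 1) *: v = 0 by rewrite scalerBl e scale1r subrr.
by move/eqP; rewrite scaler_eq0 (negPf nz).
Qed.

Variable U : group_family.
Implicit Types (X Y : complex k U) (G : member U).

(** With [s] a generalized inverse of [d], the map [1 - d s] kills the boundaries but not [x], so a
    functional on its values can be composed with it. *)
Lemma homology_functional X G p (x : X p G) : ~ bd x ->
  exists l : {linear X p G -> k^o}, l x = 1 /\
    forall m (e : m - 1 = p) z, l (dg X e G z) = 0.
Proof.
elim/int_pred_ind: p => p in x * => nx.
have [s sP] := lin_pinv (diff X p G).
have lin : linear (fun y => y - diff X p G (s y)).
  by move=> a y z; rewrite (linearP s) (linearP (diff X p G)) scalerBr opprD addrACA.
have [|l lE] := @functional_exists _ (mk_linear lin x).
  apply/eqP => /= e; apply: nx; apply/bdP; exists (s x).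
  by apply/esym/eqP; rewrite -subr_eq0; apply/eqP.
exists (l \o mk_linear lin); split=> // m e z.
have em : m = p by apply: (addIr (-1)).
subst m; rewrite (dgE e) -[LHS]/(l (diff X p G z - diff X p G (s (diff X p G z)))).
by rewrite sP subrr linear0.
Qed.

Section Pairing.
Variables (X Y : complex k U) (G : member U) (p q : int).
Variables (l : {linear X p G -> k^o}) (m : {linear Y q G -> k^o}).

(** Extends a functional by zero to the other degrees, since the pairing must be given on all
    bidegrees. *)
Definition at_deg (Z : complex k U) (r : int) (f : Z r G -> k^o) r' (z : Z r' G) : k^o :=
  match pselect (r' = r) with left e => f (ct Z e G z) | right _ => 0 end.
Lemma at_deg_linear (Z : complex k U) (r : int) (f : {linear Z r G -> k^o}) r' :
  linear (@at_deg Z r f r').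
Proof.
move=> a x y; rewrite /at_deg; case: pselect => e; first by rewrite !linearP.
by rewrite scaler0 addr0.
Qed.
Lemma at_degE (Z : complex k U) (r : int) (f : Z r G -> k^o) z : at_deg f z = f z.
Proof. by rewrite /at_deg; case: pselect => // e; rewrite ct_id. Qed.
Lemma at_deg_d (Z : complex k U) (r : int) (f : {linear Z r G -> k^o}) :
  (forall m (e : m - 1 = r) z, f (dg Z e G z) = 0) ->
  forall r' z, at_deg f (diff Z r' G z) = 0.
Proof.
move=> fd r' z; rewrite /at_deg; case: pselect => // e.
by rewrite -(dgE erefl) (ct_dg erefl e e).
Qed.

Fact pairing_l n (p' q' : int) (e : p' + q' = n) (y : Y q' G) :
  linear (fun x : X p' G => at_deg l x * at_deg m y : k^o).
Proof. by move=> a x x'; rewrite at_deg_linear mulrDl -scalerAl. Qed.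
Fact pairing_r n (p' q' : int) (e : p' + q' = n) (x : X p' G) :
  linear (fun y : Y q' G => at_deg l x * at_deg m y : k^o).
Proof. by move=> a y y'; rewrite at_deg_linear mulrDr -scalerAr. Qed.
Definition pairing n : {linear tens_ob X Y G n -> k^o} :=
  tens_lift (@pairing_l n) (@pairing_r n).
Lemma pairingE n (p' q' : int) (e : p' + q' = n) x y :
  pairing n (tens e x y) = at_deg l x * at_deg m y.
Proof. exact: tens_liftE. Qed.
End Pairing.

(** The part of the Kunneth formula for one decomposable class: the product of functionals vanishing
    on boundaries vanishes on the boundaries of the tensor product and is 1 on [x] tensor [y]. *)
Lemma tens_not_bd X Y G (n p q : int) (e : p + q = n) (x : X p G) (y : Y q G) :
  ~ bd x -> ~ bd y -> ~ @bd k U (tensor X Y) G n (tens e x y).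
Proof.
move=> /homology_functional[l [lx ld]] /homology_functional[m [my md]].
elim/int_pred_ind: n => n in e * => /bdP[z zE].
have /eqP := pairingE l m e x y; rewrite !at_degE lx my mul1r -zE.
have -> : pairing l m (n - 1) (diff (tensor X Y) n G z) = 0.
  apply: (@tens_ext _ _ _ _ _ _ _ (pairing l m (n - 1) \o diff (tensor X Y) n G) \0) => p' q' e' x' y'.
  rewrite -[LHS]/(pairing l m (n - 1) (diff (tensor X Y) n G (tens e' x' y'))) tensor_dE.
  rewrite linearD linearZ_LR !pairingE (at_deg_d ld) (at_deg_d md) mul0r mulr0.
  by rewrite scaler0 addr0.
by rewrite eq_sym oner_eq0.
Qed.
End Kunneth.

(** * The Cech complex *)

Section Cech.
Variables (k : fieldType) (V : group_family) (N : finGroupType).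
Hypothesis V_prod : forall G : finGroupType, V G -> V (N * G)%type.
Implicit Types (G H : member V) (M : gfunctor k V) (X Y Z : complex k V).

Definition xN G : member V := Member (V_prod (memberP G)).

Section Epis.
Variables H G : member V.
Variable e : epi H G.
Definition xN_fun (u : xN H) : xN G := (u.1, e u.2).
Fact xN_morph : {morph xN_fun : x y / (x * y)%g}.
Proof. by move=> x y; congr pair; rewrite /= epiM. Qed.
Fact xN_surj y : exists x, xN_fun x = y.
Proof. by case: y => a y; have [x <-] := epi_surj e y; exists (a, x). Qed.
Definition xN_epi : epi (xN H) (xN G) := mk_epi xN_morph xN_surj.
End Epis.

Definition xN_pr_fun G (u : xN G) : G := u.2.
Fact xN_pr_morph G : {morph @xN_pr_fun G : x y / (x * y)%g}. Proof. by []. Qed.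
Fact xN_pr_surj G y : exists x, @xN_pr_fun G x = y. Proof. by exists (1%g, y). Qed.
Definition xN_pr G : epi (xN G) G := mk_epi (@xN_pr_morph G) (@xN_pr_surj G).

Lemma xN_conj H G (e f : epi H G) : epi_conj e f -> epi_conj (xN_epi e) (xN_epi f).
Proof.
move=> [a ef]; exists (1, a)%g => -[x y].
rewrite -[LHS]/((x, f y) : (N * G)%type) ef.
have -> : (xN_epi e (x, y) ^ (1, a))%g = ((x ^ 1)%g, (e y ^ a)%g) :> (N * G)%type by [].
by rewrite conjg1.
Qed.

Fixpoint tpow n G : member V := if n is n'.+1 then xN (tpow n' G) else G.
Fixpoint tpow_epi n H G (e : epi (member_group H) (member_group G)) : epi (tpow n H) (tpow n G) :=
  match n with 0%N => e | n'.+1 => xN_epi (tpow_epi n' e) end.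

Lemma tpow_conj n H G (e f : epi (member_group H) (member_group G)) :
  epi_conj e f -> epi_conj (tpow_epi n e) (tpow_epi n f).
Proof. by move=> ef; elim: n => //= n IH; apply: xN_conj. Qed.
Lemma tpow_id n G : tpow_epi n (id_epi G) =1 id.
Proof. by elim: n => //= n IH [x y] /=; rewrite /xN_fun /= IH. Qed.
Lemma tpow_comp n K H G (e : epi (member_group H) (member_group G))
   (f : epi (member_group K) (member_group H)) :
  tpow_epi n (comp_epi e f) =1 comp_epi (tpow_epi n e) (tpow_epi n f).
Proof. by elim: n => //= n IH [x y] /=; rewrite /xN_fun /= IH. Qed.

Section Pre.
Variable n : nat.
Fact pre_conj M H G (e f : epi (member_group H) (member_group G)) : epi_conj e f ->
  res M (tpow_epi n e) =1 res M (tpow_epi n f).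
Proof. by move=> ef; apply/res_conj/tpow_conj. Qed.
Fact pre_id M G (x : M (tpow n G)) : res M (tpow_epi n (id_epi G)) x = x.
Proof. by rewrite -[RHS]res_id; apply/res_conj/epi_conj_ext/tpow_id. Qed.
Fact pre_comp M (K H G : member V) (e : epi H G) (f : epi K H) (x : M (tpow n G)) :
  res M (tpow_epi n (comp_epi e f)) x = res M (tpow_epi n f) (res M (tpow_epi n e) x).
Proof. by rewrite -res_comp; apply/res_conj/epi_conj_ext/tpow_comp. Qed.
Definition pre M : gfunctor k V :=
  @GFunctor k V (fun G => M (tpow n G)) (fun H G e => res M (tpow_epi n e))
    (@pre_conj M) (@pre_id M) (@pre_comp M).
Definition pre_nt M M' (f : nat_trans M M') : nat_trans (pre M) (pre M') :=
  @NatTrans k V (pre M) (pre M') (fun G => f (tpow n G))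
    (fun H G e => @nt_natural k V M M' f _ _ (tpow_epi n e)).
Definition pre_cx X : complex k V :=
  @Complex k V (fun q => pre (X q)) (fun q => pre_nt (diff X q)) (fun q G => @dd k V X q (tpow n G)).
Definition pre_map X Y (f : chain_map X Y) : chain_map (pre_cx X) (pre_cx Y) :=
  @ChainMap k V (pre_cx X) (pre_cx Y) (fun q => pre_nt (f q)) (fun q G => @cm_d k V X Y f q (tpow n G)).

Lemma pre_dg X p q (e : p - 1 = q) G (x : pre_cx X p G) :
  dg (pre_cx X) e G x = dg X e (tpow n G) x.
Proof. by subst q. Qed.
Lemma pre_ct X p q (e : p = q) G (x : pre_cx X p G) :
  ct (pre_cx X) e G x = ct X e (tpow n G) x.
Proof. by subst q. Qed.
Lemma pre_bd X q G (x : pre_cx X q G) : @bd k V (pre_cx X) G q x <-> @bd k V X (tpow n G) q x.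
Proof. by elim/int_pred_ind: q => q in x *; split=> /bdP[z <-]; apply/bdP; exists z. Qed.
End Pre.

Lemma pre_homology n X G : homology_zero X (tpow n G) -> homology_zero (pre_cx n X) G.
Proof. by move=> /homology_zeroP h; apply/homology_zeroP => q x cx; apply/pre_bd/h. Qed.

Definition rho_at M G : {linear M G -> M (xN G)} := res M (xN_pr G).
Lemma rho_res M H G (e : epi (member_group H) (member_group G)) (x : M G) :
  rho_at M H (res M e x) = res M (xN_epi e) (rho_at M G x).
Proof. by rewrite /rho_at -!res_comp; apply/res_conj/epi_conj_ext. Qed.

Definition shN M : gfunctor k V := pre 1 M.
Definition rho M : nat_trans M (shN M) := @NatTrans k V M (shN M) (rho_at M) (@rho_res M).

(** The alternating sum of the [n + 1] projections that omit one factor [N]. [rho_at] omits the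
    outermost; the others fix it, so they are the faces of the functor [shN M]. Recursion on the
    functor works because [M (tpow n.+1 G)] and [shN M (tpow n G)] are convertible. *)
Fixpoint face n M G : {linear M (tpow n G) -> M (tpow n.+1 G)} :=
  match n with
  | 0%N => rho_at M G
  | n'.+1 => rho_at M (tpow n'.+1 G) \- (face n' (shN M) G)
  end.

Lemma faceS n M G (x : M (tpow n.+1 G)) :
  face n.+1 M G x = rho M _ x - face n (shN M) G x.
Proof. by []. Qed.

Lemma face_nt n M M' (f : nat_trans M M') G x :
  f _ (face n M G x) = face n M' G (f _ x).
Proof.
elim: n => [|n IH] in M M' f x *; first exact: nt_natural.
rewrite !faceS linearB; congr (_ - _); first exact: nt_natural.
exact: (IH _ _ (pre_nt 1 f)).
Qed.

Lemma face_res n M H G (e : epi (member_group H) (member_group G)) x :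
  face n M H (res M (tpow_epi n e) x) = res M (tpow_epi n.+1 e) (face n M G x).
Proof.
elim: n => [|n IH] in M x *; first exact: rho_res.
rewrite !faceS linearB; congr (_ - _); first exact: rho_res.
exact: (IH (shN M)).
Qed.

(** The mixed terms cancel by naturality of [face] with respect to [rho], the rest by the induction
    hypothesis for [shN M]. *)
Lemma face2 n M G x : face n.+1 M G (face n M G x) = 0.
Proof.
elim: n => [|n IH] in M x *.
  by rewrite faceS; apply/eqP; rewrite subr_eq0; apply/eqP; exact: (@face_nt 0 M (shN M) (rho M) G x).
have e : face n.+1 (shN M) G (face n.+1 M G x) = face n.+1 (shN M) G (rho M _ x).
  rewrite [in LHS](faceS x); apply: etrans (linearB (face n.+1 (shN M) G) _ _) _.
  rewrite -[RHS]subr0; congr (_ - _); exact: (IH (shN M) x).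
rewrite (faceS (face n.+1 M G x)) e -(@face_nt n.+1 M (shN M) (rho M) G x); exact: subrr.
Qed.

Section Complexes.
Variable X : complex k V.
Definition face_tr n q : nat_trans (pre_cx n X q) (pre_cx n.+1 X q) :=
  @NatTrans k V (pre_cx n X q) (pre_cx n.+1 X q) (face n (X q)) (fun H G e x => face_res e x).
Fact face_d n q G (x : pre_cx n X q G) :
  face_tr n (q - 1) G (diff (pre_cx n X) q G x) = diff (pre_cx n.+1 X) q G (face_tr n q G x).
Proof. exact/esym/face_nt. Qed.
Definition face_map n : chain_map (pre_cx n X) (pre_cx n.+1 X) :=
  @ChainMap k V (pre_cx n X) (pre_cx n.+1 X) (face_tr n) (@face_d n).
Fact face_map2 n q G (x : pre_cx n X q G) : face_map n.+1 q G (face_map n q G x) = 0.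
Proof. exact: face2. Qed.
Definition cech : complex k V := tot face_map2.
End Complexes.
End Cech.

Section CechFunctor.
Variables (k : fieldType) (V : group_family) (N : finGroupType).
Hypothesis V_prod : forall G : finGroupType, V G -> V (N * G)%type.
Implicit Types (G H : member V) (M : gfunctor k V) (X Y Z : complex k V).

Notation cech := (cech V_prod).
Notation pre_cx := (pre_cx V_prod).
Notation tpow := (tpow V_prod).

Section Map.
Variables (X Y : complex k V) (f : chain_map X Y).

Definition cech_map_fun m G (z : cech X m G) : cech Y m G :=
  fun n => f (m + n%:Z) (tpow n G) (z n).
Fact cech_map_linear m G : linear (@cech_map_fun m G).
Proof. by move=> a x y; apply: pifunP => n; rewrite /cech_map_fun linearP. Qed.
Fact cech_map_natural m (H G : member V) (e : epi H G) (z : cech X m G) :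
  mk_linear (@cech_map_linear m H) (res (cech X m) e z)
  = res (cech Y m) e (mk_linear (@cech_map_linear m G) z).
Proof. by apply: pifunP => n; exact: (nt_natural (f (m + n%:Z)) (tpow_epi V_prod n e) (z n)). Qed.
Definition cech_map_nt m : nat_trans (cech X m) (cech Y m) :=
  @NatTrans k V (cech X m) (cech Y m) (fun G => mk_linear (@cech_map_linear m G))
    (@cech_map_natural m).
Fact cech_map_d m G (z : cech X m G) :
  cech_map_nt (m - 1) G (diff (cech X) m G z) = diff (cech Y) m G (cech_map_nt m G z).
Proof.
apply: pifunP => n.
rewrite -[LHS]/(f _ (tpow n G) (tot_d (face_map V_prod X) m G z n)) tot_dE linearD.
rewrite -[RHS]/(tot_d (face_map V_prod Y) m G (cech_map_fun z) n) tot_dE.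
congr (_ + _); first exact: (cm_dg (pre_map V_prod n f)).
case: n => [|n]; first exact: linear0.
rewrite [LHS]linearZ_LR; congr (_ *: _).
apply: etrans (cm_ct (pre_map V_prod n.+1 f) _ _) _; congr (ct _ _ _ _).
exact: face_nt.
Qed.
Definition cech_map : chain_map (cech X) (cech Y) :=
  @ChainMap k V (cech X) (cech Y) cech_map_nt cech_map_d.
End Map.

Section Cone.
Variables (X Y : complex k V) (f : chain_map X Y).
Notation C := (cech (cone f)).
Notation D := (cone (cech_map f)).

(** Taking Cech complexes commutes with cones; the isomorphism only regroups degrees, from
    [m + n - 1] to [m - 1 + n]. *)
Definition cech_cone1 m G (z : C m G) : cech X (m - 1) G :=
  fun n => ct X (tot_deg m n) (tpow n G) (z n).1.
Definition cech_cone2 m G (z : C m G) : cech Y m G := fun n => (z n).2.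
Definition cech_cone_fun m G (z : C m G) : D m G := (cech_cone1 z, cech_cone2 z).
Fact cech_cone_linear m G : linear (@cech_cone_fun m G).
Proof.
move=> a x y; rewrite -[RHS]/((a *: cech_cone1 x + cech_cone1 y, a *: cech_cone2 x + cech_cone2 y) : D m G).
congr pair; apply: pifunP => n //; exact: (linearP (ct X (tot_deg m n) (tpow n G))).
Qed.
Fact cech_cone_natural m (H G : member V) (e : epi H G) (z : C m G) :
  mk_linear (@cech_cone_linear m H) (res (C m) e z) = res (D m) e (mk_linear (@cech_cone_linear m G) z).
Proof.
congr pair; apply: pifunP => n //.
exact: (nt_natural (ct X (tot_deg m n)) (tpow_epi V_prod n e)).
Qed.
Definition cech_cone_nt m : nat_trans (C m) (D m) :=
  @NatTrans k V (C m) (D m) (fun G => mk_linear (@cech_cone_linear m G)) (@cech_cone_natural m).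

Lemma face_cone1 n q G (u : cone f q (tpow n G)) :
  (face V_prod n (cone f q) G u).1 = face V_prod n (X (q - 1)) G u.1.
Proof. exact: (@face_nt k V N V_prod n (cone f q) (X (q - 1)) (nt_fst (X (q - 1)) (Y q)) G u). Qed.
Lemma face_cone2 n q G (u : cone f q (tpow n G)) :
  (face V_prod n (cone f q) G u).2 = face V_prod n (Y q) G u.2.
Proof. exact: (@face_nt k V N V_prod n (cone f q) (Y q) (nt_snd (X (q - 1)) (Y q)) G u). Qed.

Lemma ct_cone_pair p p' (d : p = p') (d' : p - 1 = p' - 1) G (u : cone f p G) :
  ct (cone f) d G u = ((ct X d' G u.1, ct Y d G u.2) : cone f p' G).
Proof. by subst p'; rewrite (eq_irrelevance d' erefl); case: u. Qed.

Fact cech_cone_d m G (z : C m G) : cech_cone_nt (m - 1) G (diff C m G z) = diff D m G (cech_cone_nt m G z).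
Proof.
have zd n : diff C m G z n = dg (cone f) (tot_deg m n) (tpow n G) (z n)
   + tot_prev (face_map V_prod (cone f)) z n.
  by rewrite -[LHS]/(tot_d (face_map V_prod (cone f)) m G z n) tot_dE -pre_dg.
congr pair; apply: pifunP => n.
- rewrite -[LHS]/(ct X (tot_deg (m - 1) n) (tpow n G) (diff C m G z n).1) zd.
  rewrite -[RHS]/(- tot_d (face_map V_prod X) (m - 1) G (cech_cone1 z) n) tot_dE opprD.
  have e1 : m + n%:Z - 1 - 1 = m - 1 + n%:Z - 1 by rewrite tot_deg.
  have e2 : m + n%:Z - 1 - 1 = m - 1 - 1 + n%:Z by rewrite e1 tot_deg.
  apply: etrans (linearD (ct X (tot_deg (m - 1) n) (tpow n G)) _ _) _; congr (_ + _).
    rewrite (cone_dg1 (tot_deg m n) _ e1) linearN (ct_dg _ _ e2) pre_dg; congr (- _).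
    exact/esym/dg_ct.
  case: n {zd e1 e2} => [|n]; first by rewrite linear0 oppr0.
  have d' : m + n%:Z - 1 = m - 1 + n.+1%:Z - 1 by rewrite tot_degS.
  have -> : (tot_prev (face_map V_prod (cone f)) z n.+1).1
    = (-1) ^ (m + n%:Z) *: ct X d' (tpow n.+1 G) (face V_prod n (X (m + n%:Z - 1)) G (z n).1).
    rewrite -face_cone1 -[LHS]/(_ *: (ct (pre_cx n.+1 (cone f)) _ _ _).1).
    by rewrite pre_ct (ct_cone_pair _ d').
  rewrite [LHS]linearZ_LR /= (tot_sign k) scaleNr opprK; congr (_ *: _).
  rewrite pre_ct -(face_nt (ct X (tot_deg m n))).
  have e : m + n%:Z - 1 = m - 1 - 1 + n.+1%:Z by rewrite tot_deg tot_degS.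
  by rewrite (ct_ct _ _ e) (ct_ct _ _ e).
- rewrite -[LHS]/((diff C m G z n).2) zd.
  rewrite -[RHS]/(f _ (tpow n G) (cech_cone1 z n) + tot_d (face_map V_prod Y) m G (cech_cone2 z) n) tot_dE.
  rewrite -[LHS]/((dg (cone f) (tot_deg m n) (tpow n G) (z n)).2
   + (tot_prev (face_map V_prod (cone f)) z n).2) cone_dg2.
  apply: etrans (esym (addrA _ _ _)) _; congr (_ + (_ + _)); first by rewrite pre_dg.
  case: n {zd} => [|n] //.
  have d' : m + n%:Z - 1 = m - 1 + n.+1%:Z - 1 by rewrite tot_degS.
  rewrite /= pre_ct -face_cone2.
  rewrite -[LHS]/(_ *: (ct (pre_cx n.+1 (cone f)) _ _ _).2); congr (_ *: _).
  by rewrite pre_ct (ct_cone_pair _ d').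
Qed.
Definition cech_cone : chain_map C D := @ChainMap k V C D cech_cone_nt cech_cone_d.

Definition cech_cone_inv m G (u : D m G) : C m G :=
  fun n => (ct X (esym (tot_deg m n)) (tpow n G) (u.1 n), u.2 n).
Lemma cech_cone_qi : quasi_iso cech_cone.
Proof.
apply: (@bij_qi _ _ _ _ cech_cone cech_cone_inv) => m G.
  move=> z; apply: pifunP => n; rewrite /cech_cone_inv /= /cech_cone1 ctK.
  exact/esym/surjective_pairing.
move=> [a b]; rewrite -[LHS]/((cech_cone1 (cech_cone_inv (a, b)), b) : D m G); congr pair.
apply: pifunP => n; exact: (@ctK k V X _ _ (esym (tot_deg m n)) (tot_deg m n) (tpow n G) (a n)).
Qed.
End Cone.

Lemma cech_acyclic X : acyclic X -> acyclic (cech X).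
Proof. by move=> hX G; apply: tot_acyclic => n; apply: pre_homology. Qed.

Lemma acyclic_qi X Y (s : chain_map X Y) : quasi_iso s -> acyclic X <-> acyclic Y.
Proof.
move=> /quasi_isoP sP; split=> /acyclicP h; apply/acyclicP => G n x cx; have [i s'] := sP G n.
  have [y cy e] := s' x cx; apply: (bd_subl e); apply/cm_bd/h/cy.
by apply: i => //; apply/h/cm_cyc.
Qed.

Lemma cech_map_qi X Y (f : chain_map X Y) : quasi_iso f -> quasi_iso (cech_map f).
Proof.
move=> /quasi_iso_cone hf; apply/quasi_iso_cone/(acyclic_qi (cech_cone_qi f)).
exact: cech_acyclic.
Qed.

Definition cechF : cfun k V V.
Proof.
exists (fun X => cech X) (fun X Y f => cech_map f).
- by move=> X Y f g fg m G z; apply: pifunP => n; apply: fg.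
- by [].
- by [].
- by [].
- exact: cech_map_qi.
Defined.
End CechFunctor.

(** * Restriction to the subfamily and acyclicity on compact objects *)

Section Restriction.
Variables (k : fieldType) (U V : group_family).
Hypothesis V_sub : forall G : finGroupType, V G -> U G.

Definition inU (G : member V) : member U := Member (V_sub (memberP G)).

Definition restr_g (M : gfunctor k U) : gfunctor k V :=
  @GFunctor k V (fun G => M (inU G)) (fun H G (e : epi H G) => @res k U M (inU H) (inU G) e)
   (fun H G => @res_conj k U M (inU H) (inU G)) (fun G => @res_id k U M (inU G))
   (fun K H G => @res_comp k U M (inU K) (inU H) (inU G)).
Definition restr_nt (M M' : gfunctor k U) (f : nat_trans M M') : nat_trans (restr_g M) (restr_g M') :=
  @NatTrans k V (restr_g M) (restr_g M') (fun G => f (inU G))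
   (fun H G => @nt_natural k U M M' f (inU H) (inU G)).
Definition restr (X : complex k U) : complex k V :=
  @Complex k V (fun q => restr_g (X q)) (fun q => restr_nt (diff X q))
    (fun q G => @dd k U X q (inU G)).
Definition restr_map (X Y : complex k U) (f : chain_map X Y) : chain_map (restr X) (restr Y) :=
  @ChainMap k V (restr X) (restr Y) (fun q => restr_nt (f q)) (fun q G => @cm_d k U X Y f q (inU G)).

Lemma restr_bd (X : complex k U) q (G : member V) (x : restr X q G) : @bd k V (restr X) G q x <-> @bd k U X (inU G) q x.
Proof. by elim/int_pred_ind: q => q in x *; split=> /bdP[z <-]; apply/bdP; exists z. Qed.

Lemma restr_qi (X Y : complex k U) (f : chain_map X Y) : quasi_iso f -> quasi_iso (restr_map f).
Proof.
move=> /quasi_isoP fP; apply/quasi_isoP => G n; have [i s] := fP (inU G) n; split.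
  by move=> x cx /restr_bd bx; apply/restr_bd/i.
by move=> y cy; have [x cx bx] := s y cy; exists x => //; apply/restr_bd.
Qed.

Definition restrF : cfun k U V.
Proof.
exists restr restr_map.
- by move=> X Y f g fg n G x; apply: fg.
- by [].
- by [].
- by [].
- exact: restr_qi.
Defined.

Section Cone.
Variables (X Y : complex k U) (f : chain_map X Y).
Definition restr_cone_nt q : nat_trans (restr (cone f) q) (cone (restr_map f) q) :=
  @NatTrans k V (restr (cone f) q) (cone (restr_map f) q) (fun G => idfun) (fun _ _ _ _ => erefl).
Definition restr_cone : chain_map (restr (cone f)) (cone (restr_map f)) :=
  @ChainMap k V (restr (cone f)) (cone (restr_map f)) restr_cone_nt (fun _ _ _ => erefl).
Lemma restr_cone_qi : quasi_iso restr_cone.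
Proof. exact: (@bij_qi _ _ _ _ restr_cone (fun n G x => x)). Qed.
End Cone.
End Restriction.

Section ExactFunctor.
Variables (k : fieldType) (U V : group_family).
Hypotheses (U_replete : replete U) (V_replete : replete V).
Variable F : cfun k U V.
Hypothesis F_cone : forall X Y (f : chain_map X Y),
  exists c : chain_map (F (cone f)) (cone (fm F f)), quasi_iso c.

(** Acyclic complexes are the zero objects, so acyclicity of the values of an exact functor passes
    to retracts and need be known on generators only. *)
Lemma acyclic_building : (forall n G, acyclic (F (sph k n G))) -> building (fun X => acyclic (F X)).
Proof.
have z X : m1 (F X) = m0 -> acyclic (F X) := m1_0_acyclic V_replete (X := F X).
move=> F_sph; split=> //.
- by apply: z; rewrite -fd1 (acyclic_m1 (@acyclic_zero _ _)) fd0.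
- move=> A B f hA hB; have [c cq] := F_cone f; apply/(acyclic_qi cq)/quasi_iso_cone.
  exact: quasi_iso_acyclic.
- move=> A B f hB; have [c cq] := F_cone f => /(acyclic_qi cq)/quasi_iso_cone/acyclic_qi.
  by move=> h; apply/h.
- move=> X E1 E2 i1 r1 i2 r2 e /acyclic_m1 h1 /acyclic_m1 h2; apply: z.
  rewrite -fd1 -e fdD !fdM (m1_mor0 (fd F r1) h1) (m1_mor0 (fd F r2) h2).
  by rewrite !mcomp0l madd0l.
Qed.
End ExactFunctor.

Section SphereContraction.
Variables (k : fieldType) (U V : group_family) (N : finGroupType).
Hypothesis V_sub : forall G : finGroupType, V G -> U G.
Hypothesis V_prod : forall G : finGroupType, V G -> V (N * G)%type.
Variables (n : int) (H : member U).

Notation P := (restr V_sub (sph k n H)).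
Notation xN := (xN V_prod).

Section Kill.
Variable G : member V.
Implicit Type f : epi (xN G) H.
Definition kills f := forall x, f (x, 1%g) = 1%g.
Section Def.
Variable f : epi (xN G) H.
Hypothesis fk : kills f.
Definition desc_fun (t : G) : H := f (1%g, t).
Fact desc_morph : {morph desc_fun : x y / (x * y)%g}.
Proof.
move=> x y; rewrite /desc_fun -epiM; congr (f _).
by rewrite -[RHS]/((1 * 1)%g, (x * y)%g) mulg1.
Qed.
Lemma desc_funE u : f u = desc_fun u.2.
Proof.
case: u => a t; rewrite -[RHS]/(f (1%g, t)).
have -> : (a, t) = (((a, 1) : xN G) * ((1, t) : xN G))%g :> xN G.
  by rewrite -[RHS]/((a * 1)%g, (1 * t)%g) mulg1 mul1g.
by rewrite epiM fk mul1g.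
Qed.
Fact desc_surj y : exists t, desc_fun t = y.
Proof. by have [u <-] := epi_surj f y; exists u.2; rewrite desc_funE. Qed.
Definition desc : epi G H := mk_epi desc_morph desc_surj.
End Def.

Lemma kills_conj f g : epi_conj f g -> kills f -> kills g.
Proof. by move=> [a fg] kf x; rewrite fg kf conj1g. Qed.

(* The retraction of [rho]: it is natural in [G] but not in [H], so that it
   contracts the Cech complex of a generator only. *)
Definition sphr_gen (q : int) (e : q = n) f : P q G :=
  match pselect (kills f) with left h => fgen k (e, ecl (desc h)) | right _ => 0 end.
Lemma sphr_gen_conj q (e : q = n) f g : epi_conj f g -> sphr_gen e f = sphr_gen e g.
Proof.
move=> fg; rewrite /sphr_gen; case: pselect => h; case: pselect => h' //.
- congr (fgen k (_, _)); apply/ecl_eq; have [a ag] := fg; exists a => x; exact: ag.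
- by case: h'; apply: kills_conj fg h.
- by case: h; apply: kills_conj (epi_conj_sym fg) h'.
Qed.
Lemma sphr_gen_pr q (e : q = n) (f : epi G H) :
  sphr_gen e (comp_epi f (xN_pr V_prod G)) = fgen k (e, ecl f).
Proof.
rewrite /sphr_gen; case: pselect => [h|[]]; last by move=> x; apply: epi1.
by congr (fgen k (_, _)); apply/ecl_eq/epi_conj_ext.
Qed.
End Kill.

Lemma sphr_gen_res q (e : q = n) (G' G : member V) (g : epi G' G) (f : epi (xN G) H) :
  res (P q) g (sphr_gen e f) = sphr_gen e (comp_epi f (xN_epi V_prod g)).
Proof.
rewrite /sphr_gen; case: pselect => h; case: pselect => h'; rewrite ?linear0 //.
- rewrite [LHS]sph_resE; congr (fgen k (_, _)); apply/ecl_eq.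
  apply: epi_conj_trans (epi_conj_comp (epi_conj_sym (erep_ecl _)) (epi_conj_refl _)) _.
  exact: epi_conj_ext.
- by case: h' => x; rewrite /= /xN_fun /= epi1 h.
- case: h => x; have := h' x; by rewrite /= /xN_fun /= epi1.
Qed.

Definition sphr_fun q (G : member V) : {linear shN V_prod (P q) G -> P q G} :=
  flift (fun p : sph_idx n H q (inU V_sub (xN G)) => sphr_gen p.1 (erep p.2)).
Lemma sphr_natural q (G' G : member V) (g : epi G' G) (x : shN V_prod (P q) G) :
  sphr_fun q G' (res (shN V_prod (P q)) g x) = res (P q) g (sphr_fun q G x).
Proof.
apply: (@free_ext _ _ _ (sphr_fun q G' \o res (shN V_prod (P q)) g) (res (P q) g \o sphr_fun q G)) => p.
rewrite -[LHS]/(sphr_fun q G' (@sph_res k U n H q (inU V_sub (xN G')) (inU V_sub (xN G)) (xN_epi V_prod g) (fgen k p))).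
rewrite sph_resE -[RHS]/(res (P q) g (sphr_fun q G (fgen k p))).
rewrite [LHS]fliftE [in RHS]fliftE sphr_gen_res; apply: sphr_gen_conj.
exact: epi_conj_sym (erep_ecl _).
Qed.
Definition sphr q : nat_trans (shN V_prod (P q)) (P q) :=
  @NatTrans k V (shN V_prod (P q)) (P q) (sphr_fun q) (@sphr_natural q).
Lemma sphr_rho q (G : member V) x : sphr q G (rho_at V_prod (P q) G x) = x.
Proof.
apply: (@free_ext _ _ _ (sphr q G \o rho_at V_prod (P q) G) idfun) => p.
rewrite -[LHS]/(sphr_fun q G (@sph_res k U n H q (inU V_sub (xN G)) (inU V_sub G) (xN_pr V_prod G) (fgen k p))).
rewrite sph_resE [LHS]fliftE /= -(sphr_gen_conj _ (erep_ecl _)) sphr_gen_pr erepK.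
by case: p.
Qed.

Lemma sphr_face i q (G : member V) (x : P q (tpow V_prod i.+1 G)) :
  sphr q (tpow V_prod i.+1 G) (face V_prod i.+1 (P q) G x)
  = x - face V_prod i (P q) G (sphr q (tpow V_prod i G) x).
Proof.
rewrite (faceS (V_prod := V_prod) x); apply: etrans (linearB (sphr q (tpow V_prod i.+1 G)) _ _) _.
congr (_ - _); first exact: sphr_rho.
exact: (face_nt (V_prod := V_prod) (sphr q)).
Qed.

(** [sphr] is an extra degeneracy. In column 0 it is an exact retraction of [rho_at], so
    [tot_contract] gives a contraction without augmentation. *)
Lemma cech_sph_acyclic : acyclic (cech V_prod P).
Proof.
move=> G; apply/homology_zeroP; elim/int_pred_ind => m y cy.
pose s i q : {linear pre_cx V_prod i.+1 P q G -> pre_cx V_prod i P q G} :=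
  sphr q (tpow V_prod i G).
have sdg i (p q : int) (e : p - 1 = q) x :
    s i q (dg (pre_cx V_prod i.+1 P) e G x) = dg (pre_cx V_prod i P) e G (s i p x).
  by subst q; apply: (linear0 (s i (p - 1))).
have [w [w0 wS]] := tot_contract sdg cy.
apply/bdP; exists w; apply: pifunP => -[|i].
  rewrite -[LHS]/(tot_d_fun (face_map V_prod P) w 0%N) w0; exact: sphr_rho.
rewrite -[LHS]/(tot_d_fun (face_map V_prod P) w i.+1) wS.
apply: etrans (f_equal2 +%R (sphr_face _) erefl) _; exact: subrK.
Qed.
End SphereContraction.

Import Order.TTheory Num.Theory.

Section CechCompact.
Variables (k : fieldType) (U V : group_family) (N : finGroupType).
Hypothesis U_replete : replete U.
Hypothesis V_replete : replete V.
Hypothesis V_sub : forall G : finGroupType, V G -> U G.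
Hypothesis V_prod : forall G : finGroupType, V G -> V (N * G)%type.

Definition comp_cfun U1 U2 U3 (F : cfun k U2 U3) (F' : cfun k U1 U2) : cfun k U1 U3.
Proof.
exists (fun X => F (F' X)) (fun X Y f => fm F (fm F' f)).
- by move=> X Y f g fg; apply/fm_ext/fm_ext.
- move=> X n G x; rewrite -[RHS](@fm_id _ _ _ F); apply: fm_ext => m H y; exact: fm_id.
- move=> X Y Z g f n G x; rewrite -fm_comp; apply: fm_ext => m H y; exact: fm_comp.
- move=> X Y f g n G x; rewrite -fm_add; apply: fm_ext => m H y; exact: fm_add.
- by move=> X Y f fq; apply/fm_qi/fm_qi.
Defined.

Lemma cech_compact (X : complex k U) : cpt X -> acyclic (cech V_prod (restr V_sub X)).
Proof.
pose F := comp_cfun (cechF k V_prod) (restrF k V_sub).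
apply: (compact_ind U_replete (P := fun X => acyclic (F X))).
apply: acyclic_building => // [Y Z f|n G]; last exact: cech_sph_acyclic.
exists (chain_comp (cech_cone V_prod (restr_map V_sub f)) (cech_map V_prod (restr_cone V_sub f))).
apply: quasi_iso_comp; first exact: cech_cone_qi.
exact/cech_map_qi/restr_cone_qi.
Qed.
End CechCompact.

(** * Homology as morphisms from spheres, and upper bounds for its degrees *)

Section Bounded.
Variables (k : fieldType) (U : group_family).
Hypothesis U_replete : replete U.

Definition exact_at (X : complex k U) n (G : member U) := forall x : X n G, cyc x -> bd x.

(** The injective half of the identification begun in [sph_hom]: a zero morphism is null-homotopic
    in the resolution, and the homotopy bounds the image of [z]. *)
Lemma sph_map_bd (X : complex k U) n (G : member U) (z : X n G) (cz : cyc z) :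
  mm (sph_map cz) = m0 <-> bd z.
Proof.
split=> h.
  have jz : htpy (chain_comp (jQ U_replete X) (sph_map cz)) (@chain_zero k U _ (Q U_replete X)).
    by apply: (hom_inj U_replete (@Q_kinj _ _ U_replete X)); rewrite mmM h mcomp0r mm0.
  have [i _] := proj1 (quasi_isoP _) (jQ_qi U_replete X) G n; apply: i => //.
  have [l lP] := jz; have e : n = n + 1 - 1 by rewrite addrK.
  move: (sph_mapE cz) => <-; move: (jQ U_replete X) l lP; move: (Q U_replete X) => I j l lP.
  have {lP} hb m (y : sph k n G m G) : bd (j m G (sph_map cz m G y)).
    elim/int_pred_ind: m => m in y *.
    rewrite -[j _ _ _]/(chain_comp j (sph_map cz) (m - 1) G y) (etrans (esym (subr0 _)) (lP m G y)).
    rewrite -[diff (sph k n G) _ _ _]/(0 : sph k n G (m - 1 - 1) G) linear0 addr0; exact: Bd.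
  exact: hb.
have -> : mm (sph_map cz) = mm (@chain_zero k U (sph k n G) X); last exact: mm0.
apply/htpy_mm/sph_htpy; rewrite sph_mapE (subr0 z) //.
Qed.

Lemma exact_atP (X : complex k U) n (G : member U) :
  exact_at X n G <-> forall d : mor (sph k n G) X, d = m0.
Proof.
split=> [h d|h x cx]; last exact/(sph_map_bd cx).
by have [z [cz ->]] := sph_hom U_replete d; apply/sph_map_bd/h.
Qed.

Lemma homology_zero_mor (X : complex k U) (G : member U) :
  homology_zero X G <-> forall n (d : mor (sph k n G) X), d = m0.
Proof.
split=> [/homology_zeroP h n|h]; first exact/exact_atP/h.
by apply/homology_zeroP => n; apply/exact_atP/h.
Qed.

Lemma shift_bd (X : complex k U) n G (x : shift X n G) : bd x -> @bd k U X G (n - 1) x.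
Proof. by case=> m z; apply/bdN/Bd. Qed.

(** The bound does not depend on the group, so that a nonzero class can be chosen in the highest
    degree occurring at any group of [V]. *)
Definition bounded_above (X : complex k U) :=
  exists b : int, forall (n : int) G, b < n -> exact_at X n G.

Lemma bounded_above_building : building bounded_above.
Proof.
split.
- by exists 0 => n G _ x _; have /acyclicP := @acyclic_zero k U; apply.
- move=> n G; exists n => m H nm; apply/exact_atP => d.
  have [z [cz ->]] := sph_hom U_replete d; apply/sph_map_bd.
  suff -> : z = 0 by apply: bd0.
  elim/free_ind: z {cz} => [[e c]||x y -> ->|a x ->].
  + by rewrite e ltxx in nm.
  + by [].
  + exact: addr0.
  + exact: scaler0.
(* [A] sits one degree higher in the cone, whence [a + 1]. *)
- move=> A B f [a ha] [b hb]; exists (Num.max (a + 1) b) => n G.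
  elim/int_pred_ind: n => n; rewrite gt_max => /andP[an bn] [x y] /cone_cyc[/= cx cy].
  have /bdP[x' x'E] : bd x by apply: ha => //; rewrite ltrBrDr.
  have cy' : cyc (y + f (n - 1) G x').
    by rewrite /cyc linearD -cm_d x'E -cy; apply: addrC.
  have /bdP[y' y'E] := hb _ _ bn _ cy'.
  apply/cone_bd; exists (- x'), y'; split; first by rewrite linearN opprK x'E.
  by rewrite linearN y'E; apply/esym; apply: etrans (addrC _ _) (addrK _ _).
- move=> A B f [b hb] [c hc]; exists (Num.max b c) => n G.
  elim/int_pred_ind: n => n; rewrite gt_max => /andP[bn cn] x cx.
  have /bdP[y yE] := hb _ _ bn _ (cm_cyc f cx).
  have cu : cyc ((x, - y) : cone f n G).
    by apply/cone_cyc; split=> //=; rewrite linearN yE subrr.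
  have cn' : c < n by apply: lt_trans cn _; rewrite ltrBlDr ltrDl.
  exact: (shift_bd (cm_bd (cone_out f) (hc n G cn' _ cu))).
- move=> X E1 E2 i1 r1 i2 r2 e [a ha] [b hb]; exists (Num.max a b) => n G.
  rewrite gt_max => /andP[an bn]; apply/exact_atP => d.
  rewrite -[d]mcomp1l -e mcompDl -!mcompA.
  have /exact_atP/(_ (i1 *d d)) -> := ha n G an.
  have /exact_atP/(_ (i2 *d d)) -> := hb n G bn.
  by rewrite !mcomp0r madd0l.
Qed.
End Bounded.

Section TopDegree.
Variables (k : fieldType) (V : group_family).

Lemma bd_ct (Y : complex k V) p q (e : p = q) G (x : Y p G) : bd (ct Y e G x) <-> bd x.
Proof. by subst q. Qed.

Lemma bdZ (Y : complex k V) p G a (x : Y p G) : bd x -> bd (a *: x).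
Proof.
elim/int_pred_ind: p => p in x *.
by move=> /bdP[z <-]; rewrite -linearZ_LR; apply: Bd.
Qed.

Variable N : finGroupType.
Hypothesis V_prod : forall G : finGroupType, V G -> V (N * G)%type.

(* A class of top degree killed by the restriction along [N * G -> G] would
   extend to a cocycle of the Cech complex. *)
Lemma cech_top (Y : complex k V) m (G : member V) (z : Y m G) :
  acyclic (cech V_prod Y) -> (forall n H, m < n -> exact_at Y n H) ->
  cyc z -> bd (rho_at V_prod (Y m) G z) -> bd z.
Proof.
elim/int_pred_ind: m => m in z * => hC hY cz bz.
pose E n := pre_cx V_prod n Y.
(* The next column is total in [u] and arbitrary when the obstruction does not vanish, so that [y]
   can be defined before [by_] is proved. *)
have step n (u : E n (m - 1 + n%:Z) G) : exists w : E n.+1 (m - 1 + n.+1%:Z) G,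
    bd (face_map V_prod Y n _ G u) -> dg (E n.+1) (tot_deg (m - 1) n.+1) G w
      = - ((-1) ^ (m - 1 + n%:Z) *: ct (E n.+1) (tot_degS (m - 1) n) G (face_map V_prod Y n _ G u)).
  have [b|] := pselect (bd (face_map V_prod Y n _ G u)); last by exists 0.
  have /(bd_dgP (tot_deg (m - 1) n.+1))[w wE] : bd (- ((-1) ^ (m - 1 + n%:Z) *:
    ct (E n.+1) (tot_degS (m - 1) n) G (face_map V_prod Y n _ G u))).
    exact/bdN/bdZ/bd_ct.
  by exists w.
have e0 : m - 1 = m - 1 + 0%N%:Z by rewrite addr0.
pose y := fix y n : E n (m - 1 + n%:Z) G := match n with
  | 0%N => ct Y e0 G z
  | n'.+1 => sval (cid (step n' (y n')))
  end.
have yS n : bd (face_map V_prod Y n _ G (y n)) ->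
    dg (E n.+1) (tot_deg (m - 1) n.+1) G (y n.+1) = - ((-1) ^ (m - 1 + n%:Z) *:
      ct (E n.+1) (tot_degS (m - 1) n) G (face_map V_prod Y n _ G (y n))).
  by rewrite [y n.+1]/=; case: cid.
(* The first obstruction is the restriction of [z], a boundary by hypothesis. The later ones are
   cycles strictly above the top degree, where [Y] is exact. *)
have by_ n : bd (face_map V_prod Y n _ G (y n)).
  elim: n => [|n IH].
    apply: (proj2 (@pre_bd k V N V_prod 1 Y _ G _)).
    rewrite -[face_map _ _ _ _ _ _]/(face V_prod 0 (Y _) G (ct Y e0 G z)).
    by rewrite -(face_nt (ct Y e0)); apply/bd_ct.
  apply: (proj2 (@pre_bd k V N V_prod n.+2 Y _ G _)); apply: hY; first by rewrite ltrDl.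
  apply/(cyc_dg (tot_deg (m - 1) n.+1)); rewrite -(@pre_dg k V N V_prod n.+2 Y).
  apply: etrans (esym (cm_dg (face_map V_prod Y n.+1) _ _)) _; rewrite (yS n IH) linearN linearZ_LR.
  by rewrite cm_ct face_map2 linear0 scaler0 oppr0.
have cy : @cyc k V (cech V_prod Y) G (m - 1) y.
  apply/tot_cyc => -[|n]; last exact: yS.
  rewrite oppr0 -[LHS]/(dg (E 0%N) _ G (ct Y e0 G z)) pre_dg.
  have e : m - 1 - 1 = m - 1 - 1 + 0%N%:Z by rewrite addr0.
  by rewrite (dg_ct _ _ e) -(ct_dg erefl e) dgE cz linear0.
have /acyclicP/(_ _ _ _ cy)/bdP[w wE] := hC.
(* No horizontal differential enters column 0, so there a bounding element of the Cech cycle bounds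
   [z]. *)
have e1 : dg Y (tot_deg m 0) G (w 0%N) = ct Y e0 G z.
  rewrite -[RHS]/(y 0%N) -wE -[RHS]/(tot_d (face_map V_prod Y) m G w 0%N) tot_dE -(@pre_dg k V N V_prod 0 Y).
  exact: esym (addr0 _).
by apply/(bd_ct e0); rewrite -e1; apply: bd_dg.
Qed.
End TopDegree.

Lemma int_max (P : int -> Prop) (b m : int) : P m -> (forall n, b < n -> ~ P n) ->
  exists2 t, P t & forall n, t < n -> ~ P n.
Proof.
move=> Pm hb; have [j jb] : exists j : nat, b - m <= j%:Z.
  by exists `|b - m|%N; rewrite abszE ler_norm.
elim: j => [|j IH] in m Pm jb *.
  by exists m => // n mn; apply: hb; apply: le_lt_trans mn; rewrite -subr_le0.
have [[n mn Pn]|h] := pselect (exists2 n, m < n & P n); last first.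
  by exists m => // n mn Pn; apply: h; exists n.
by apply: (IH n Pn); lia.
Qed.

(** * The prime ideal *)

Section Primality.
Variables (k : fieldType) (U V : group_family).
Hypothesis char_k : [pchar k]%R =i pred0.
Hypothesis U_replete : replete U.
Hypothesis U_wide : widely_closed U.
Hypothesis V_mgf : multiplicative_global_family V.
Hypothesis V_sub_U : forall G : finGroupType, V G -> U G.
Implicit Types (X Y Z : complex k U).

Let V_replete : replete V. Proof. by case: V_mgf. Qed.
Let V_prod (N : finGroupType) : V N -> forall G : finGroupType, V G -> V (N * G)%type.
Proof. by case: V_mgf => _ _ h _ _ VN G VG; apply: h. Qed.

Lemma homology_zero_retract X Y (i : mor X Y) (r : mor Y X) (G : member U) :
  r *d i = m1 X -> homology_zero Y G -> homology_zero X G.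
Proof.
move=> e /(homology_zero_mor U_replete) h; apply/(homology_zero_mor U_replete) => n d.
by rewrite -[d]mcomp1l -e -mcompA (h n (i *d d)) mcomp0r.
Qed.

Lemma p_ideal_retract X Y (i : mor X Y) (r : mor Y X) :
  r *d i = m1 X -> p_ideal V Y -> p_ideal V X.
Proof.
move=> e [/compactP cY hY]; split; first exact/compactP/(cpt_retract e).
by move=> G VG; apply: homology_zero_retract e (hY G VG).
Qed.

Lemma p_ideal_acyclic X : acyclic X -> p_ideal V X.
Proof.
move=> hX; split=> [|G _]; last exact: hX.
by apply/compactP; apply: (building_acyclic (building_cpt k U_replete)).
Qed.

Lemma p_ideal_cone X Y (f : chain_map X Y) : p_ideal V X -> p_ideal V Y -> p_ideal V (cone f).
Proof.
move=> [/compactP cX hX] [/compactP cY hY]; split; first exact/compactP/cpt_cone.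
move=> G VG; apply/cone_exact_at => n; split.
  by move=> x cx _; have /homology_zeroP := hX G VG; apply.
move=> y cy; exists 0; first exact: linear0.
by rewrite linear0 sub0r; apply/bdN; have /homology_zeroP := hY G VG; apply.
Qed.

Lemma homology_zero_shift X (G : member U) : homology_zero (shift X) G <-> homology_zero X G.
Proof.
split=> h.
  elim/int_pred_ind => n x cx; apply/(shift_homologous (X := X) (n := n)).
  by apply: h; apply/shift_cycle.
by move=> n x /shift_cycle cx; apply/shift_homologous; apply: h.
Qed.

Lemma p_ideal_thick : thick_ideal (p_ideal (k := k) (U := U) V).
Proof.
have isoP X Y (f : dhom X Y) : is_iso f -> p_ideal V X -> p_ideal V Y.
  move=> [g [_ /cl_eq]]; rewrite clM; exact: p_ideal_retract.
split; first split=> //.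
- by move=> X [].
- move=> X /zero_objectP e; apply: p_ideal_acyclic; exact: (m1_0_acyclic U_replete).
- move=> X; split=> -[/compactP cX hX]; (split=> [|G VG];
    [by apply/compactP; apply/cpt_shiftE|exact/homology_zero_shift/hX]).
- move=> X Y Z u v w [A [B [f [a [b [c [[ia ib ic] _]]]]]]] pX pY.
  have inv (C D : complex k U) (d : dhom C D) : is_iso d -> p_ideal V D -> p_ideal V C.
    by move=> [g [/cl_eq + _]]; rewrite clM; exact: p_ideal_retract.
  apply: (isoP _ _ c ic); apply: p_ideal_cone; first exact: (inv _ _ a ia pX).
  exact: (inv _ _ b ib pY).
- by move=> X Y [i [r /cl_eq]]; rewrite clM; exact: p_ideal_retract.
move=> X Y /compactP cX [/compactP cY hY]; split; first exact/compactP/cpt_tensor.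
(* [tensor_homology_zero] concerns the left factor, whereas the member of the ideal is on the
   right. *)
move=> G VG; apply: (homology_zero_retract (mm_minv (swap_qi Y X))).
exact/tensor_homology_zero/hY.
Qed.

Lemma p_ideal_proper : Defs.proper_ideal (p_ideal (k := k) (U := U) V).
Proof.
(* A concrete group with one element; its sphere has nonzero homology in degree 0. *)
have V1 : V (subg_of (1%G : {group 'S_1})).
  by case: V_mgf => _ h _ _ _; apply: h; rewrite card_sub -[RHS](cards1 (1%g : 'S_1)); apply: eq_card.
pose G : member U := Member (V_sub_U V1).
exists (sph k 0 G); first exact/compactP/cpt_sph.
move=> [_ /(_ G V1)/homology_zeroP h].
have /(h 0) : cyc (sph_u k 0 G) by [].
suff nz : ~ bd (sph_u k 0 G) by [].
have bd0 n (x : sph k 0 G n G) : bd x -> x = 0 by case=> m z.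
(* The functional with value 1 on every basis element shows that the generator is not zero. *)
move/bd0/(congr1 (flift (fun _ => 1 : k^o))).
by rewrite linear0 => /(etrans (esym (fliftE (fun _ => 1 : k^o) _)))/eqP; rewrite oner_eq0.
Qed.

Lemma top_class X : cpt X -> ~ (forall G : member U, V G -> homology_zero X G) ->
  exists m (G : member V) (z : restr V_sub_U X m G),
    [/\ cyc z, ~ bd z & forall n H, m < n -> exact_at (restr V_sub_U X) n H].
Proof.
move=> cX hX; have [b hb] := compact_ind U_replete (bounded_above_building k U_replete) cX.
pose P m := exists (G : member V) (z : restr V_sub_U X m G), cyc z /\ ~ bd z.
have [m Pm] : exists m, P m.
  apply: contra_notP hX => nP G VG; apply/homology_zeroP => n x cx.
  apply: contra_notP nP => nx; exists n, (@Member V G VG).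
  (* The same group carries two proofs of membership in [U], its own and the one coming from [V];
     they are identified before [x] is seen as an element of the restriction. *)
  case: G => G UG in VG x cx nx *; rewrite [member_group _]/= in VG *; have e : UG = V_sub_U VG by apply: Prop_irrelevance.
  by subst UG; exists x; split=> // /restr_bd.
have [t [G [z [cz nz]]] tmax] : exists2 t, P t & forall n, t < n -> ~ P n.
  apply: (int_max (b := b) Pm) => n bn [G [z [cz nz]]]; apply: nz.
  by apply/restr_bd/hb.
exists t, G, z; split=> // n H tn x cx.
by apply: contra_notP (tmax n tn) => nx; exists H, x.
Qed.

(** Contrapositive of [cech_top]: a top class survives multiplication of its group by any [N] in
    [V], which brings the classes of two complexes to a common group. *)
Lemma top_class_res X m (G : member V) (z : restr V_sub_U X m G) (N : finGroupType) (VN : V N) :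
  cpt X -> cyc z -> ~ bd z -> (forall n H, m < n -> exact_at (restr V_sub_U X) n H) ->
  ~ bd (rho_at (V_prod VN) (restr V_sub_U X m) G z).
Proof.
move=> cX cz nz hz; apply: contra_not nz => bz; apply: cech_top bz => //.
exact: cech_compact.
Qed.

Definition pair_swap (A B : finGroupType) (u : A * B) : B * A := (u.2, u.1).
Fact pair_swap_morph (A B : finGroupType) : {morph @pair_swap A B : x y / (x * y)%g}.
Proof. by []. Qed.
Fact pair_swap_surj (A B : finGroupType) y : exists x, @pair_swap A B x = y.
Proof. by case: y => b a; exists (a, b). Qed.
Definition pair_swap_epi (A B : finGroupType) : epi (A * B)%type (B * A)%type :=
  mk_epi (@pair_swap_morph A B) (@pair_swap_surj A B).

Lemma bd_res X n (H G : member U) (e : epi H G) (x : X n G) : bd x -> bd (res (X n) e x).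
Proof. by case=> m z; rewrite -nt_natural; apply: Bd. Qed.

Lemma cyc_res X n (H G : member U) (e : epi H G) (x : X n G) : cyc x -> cyc (res (X n) e x).
Proof. by rewrite /cyc nt_natural => ->; rewrite linear0. Qed.

Lemma p_ideal_prime X Y : compact X -> compact Y -> p_ideal V (tensor X Y) ->
  p_ideal V X \/ p_ideal V Y.
Proof.
move=> /compactP cX /compactP cY [_ hXY].
have [hX|/(top_class cX)[m [G [x [cx nx hx]]]]] :=
  pselect (forall G : member U, V G -> homology_zero X G); first by left; split=> //; apply/compactP.
have [hY|/(top_class cY)[n [H [y [cy ny hy]]]]] :=
  pselect (forall G : member U, V G -> homology_zero Y G); first by right; split=> //; apply/compactP.
(* The two classes reach the product in opposite orders, [H * G] and [G * H]; the exchange [s]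
   brings both to [L]. *)
pose L : member U := inU V_sub_U (xN (V_prod (memberP H)) G).
pose L' : member U := inU V_sub_U (xN (V_prod (memberP G)) H).
pose x' : X m L := rho_at (V_prod (memberP H)) (restr V_sub_U X m) G x.
pose y' : Y n L' := rho_at (V_prod (memberP G)) (restr V_sub_U Y n) H y.
pose s : epi L L' := pair_swap_epi _ _.
pose t : epi L' L := pair_swap_epi _ _.
have nx' : ~ bd x' by move=> /restr_bd; apply: top_class_res.
(* Restricting back along [t], inverse to [s], would make [y'] a boundary. *)
have ny' : ~ bd (res (Y n) s y').
  move=> /(bd_res t); rewrite -res_comp => b; suff /restr_bd : bd y' by apply: top_class_res.
  suff <- : res (Y n) (comp_epi s t) y' = y' by [].
  rewrite -[RHS]res_id; apply: res_conj; apply: epi_conj_ext; by case.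
have /homology_zeroP/(_ _ (tens erefl x' (res (Y n) s y'))) h := hXY L (memberP (xN (V_prod (memberP H)) G)).
case: (tens_not_bd (e := erefl) nx' ny'); apply: h.
rewrite /cyc tensor_dE; have -> : diff X m L x' = 0 by apply: (@cyc_res X m L (inU V_sub_U G)).
have -> : diff Y n L (res (Y n) s y') = 0 by apply: cyc_res; apply: (@cyc_res Y n L' (inU V_sub_U H)).
by rewrite tens0l tens0r scaler0 addr0.
Qed.
End Primality.

Theorem theorem6 (k : fieldType) (char_k : [pchar k]%R =i pred0)
    (U : group_family) (U_replete : replete U) (U_wide : widely_closed U)
    (V : group_family) (V_mgf : multiplicative_global_family V)
    (V_sub_U : forall G : finGroupType, V G -> U G) :
  prime_ideal (p_ideal (k := k) (U := U) V)
  /\ ((forall G : finGroupType, U G <-> V G) ->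
      prime_ideal (zero_ideal (k := k) (U := U))).
Proof.
have pP : prime_ideal (p_ideal (k := k) (U := U) V).
  split; [exact: p_ideal_thick|exact: p_ideal_proper|exact: p_ideal_prime].
(* When the two families have the same groups, vanishing at the groups of [V] is acyclicity, and the
   acyclic complexes are the zero objects. *)
split=> // UV; have -> // : @zero_ideal k U = p_ideal V.
apply/funext => X; apply/propext; split=> -[cX hX]; split=> //.
  by move=> G _; apply: (m1_0_acyclic U_replete); apply/zero_objectP.
apply/zero_objectP/acyclic_m1 => G; apply: hX; exact: (proj1 (UV _) (memberP G)).
Qed.
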